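(* Let $M\subset\mathbb{R}^5$ be an open set with coordinates $(x,y,z,p,r)$ and let $G,H$ be smooth functions on $M$ with $G_r\equiv0$, $G_{pp}\ne0$, $\triangle H=D^3G$, defining a $5$-dimensional para-CR structure via $z_y=G$, $z_{xxx}=H$. Let $\bar\omega^1,\dots,\bar\omega^5$, $I^1,I^2,I^3$, the coframe derivatives $I^3{}_{|3}$, $I^3{}_{|55}$, the system (E), and the questions Q1 and Q2 be as defined in the context. Then: (1) Question Q1 has a positive answer if and only if $I^3{}_{|3}\equiv 0$. In that case the para-CR structure gives rise to the $\mathfrak{sp}(4,\mathbb{R})$-valued Cartan connection $\widehat\omega$, whose curvature has basic invariant $\mathbf{Z_1}\equiv 0$ and basic invariant $\mathbf{A_1}$ proportional (by a nowhere vanishing factor) to the Wünschmann invariant $$9D^2H_r-27DH_p-18H_rDH_r+18H_pH_r+4H_r^3+54H_z .$$ (2) Question Q2 has a positive answer if and only if $I^3{}_{|55}\equiv 0$. In that case the para-CR structure gives rise to the $\mathfrak{sp}(4,\mathbb{R})$-valued Cartan connection $\widehat\omega$, whose curvature has basic invariant $\mathbf{Z_1}\equiv 0$ and basic invariant $\mathbf{A_1}$ proportional (by a nowhere vanishing factor) to the Monge invariant $$40G_{ppp}^3-45G_{pp}G_{ppp}G_{pppp}+9G_{pp}^2G_{ppppp}.$$ (3) Each of the conditions $I^3{}_{|3}\equiv0$ and $I^3{}_{|55}\equiv 0$, considered separately, implies $I^3\equiv 0$. Consequently either of the questions Q1, Q2 has a positive answer if and only if $$2G_{ppp}+G_{pp}H_{rr}\equiv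 0 .$$
   Context: All considerations are local. Notation: $p=z_x$, $r=z_{xx}$, $D=\partial_x+p\,\partial_z+r\,\partial_p+H\,\partial_r$, $\triangle=\partial_y+G\,\partial_z+(DG)\,\partial_p+(D^2G)\,\partial_r$. Put $\omega^1=dz-p\,dx-G\,dy$, $\omega^2=dp-r\,dx-(DG)dy$, $\omega^3=dr-H\,dx-(D^2G)dy$, $\omega^4=dx$, $\omega^5=dy$. The para-CR structure is the class of this coframe modulo para-CR transformations $\omega^1\mapsto f_1\omega^1$, $\omega^2\mapsto f_2\omega^1+\rho e^{\phi}\omega^2+f_4\omega^3$, $\omega^3\mapsto f_5\omega^1+f_6\omega^2+f_7\omega^3$, $\omega^4\mapsto \bar f_2\omega^1+\rho e^{-\phi}\omega^4+\bar f_4\omega^5$, $\omega^5\mapsto\bar f_5\omega^1+\bar f_6\omega^4+\bar f_7\omega^5$ (invertible, coefficients functions). **Adapted coframe (known fact).** There exist forms $\bar\omega^1,\dots,\bar\omega^5$, related to $\omega^1,\dots,\omega^5$ by a para-CR transformation (on a bundle $B$ over $M$ of group parameters), and $1$-forms $\varpi_1,\dots,\varpi_4$, with $\bar\omega^1\wedge\dots\wedge\bar\omega^5\wedge\varpi_1\wedge\dots\wedge\varpi_4\ne0$, and functions such that $$\begin{aligned} d\bar\omega^1&=-\bar\omega^1\wedge\varpi_1+\bar\omega^2\wedge\bar\omega^4,\\ d\bar\omega^2&=-\bar\omega^1\wedge\varpi_3+\bar\omega^2\wedge(\varpi_2-\tfrac12\varpi_1)+\bar\omega^3\wedge\bar\omega^4,\\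 d\bar\omega^3&=-\bar\omega^2\wedge\varpi_3+2\bar\omega^3\wedge\varpi_2+\tfrac18(2I^3{}_{|4}+I^3{}_{|52})\bar\omega^1\wedge\bar\omega^3+I^1\bar\omega^1\wedge\bar\omega^4+I^3\bar\omega^2\wedge\bar\omega^3,\\ d\bar\omega^4&=-\bar\omega^1\wedge\varpi_4-\bar\omega^4\wedge(\varpi_2+\tfrac12\varpi_1)-\bar\omega^2\wedge\bar\omega^5,\\ d\bar\omega^5&=\bar\omega^4\wedge\varpi_4-2\bar\omega^5\wedge\varpi_2+I^2\bar\omega^1\wedge\bar\omega^2+\tfrac18(2I^3{}_{|4}+I^3{}_{|52})\bar\omega^1\wedge\bar\omega^5-\tfrac12I^3{}_{|5}\bar\omega^4\wedge\bar\omega^5, \end{aligned}$$ where the coframe derivatives are defined by $$dI^3=\sum_{i=1}^5I^3{}_{|i}\,\bar\omega^i-\tfrac12I^3\varpi_1+I^3\varpi_2,$$ $$dI^3{}_{|5}=I^3{}_{|51}\bar\omega^1+I^3{}_{|52}\bar\omega^2+4I^3\bar\omega^3+I^3{}_{|54}\bar\omega^4+I^3{}_{|55}\bar\omega^5-\tfrac12I^3{}_{|5}\varpi_1-I^3{}_{|5}\varpi_2 .$$ Moreover $I^1$, $I^2$, $I^3$ are nowhere vanishing multiples, respectively, of $9D^2H_r-27DH_p-18H_rDH_r+18H_pH_r+4H_r^3+54H_z$, of $40G_{ppp}^3-45G_{pp}G_{ppp}G_{pppp}+9G_{pp}^2G_{ppppp}$, and of $2G_{ppp}+G_{pp}H_{rr}$.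 **The system (E)** for a coframe $(\theta^1,\dots,\theta^5,\Omega_1,\dots,\Omega_5)$ on a $10$-manifold $P$, with some functions $\mathbf{A_1},\dots,\mathbf{A_8},\mathbf{Z_1},\dots,\mathbf{Z_4},\mathbf{C_1}$ on $P$ (this is the system characterizing contact equivalence classes of third-order ODEs): $$\begin{aligned} d\theta^1&=\Omega_1\wedge\theta^1+\theta^4\wedge\theta^2,\\ d\theta^2&=\Omega_2\wedge\theta^1+\Omega_3\wedge\theta^2+\theta^4\wedge\theta^3,\\ d\theta^3&=\Omega_2\wedge\theta^2+(2\Omega_3-\Omega_1)\wedge\theta^3+\mathbf{A_2}\theta^2\wedge\theta^1+\mathbf{A_1}\theta^4\wedge\theta^1,\\ d\theta^4&=\Omega_4\wedge\theta^1+(\Omega_1-\Omega_3)\wedge\theta^4+\theta^5\wedge\theta^2,\\ d\theta^5&=\Omega_4\wedge\theta^4+(\Omega_1-2\Omega_3)\wedge\theta^5+(\mathbf{A_7}+\mathbf{Z_3})\theta^1\wedge\theta^2+\mathbf{Z_4}\theta^1\wedge\theta^3-\mathbf{A_5}\theta^1\wedge\theta^4+\mathbf{Z_1}\theta^2\wedge\theta^3,\\ d\Omega_1&=\Omega_5\wedge\theta^1+\Omega_4\wedge\theta^2-\Omega_2\wedge\theta^4,\\ d\Omega_2&=(\Omega_3-\Omega_1)\wedge\Omega_2+\tfrac12\Omega_5\wedge\theta^2+\Omega_4\wedge\theta^3+\mathbf{A_3}\theta^1\wedge\theta^2+\mathbf{A_4}\theta^1\wedge\theta^4,\\ d\Omega_3&=\tfrac12\Omega_5\wedge\theta^1+\Omega_4\wedge\theta^2+\theta^5\wedge\theta^3+\mathbf{A_5}\theta^1\wedge\theta^2+\mathbf{A_2}\theta^1\wedge\theta^4,\\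 d\Omega_4&=\theta^5\wedge\Omega_2+\Omega_4\wedge\Omega_3+\tfrac12\Omega_5\wedge\theta^4+(\mathbf{A_6}+\mathbf{Z_2})\theta^1\wedge\theta^2+2\mathbf{Z_3}\theta^1\wedge\theta^3-\mathbf{A_3}\theta^1\wedge\theta^4+\mathbf{Z_4}\theta^2\wedge\theta^3,\\ d\Omega_5&=\Omega_5\wedge\Omega_1+2\Omega_4\wedge\Omega_2+\mathbf{C_1}\theta^1\wedge\theta^2+2\mathbf{Z_2}\theta^1\wedge\theta^3+\mathbf{A_8}\theta^1\wedge\theta^4+2\mathbf{Z_3}\theta^2\wedge\theta^3. \end{aligned}$$ The associated $\mathfrak{sp}(4,\mathbb{R})$-valued Cartan connection is $$\widehat\omega=\begin{pmatrix}\tfrac12\Omega_1&\tfrac12\Omega_2&-\tfrac12\Omega_4&-\tfrac14\Omega_5\\ \theta^4&\Omega_3-\tfrac12\Omega_1&-\theta^5&-\tfrac12\Omega_4\\ \theta^2&\theta^3&\tfrac12\Omega_1-\Omega_3&-\tfrac12\Omega_2\\ 2\theta^1&\theta^2&-\theta^4&-\tfrac12\Omega_1\end{pmatrix},$$ with curvature $\widehat K=d\widehat\omega+\widehat\omega\wedge\widehat\omega$. The functions $\mathbf{A_i},\mathbf{Z_j},\mathbf{C_1}$ are entries of its coefficients; $\mathbf{A_1}$ and $\mathbf{Z_1}$ are the basic ones. **Question Q1.** Do there exist a $10$-manifold $P$ fibred over $M$ (with $\bar\omega^i$ pulled back to $P$ by a map $P\to B$ over $M$), functions $f_1,f_2,\rho,\phi,f_4,f_5,f_6,f_7,\bar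 f_2,\bar f_4,\bar f_5,\bar f_6,\bar f_7$ on $P$ and $1$-forms $\Omega_1,\dots,\Omega_5$ on $P$, such that the forms $$\begin{aligned}\theta^1&=f_1\bar\omega^1,\quad \theta^2=f_2\bar\omega^1+\rho e^\phi\bar\omega^2+f_4\bar\omega^3,\quad \theta^3=f_5\bar\omega^1+f_6\bar\omega^2+f_7\bar\omega^3,\\ \theta^4&=\bar f_2\bar\omega^1+\rho e^{-\phi}\bar\omega^4+\bar f_4\bar\omega^5,\quad \theta^5=\bar f_5\bar\omega^1+\bar f_6\bar\omega^4+\bar f_7\bar\omega^5\end{aligned}$$ together with $\Omega_1,\dots,\Omega_5$ form a coframe on $P$ satisfying (E)? **Question Q2.** The same question after the flip $(\bar\omega^2,\bar\omega^3)\leftrightarrow(\bar\omega^4,\bar\omega^5)$, i.e. with $$\begin{aligned}\theta^1&=f_1\bar\omega^1,\quad \theta^2=f_2\bar\omega^1+\rho e^\phi\bar\omega^4+f_4\bar\omega^5,\quad \theta^3=f_5\bar\omega^1+f_6\bar\omega^4+f_7\bar\omega^5,\\ \theta^4&=\bar f_2\bar\omega^1+\rho e^{-\phi}\bar\omega^2+\bar f_4\bar\omega^3,\quad \theta^5=\bar f_5\bar\omega^1+\bar f_6\bar\omega^2+\bar f_7\bar\omega^3.\end{aligned}$$ *)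

(* Defs.v *)
From mathcomp Require Import all_boot all_order all_algebra.
From mathcomp Require Import all_classical all_reals all_analysis.

Set Implicit Arguments.
Unset Strict Implicit.
Unset Printing Implicit Defensive.

Import Order.TTheory GRing.Theory Num.Theory.
Import numFieldNormedType.Exports.
Local Open Scope classical_set_scope.
Local Open Scope ring_scope.

(* Everything lives on open subsets of R^n = 'rV[R]_n.  Scalar functions, maps
   and forms are total Rocq functions, constrained only on the open set under
   consideration.  A 1-form is the row of its coefficients on dx_0,...,dx_(n-1);
   a 2-form is the skew matrix of its values on pairs of coordinate fields. *)
Notation scal R n := ('rV[R]_n -> R) (only parsing).
Notation form1 R n := ('rV[R]_n -> 'rV[R]_n) (only parsing).
Notation form2 R n := ('rV[R]_n -> 'M[R]_n) (only parsing).

Section Calculus.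
Variables (R : realType) (n : nat).
Implicit Types (U : set 'rV[R]_n) (f : scal R n) (a b : form1 R n).

Definition pd (i : 'I_n) f : scal R n := fun x => 'D_(delta_mx 0 i) f x.

(* C^infinity: all iterated partial derivatives exist and are continuous on U *)
Definition smooth U f : Prop :=
  forall (s : seq 'I_n) (x : 'rV[R]_n), U x ->
    {for x, continuous (foldr pd f s)} /\
    forall i : 'I_n, derivable (foldr pd f s) x (delta_mx 0 i).

Definition smooth_map m U (F : 'rV[R]_n -> 'rV[R]_m) : Prop :=
  forall j : 'I_m, smooth U (fun x => F x 0 j).

(* F : U -> M is a smooth surjective submersion; the library's 'J F x acts on
   tangent row vectors from the right, so "onto" is row_full. *)
Definition fibred m U (M : set 'rV[R]_m) (F : 'rV[R]_n -> 'rV[R]_m) : Prop :=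
  [/\ smooth_map U F, F @` U = M & forall x, U x -> row_full ('J F x)].

Definition dcoord (i : 'I_n) : form1 R n := fun=> delta_mx 0 i.

Definition grad f : form1 R n := fun x => \row_i pd i f x.

Definition fscale (V : lmodType R) f (a : 'rV[R]_n -> V) : 'rV[R]_n -> V :=
  fun x => f x *: a x.

(* (a /\ b)(u, v) = a(u) b(v) - a(v) b(u) *)
Definition wedge a b : form2 R n :=
  fun x => \matrix_(i, j) (a x 0 i * b x 0 j - a x 0 j * b x 0 i).

(* (da)(u, v) = u(a(v)) - v(a(u)) for coordinate fields u, v *)
Definition ext_d a : form2 R n :=
  fun x => \matrix_(i, j) (pd i (fun y => a y 0 j) x - pd j (fun y => a y 0 i) x).

(* n pointwise independent 1-forms, i.e. with nowhere vanishing total wedge *)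
Definition coframe U (s : seq (form1 R n)) : Prop :=
  size s = n /\
  forall x, U x -> \matrix_(i < n) (nth (fun=> 0) s i x) \in unitmx.

Definition pullback m (F : 'rV[R]_n -> 'rV[R]_m) (a : form1 R m) : form1 R n :=
  fun x => a (F x) *m ('J F x)^T.

Definition vanishes U f : Prop := {in U, f =1 fun=> 0}.

Definition nonvanishing_multiple U f g : Prop :=
  exists l : scal R n, [/\ smooth U l, forall x, U x -> l x != 0 &
    {in U, f =1 fun x => l x * g x}].

End Calculus.

Declare Scope dform_scope.
Delimit Scope dform_scope with F.
Notation "f :* a" := (fscale f a) : dform_scope.
Notation "a \w b" := (wedge a b) (at level 40, left associativity) : dform_scope.

Record quint (T : Type) := Quint { q1 : T; q2 : T; q3 : T; q4 : T; q5 : T }.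

Definition quint_map (S T : Type) (f : S -> T) (w : quint S) : quint T :=
  Quint (f (q1 w)) (f (q2 w)) (f (q3 w)) (f (q4 w)) (f (q5 w)).

Definition quint_seq (T : Type) (w : quint T) : seq T :=
  [:: q1 w; q2 w; q3 w; q4 w; q5 w].

Definition quint_all (T : Type) (P : T -> Prop) (w : quint T) : Prop :=
  [/\ P (q1 w), P (q2 w), P (q3 w), P (q4 w) & P (q5 w)].

Section ParaCR.
Variable R : realType.

(* Coordinates (x, y, z, p, r) of R^5; p = z_x and r = z_xx. *)
Definition ix : 'I_5 := @Ordinal 5 0 isT.
Definition iy : 'I_5 := @Ordinal 5 1 isT.
Definition iz : 'I_5 := @Ordinal 5 2 isT.
Definition ip : 'I_5 := @Ordinal 5 3 isT.
Definition ir : 'I_5 := @Ordinal 5 4 isT.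

Definition Dx (H f : scal R 5) : scal R 5 := fun m =>
  pd ix f m + m 0 ip * pd iz f m + m 0 ir * pd ip f m + H m * pd ir f m.

Definition Dy (G H f : scal R 5) : scal R 5 := fun m =>
  pd iy f m + G m * pd iz f m + Dx H G m * pd ip f m
  + Dx H (Dx H G) m * pd ir f m.

Definition para_CR (M : set 'rV[R]_5) (G H : scal R 5) : Prop :=
  [/\ open M, smooth M G /\ smooth M H,
      vanishes M (pd ir G),
      forall m, M m -> pd ip (pd ip G) m != 0 &
      {in M, Dy G H H =1 Dx H (Dx H (Dx H G))}].

Local Open Scope dform_scope.

Definition para_CR_coframe (G H : scal R 5) : quint (form1 R 5) := Quint
  (dcoord iz - (fun m => m 0 ip) :* dcoord ix - G :* dcoord iy)
  (dcoord ip - (fun m => m 0 ir) :* dcoord ix - Dx H G :* dcoord iy)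
  (dcoord ir - H :* dcoord ix - Dx H (Dx H G) :* dcoord iy)
  (dcoord ix)
  (dcoord iy).

Definition wunschmann (H : scal R 5) : scal R 5 := fun m =>
  9 * Dx H (Dx H (pd ir H)) m - 27 * Dx H (pd ip H) m
  - 18 * pd ir H m * Dx H (pd ir H) m + 18 * pd ip H m * pd ir H m
  + 4 * pd ir H m ^+ 3 + 54 * pd iz H m.

Definition monge (G : scal R 5) : scal R 5 := fun m =>
  let G2 := pd ip (pd ip G) in
  let G3 := pd ip G2 in let G4 := pd ip G3 in let G5 := pd ip G4 in
  40 * G3 m ^+ 3 - 45 * G2 m * G3 m * G4 m + 9 * G2 m ^+ 2 * G5 m.

Definition GH_invariant (G H : scal R 5) : scal R 5 := fun m =>
  2 * pd ip (pd ip (pd ip G)) m + pd ip (pd ip G) m * pd ir (pd ir H) m.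

Record pcr_coeffs (n : nat) := PcrCoeffs {
  cf1 : scal R n; cf2 : scal R n; crho : scal R n; cphi : scal R n;
  cf4 : scal R n; cf5 : scal R n; cf6 : scal R n; cf7 : scal R n;
  cbf2 : scal R n; cbf4 : scal R n;
  cbf5 : scal R n; cbf6 : scal R n; cbf7 : scal R n }.

Definition smooth_coeffs n (U : set 'rV[R]_n) (c : pcr_coeffs n) : Prop :=
  [/\ smooth U (cf1 c), smooth U (cf2 c), smooth U (crho c), smooth U (cphi c) &
   [/\ smooth U (cf4 c), smooth U (cf5 c), smooth U (cf6 c), smooth U (cf7 c) &
    [/\ smooth U (cbf2 c), smooth U (cbf4 c), smooth U (cbf5 c),
        smooth U (cbf6 c) & smooth U (cbf7 c)]]].

(* determinants of the diagonal blocks of a (block triangular) transformation *)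
Definition invertible_coeffs n (U : set 'rV[R]_n) (c : pcr_coeffs n) : Prop :=
  forall x, U x -> [/\ cf1 c x != 0,
    crho c x * expR (cphi c x) * cf7 c x - cf4 c x * cf6 c x != 0 &
    crho c x * expR (- cphi c x) * cbf7 c x - cbf4 c x * cbf6 c x != 0].

Definition pcr_transform n (c : pcr_coeffs n) (w : quint (form1 R n)) :
    quint (form1 R n) := Quint
  (cf1 c :* q1 w)
  (cf2 c :* q1 w + (fun x => crho c x * expR (cphi c x)) :* q2 w
    + cf4 c :* q3 w)
  (cf5 c :* q1 w + cf6 c :* q2 w + cf7 c :* q3 w)
  (cbf2 c :* q1 w + (fun x => crho c x * expR (- cphi c x)) :* q4 w
    + cbf4 c :* q5 w)
  (cbf5 c :* q1 w + cbf6 c :* q4 w + cbf7 c :* q5 w).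

Definition flip n (w : quint (form1 R n)) : quint (form1 R n) :=
  Quint (q1 w) (q4 w) (q5 w) (q2 w) (q3 w).

(* The structure equations of the adapted coframe w on B, with connection forms
   v1, ..., v4.  dI3 = (I^3_{|1}, ..., I^3_{|5}) and
   dI35 = (I^3_{|51}, ..., I^3_{|55}) are the coframe derivatives. *)
Definition adapted_equations (B : set 'rV[R]_9) (w : quint (form1 R 9))
    (v1 v2 v3 v4 : form1 R 9) (I1 I2 I3 : scal R 9)
    (dI3 dI35 : quint (scal R 9)) : Prop :=
  let: Quint w1 w2 w3 w4 w5 := w in
  let: Quint I31 I32 I33 I34 I35 := dI3 in
  let: Quint I351 I352 I353 I354 I355 := dI35 in
  let T : scal R 9 := fun b => 8^-1 * (2 * I34 b + I352 b) in
  [/\ {in B, ext_d w1 =1 - (w1 \w v1) + w2 \w w4},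
      {in B, ext_d w2 =1 - (w1 \w v3) + w2 \w (v2 - 2^-1 *: v1) + w3 \w w4},
      {in B, ext_d w3 =1 - (w2 \w v3) + 2 *: (w3 \w v2) + T :* (w1 \w w3)
                         + I1 :* (w1 \w w4) + I3 :* (w2 \w w3)},
      {in B, ext_d w4 =1 - (w1 \w v4) - w4 \w (v2 + 2^-1 *: v1) - w2 \w w5} &
      {in B, ext_d w5 =1 w4 \w v4 - 2 *: (w5 \w v2) + I2 :* (w1 \w w2)
                         + T :* (w1 \w w5) - 2^-1 *: (I35 :* (w4 \w w5))}]
  /\
  [/\ {in B, grad I3 =1 I31 :* w1 + I32 :* w2 + I33 :* w3 + I34 :* w4
                        + I35 :* w5 - 2^-1 *: (I3 :* v1) + I3 :* v2},
      {in B, grad I35 =1 I351 :* w1 + I352 :* w2 + I353 :* w3 + I354 :* w4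
                         + I355 :* w5 - 2^-1 *: (I35 :* v1) - I35 :* v2} &
      {in B, I353 =1 fun b => 4 * I3 b}].

(* w is an adapted coframe of the para-CR structure (M, G, H) on the bundle
   piB : B -> M of group parameters, with its invariants I1, I2, I3. *)
Definition adapted_coframe (M : set 'rV[R]_5) (G H : scal R 5)
    (B : set 'rV[R]_9) (piB : 'rV[R]_9 -> 'rV[R]_5) (w : quint (form1 R 9))
    (v1 v2 v3 v4 : form1 R 9) (I1 I2 I3 : scal R 9)
    (dI3 dI35 : quint (scal R 9)) : Prop :=
  [/\ open B, fibred B M piB,
      (exists c : pcr_coeffs 9,
        [/\ smooth_coeffs B c, invertible_coeffs B c &
            let w' := pcr_transform c
                        (quint_map (pullback piB) (para_CR_coframe G H)) in
            [/\ {in B, q1 w =1 q1 w'}, {in B, q2 w =1 q2 w'},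
                {in B, q3 w =1 q3 w'}, {in B, q4 w =1 q4 w'} &
                {in B, q5 w =1 q5 w'}]]),
      [/\ smooth_map B v1, smooth_map B v2, smooth_map B v3 &
          smooth_map B v4] /\
        coframe B (quint_seq w ++ [:: v1; v2; v3; v4]) &
  [/\ [/\ smooth B I1, smooth B I2 & smooth B I3],
      quint_all (smooth B) dI3 /\ quint_all (smooth B) dI35,
      adapted_equations B w v1 v2 v3 v4 I1 I2 I3 dI3 dI35 &
      [/\ nonvanishing_multiple B I1 (wunschmann H \o piB),
          nonvanishing_multiple B I2 (monge G \o piB) &
          nonvanishing_multiple B I3 (GH_invariant G H \o piB)]]].

Record E_functions := EFunctions {
  fA1 : scal R 10; fA2 : scal R 10; fA3 : scal R 10; fA4 : scal R 10;
  fA5 : scal R 10; fA6 : scal R 10; fA7 : scal R 10; fA8 : scal R 10;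
  fZ1 : scal R 10; fZ2 : scal R 10; fZ3 : scal R 10; fZ4 : scal R 10;
  fC1 : scal R 10 }.

Definition smooth_E_functions (P : set 'rV[R]_10) (k : E_functions) : Prop :=
  [/\ smooth P (fA1 k), smooth P (fA2 k), smooth P (fA3 k), smooth P (fA4 k) &
   [/\ smooth P (fA5 k), smooth P (fA6 k), smooth P (fA7 k), smooth P (fA8 k) &
    [/\ smooth P (fZ1 k), smooth P (fZ2 k), smooth P (fZ3 k), smooth P (fZ4 k) &
        smooth P (fC1 k)]]].

Definition system_E (P : set 'rV[R]_10) (t O : quint (form1 R 10))
    (k : E_functions) : Prop :=
  let: Quint t1 t2 t3 t4 t5 := t in
  let: Quint O1 O2 O3 O4 O5 := O in
  let: EFunctions A1 A2 A3 A4 A5 A6 A7 A8 Z1 Z2 Z3 Z4 C1 := k in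
  [/\ {in P, ext_d t1 =1 O1 \w t1 + t4 \w t2},
      {in P, ext_d t2 =1 O2 \w t1 + O3 \w t2 + t4 \w t3},
      {in P, ext_d t3 =1 O2 \w t2 + (2 *: O3 - O1) \w t3
                         + A2 :* (t2 \w t1) + A1 :* (t4 \w t1)},
      {in P, ext_d t4 =1 O4 \w t1 + (O1 - O3) \w t4 + t5 \w t2} &
      {in P, ext_d t5 =1 O4 \w t4 + (O1 - 2 *: O3) \w t5
                         + (A7 + Z3) :* (t1 \w t2) + Z4 :* (t1 \w t3)
                         - A5 :* (t1 \w t4) + Z1 :* (t2 \w t3)}]
  /\
  [/\ {in P, ext_d O1 =1 O5 \w t1 + O4 \w t2 - O2 \w t4},
      {in P, ext_d O2 =1 (O3 - O1) \w O2 + 2^-1 *: (O5 \w t2) + O4 \w t3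
                         + A3 :* (t1 \w t2) + A4 :* (t1 \w t4)},
      {in P, ext_d O3 =1 2^-1 *: (O5 \w t1) + O4 \w t2 + t5 \w t3
                         + A5 :* (t1 \w t2) + A2 :* (t1 \w t4)},
      {in P, ext_d O4 =1 t5 \w O2 + O4 \w O3 + 2^-1 *: (O5 \w t4)
                         + (A6 + Z2) :* (t1 \w t2) + 2 *: (Z3 :* (t1 \w t3))
                         - A3 :* (t1 \w t4) + Z4 :* (t2 \w t3)} &
      {in P, ext_d O5 =1 O5 \w O1 + 2 *: (O4 \w O2) + C1 :* (t1 \w t2)
                         + 2 *: (Z2 :* (t1 \w t3)) + A8 :* (t1 \w t4)
                         + 2 *: (Z3 :* (t2 \w t3))}].

(* (P, piP, s, c, O, k) answers the question positively for the forms w on B: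
   the theta's are the forms pcr_transform c (s^* w).  Question Q1 is asked for
   the adapted coframe w itself, and Q2 for flip w. *)
Definition E_solution (M : set 'rV[R]_5) (B : set 'rV[R]_9)
    (piB : 'rV[R]_9 -> 'rV[R]_5) (w : quint (form1 R 9))
    (P : set 'rV[R]_10) (piP : 'rV[R]_10 -> 'rV[R]_5)
    (s : 'rV[R]_10 -> 'rV[R]_9) (c : pcr_coeffs 10)
    (O : quint (form1 R 10)) (k : E_functions) : Prop :=
  let t := pcr_transform c (quint_map (pullback s) w) in
  [/\ open P /\ fibred P M piP,
      [/\ smooth_map P s, s @` P `<=` B & {in P, piB \o s =1 piP}],
      [/\ smooth_coeffs P c, quint_all (@smooth_map R 10 10 P) O &
          smooth_E_functions P k],
      coframe P (quint_seq t ++ quint_seq O) &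
      system_E P t O k].

Definition question (M : set 'rV[R]_5) (B : set 'rV[R]_9)
    (piB : 'rV[R]_9 -> 'rV[R]_5) (w : quint (form1 R 9)) : Prop :=
  exists P piP s c O k, E_solution M B piB w P piP s c O k.

Definition Q1 M B piB w : Prop := question M B piB w.
Definition Q2 M B piB w : Prop := question M B piB (flip w).

Definition omega_hat (t O : quint (form1 R 10)) : 'M[form1 R 10]_4 :=
  let: Quint t1 t2 t3 t4 t5 := t in
  let: Quint O1 O2 O3 O4 O5 := O in
  let h : R := 2^-1 in
  \matrix_(i, j) nth 0 (nth [::] [::
    [:: h *: O1; h *: O2; - (h *: O4); - (4^-1 *: O5)];
    [:: t4; O3 - h *: O1; - t5; - (h *: O4)];
    [:: t2; t3; h *: O1 - O3; - (h *: O2)];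
    [:: 2 *: t1; t2; - t4; - (h *: O1)]] i) j.

Definition curvature (om : 'M[form1 R 10]_4) (i j : 'I_4) : form2 R 10 :=
  ext_d (om i j) + \sum_(l < 4) (om i l \w om l j).

Definition i40 : 'I_4 := @Ordinal 4 0 isT.
Definition i41 : 'I_4 := @Ordinal 4 1 isT.
Definition i42 : 'I_4 := @Ordinal 4 2 isT.
Definition i43 : 'I_4 := @Ordinal 4 3 isT.

Definition sympl : 'M[R]_4 :=
  delta_mx i40 i43 + delta_mx i41 i42 - delta_mx i42 i41 - delta_mx i43 i40.

Definition sp4 (X : 'M[R]_4) : Prop := X^T *m sympl + sympl *m X = 0.

(* The isotropy subalgebra: the elements of sp(4,R) at which the entries
   theta^1, ..., theta^5 of omega_hat vanish. *)
Definition isotropy (X : 'M[R]_4) : Prop :=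
  [/\ sp4 X, is_trig_mx X^T & X i41 i42 = 0].

Definition eval_om (om : 'M[form1 R 10]_4) (q v : 'rV[R]_10) : 'M[R]_4 :=
  \matrix_(i, j) (om i j q *m v^T) 0 0.

(* Local form of a Cartan connection on piP : P -> M: an sp(4,R)-valued
   parallelism carrying exactly the vertical vectors into the isotropy algebra,
   with horizontal curvature.  The last condition is the infinitesimal
   equivariance L_{X^*} om = - ad(X) om along the fundamental vector fields
   X^* = om^-1(X), X in the isotropy algebra. *)
Definition sp4_Cartan_connection (P : set 'rV[R]_10)
    (piP : 'rV[R]_10 -> 'rV[R]_5) (om : 'M[form1 R 10]_4) : Prop :=
  forall q, P q ->
  [/\ forall v, sp4 (eval_om om q v),
      forall X, sp4 X -> exists! v, eval_om om q v = X,
      forall v, v *m 'J piP q = 0 <-> isotropy (eval_om om q v) &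
      forall (v : 'rV_10) i j, v *m 'J piP q = 0 -> v *m curvature om i j q = 0].

(* A1 and Z1 are read off the (3,2) and (2,3) entries of the curvature. *)
Definition basic_curvature_entries (P : set 'rV[R]_10)
    (t O : quint (form1 R 10)) (k : E_functions) : Prop :=
  let K := curvature (omega_hat t O) in
  {in P, K i42 i41 =1 fA1 k :* (q4 t \w q1 t) + fA2 k :* (q2 t \w q1 t)} /\
  {in P, K i41 i42 =1 - (fZ1 k :* (q2 t \w q3 t)
                         + (fA7 k + fZ3 k) :* (q1 t \w q2 t)
                         + fZ4 k :* (q1 t \w q3 t) - fA5 k :* (q1 t \w q4 t))}.

Definition gives_Cartan_connection (M : set 'rV[R]_5) (B : set 'rV[R]_9)
    (piB : 'rV[R]_9 -> 'rV[R]_5) (w : quint (form1 R 9))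
    (inv : scal R 5) : Prop :=
  forall P piP s c O k, E_solution M B piB w P piP s c O k ->
  let t := pcr_transform c (quint_map (pullback s) w) in
  [/\ sp4_Cartan_connection P piP (omega_hat t O),
      basic_curvature_entries P t O k,
      vanishes P (fZ1 k) &
      nonvanishing_multiple P (fA1 k) (inv \o piP)].

End ParaCR.

(* Main.v *)
Require Import Defs.
From HB Require Import structures.
From mathcomp Require Import all_boot all_order all_algebra.
From mathcomp Require Import all_classical all_reals all_analysis.
From mathcomp Require Import ring lra.

Set Implicit Arguments.
Unset Strict Implicit.
Unset Printing Implicit Defensive.

Import Order.TTheory GRing.Theory Num.Theory.
Import numFieldNormedType.Exports.
Local Open Scope classical_set_scope.
Local Open Scope ring_scope.

(** Write a = rho e^phi and b = rho e^-phi.  Evaluated on the vectors that are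
    dual to the adapted coframe and annihilated by the Omega's, the equations (E)
    for d theta^1, ..., d theta^5 determine the group parameters one after the
    other: f4 = bf4 = 0, f1 = -ab, f7 = -a/b, bf7 = b/a, f6 = -f2/b,
    bf6 = -bf2/a, f5 = f2^2/(2 f1).  What is left of these equations says that
    I^3 = I^3_{|5} = 0, Z1 = 0 and A1 = -I^1/b^3.

    Conversely, if I^3 = 0 then I^1 and I^2 are the only torsion left, and
    theta = (-w1, w2, -w3, w4, w5) solves the theta equations on B with
    Omega_1 = v1, Omega_3 = v1/2 - v2 and Omega_2, Omega_4 equal to -v3, -v4 up to
    multiples of theta^1.  By d^2 = 0 the curvature of these forms is horizontal
    once Omega_5 is the contraction of d Omega_1 with the first dual vector, up to a
    multiple of theta^1.  The tenth dimension is a gauge parameter: P = B x R.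

    The substitution (w1, w2, w3, w4, w5) -> (-w1, w4, w5, w2, w3) preserves the
    structure equations and exchanges I^3 with -I^3_{|5}/2 and I^1 with -I^2, which
    reduces Q2 to Q1.  Finally, d(d I^3) = 0 on the dual vectors e3, e5 gives
    3 I^3 = 0 if I^3_{|3} = 0, and d(d I^3_{|5}) = 0 gives I^3_{|5} = 0, hence
    4 I^3 = 0, if I^3_{|55} = 0. *)

(** * Differential calculus on open sets of R^n *)

(** Tested on vectors, an identity between forms becomes one between real numbers that is linear in
    the unknown derivatives and curvature values, so each step is an elimination. The Omega's never
    have to be solved for. The derivatives of the group parameters are removed by differentiating
    the relations already found, which is why each relation is established on the whole open set
    before the next one.

    The multiples of theta^1 in Omega_2, Omega_4 and Omega_5 are forced by repetitions in (E): A2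
    occurs in d theta^3 and in d Omega_3, A5 in d theta^5 and in d Omega_3, and A3 occurs with
    opposite signs in d Omega_2 and d Omega_4.

    The isotropy algebra in sp(4,R) has dimension five, the fibres of B over M only dimension four.
    The missing generator is the corner matrix E_14, whose entry in the connection is a multiple of
    Omega_5. *)

Section MeanValue.
Variables (R : realType) (n : nat).
Implicit Types (U : set 'rV[R]_n) (f : scal R n) (x y : 'rV[R]_n).

Lemma is_derive_line f y (v : 'rV[R]_n) (t : R) :
  derivable f (y + t *: v) v ->
  is_derive t 1 (fun s : R => f (y + s *: v)) ('D_v f (y + t *: v)).
Proof.
have E : (fun h : R => h^-1 *: (((fun s : R => f (y + s *: v)) \o shift t) (h *: 1)
            - f (y + t *: v)))
  = (fun h : R => h^-1 *: ((f \o shift (y + t *: v)) (h *: v) - f (y + t *: v))).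
  apply/funext => h /=; congr (_ *: (f _ - _)).
  by rewrite [h *: 1]mulr1 scalerDl addrCA.
by move=> df; split; rewrite /derivable /derive E.
Qed.

(** Only derivability in the single direction [v] is asked, for |t| <= |s|, so that the lemma
    applies to functions known through their partial derivatives alone. *)
Lemma mean_value_line f y (v : 'rV[R]_n) (s : R) :
  (forall t, `|t| <= `|s| -> derivable f (y + t *: v) v) ->
  exists2 t, `|t| <= `|s| & f (y + s *: v) - f y = 'D_v f (y + t *: v) * s.
Proof.
move=> df.
have mv a b : a <= b -> (forall t, a <= t <= b -> `|t| <= `|s|) ->
    exists2 t, `|t| <= `|s| &
      f (y + b *: v) - f (y + a *: v) = 'D_v f (y + t *: v) * (b - a).
  move=> ab abs.
  have dl t : a <= t <= b ->
      is_derive t 1 (fun s : R => f (y + s *: v)) ('D_v f (y + t *: v)).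
    by move=> tab; apply/is_derive_line/df/abs.
  have [||c] := @MVT_segment R (fun s : R => f (y + s *: v)) (fun t => 'D_v f (y + t *: v)) a b ab.
  - by move=> t; rewrite in_itv /= => /andP[at_ tb]; apply: dl; rewrite !ltW.
  - apply: derivable_within_continuous => t; rewrite in_itv /= => tab.
    by have [] := dl t tab.
  by rewrite in_itv /= => /abs cs ->; exists c.
have [s0|/ltW s0] := leP 0 s.
  have [||t ts] := mv 0 s => // [t /andP[t0 ts]|].
    by rewrite !ger0_norm.
  by rewrite scale0r addr0 subr0 => ->; exists t.
have [||t ts] := mv s 0 => // [t /andP[st t0]|].
  by rewrite !ler0_norm // lerN2.
rewrite scale0r addr0 sub0r => E; exists t => //.
by rewrite -[LHS]opprB E mulrN opprK.
Qed.

(** Truncation to the first [k] coordinates: the points x + [part h k] are the corners of a path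
    from x to x + h with edges parallel to the axes. *)
Let part (h : 'rV[R]_n) (k : nat) : 'rV[R]_n := \row_j (if (j < k)%N then h 0 j else 0).

Let partS (h : 'rV[R]_n) (k : 'I_n) : part h k.+1 = part h k + h 0 k *: delta_mx 0 k.
Proof.
apply/rowP => j; rewrite !mxE /= ltnS leq_eqVlt eq_sym.
case: (eqVneq k j) => [->|kj]; first by rewrite eqxx ltnn /= mulr1 add0r.
rewrite [_ == _ :> nat](_ : _ = false) ?mulr0 ?addr0 //.
by apply/negbTE; apply: contra_neq kj => /val_inj ->.
Qed.

Lemma norm_coord_le (h : 'rV[R]_n) j : `|h 0 j| <= `|h|.
Proof.
by rewrite [leRHS]/Num.Def.normr/= mx_normrE; exact: (le_bigmax _ (fun i => `|h i.1 i.2|) (0, j)).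
Qed.

Lemma norm_rV_le (h : 'rV[R]_n) c : 0 <= c -> (forall j, `|h 0 j| <= c) -> `|h| <= c.
Proof.
move=> c0 hc; rewrite [leLHS]/Num.Def.normr/= mx_normrE; apply: bigmax_le => // -[i j] _ /=.
by rewrite ord1; exact: hc.
Qed.

Definition pdiff f x (h : 'rV[R]_n) : R := \sum_i h 0 i * pd i f x.

Lemma pdiff_linear f x : linear (pdiff f x).
Proof.
move=> c g h; rewrite /pdiff scaler_sumr -big_split /=; apply: eq_bigr => i _.
by rewrite !mxE mulrDl -mulrA.
Qed.

HB.instance Definition _ f x :=
  GRing.isLinear.Build R 'rV[R]_n R *:%R (pdiff f x) (pdiff_linear f x).

Lemma pdiff_continuous f x : continuous (pdiff f x).
Proof.
apply: continuous_big => [|i _ h]; first exact: add_continuous.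
apply: (@continuousM _ _ (fun h : 'rV[R]_n => h 0 i)); last exact: cst_continuous.
exact: (@coord_continuous R 1 n 0 i).
Qed.

(** The increment telescopes along the axis-parallel path. On each edge the mean value theorem turns
    it into a partial derivative at a nearby point, which continuity compares with the one at x. *)
Lemma C1_taylor U f x : open U -> U x ->
  (forall y, U y -> forall i, derivable f y (delta_mx 0 i)) ->
  (forall i, {for x, continuous (pd i f)}) ->
  f \o shift x = cst (f x) + pdiff f x +o_ (0 : 'rV[R]_n) id.
Proof.
move=> oU Ux df cdf; apply/eqaddoP => _/posnumP[eps].
(* The share of each of the n edges; dividing by [n.+1] keeps the quotient meaningful when n = 0. *)
have e'0 : 0 < eps%:num / n.+1%:R by rewrite divr_gt0.
have : \forall y \near x, U y /\ forall i, `|pd i f x - pd i f y| <= eps%:num / n.+1%:R.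
  apply: filterI; first exact: open_nbhs_nbhs.
  have cd i : \forall y \near x, `|pd i f x - pd i f y| <= eps%:num / n.+1%:R.
    by move/cvgrPdist_le: (cdf i) => /(_ _ e'0).
  by have := @filter_forall _ 'I_n _ _ _ cd; apply.
move/nbhs_ballP => [d /= d0]; rewrite -ball_normE => Hd.
apply/nbhs_ballP; exists d => //= h; rewrite -ball_normE /ball_ /= sub0r normrN => hd.
have part_le k : `|part h k| <= `|h|.
  by apply: norm_rV_le => // j; rewrite mxE; case: ifP => _; rewrite ?normr0 ?norm_coord_le.
have Hp (i : 'I_n) t : `|t| <= `|h 0 i| ->
    U (x + part h i + t *: delta_mx 0 i) /\
    forall j, `|pd j f x - pd j f (x + part h i + t *: delta_mx 0 i)| <= eps%:num / n.+1%:R.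
  move=> th; apply: Hd; rewrite /ball_ /= -addrA opprD addNKr normrN.
  apply: le_lt_trans hd; apply: norm_rV_le => // j; rewrite !mxE /=.
  case: (eqVneq j i) => [->|ji] /=; first by rewrite ltnn add0r mulr1 (le_trans th) ?norm_coord_le.
  by rewrite mulr0 addr0; case: ifP => _; rewrite ?normr0 ?norm_coord_le.
have -> : (f \o shift x - (cst (f x) + pdiff f x)) h =
    \sum_(i < n) (f (x + part h i + h 0 i *: delta_mx 0 i) - f (x + part h i) - h 0 i * pd i f x).
  transitivity (f (h + x) - f x - pdiff f x h).
    rewrite -[LHS]/(f (h + x) - (f x + pdiff f x h)). by ring.
  rewrite /pdiff.
  under [RHS]eq_bigr => i _ do rewrite -[x + _ + _]addrA -partS.
  rewrite [RHS]big_split /= sumrN -(big_mkord xpredT (fun i => f (x + part h i.+1) - f (x + part h i))).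
  rewrite telescope_sumr //; congr (f _ - f _ - _).
    rewrite addrC; congr (_ + _); apply/rowP => j; by rewrite mxE ltn_ord.
  by rewrite -[LHS]addr0; congr (_ + _); apply/rowP => j; rewrite !mxE.
apply: (@le_trans _ _ (\sum_(i < n) (eps%:num / n.+1%:R) * `|h|)).
  apply: le_trans (ler_norm_sum _ _ _) _; apply: ler_sum => i _.
  have [t ti|t th ->] := @mean_value_line f (x + part h i) (delta_mx 0 i) (h 0 i).
    by have [Ut _] := Hp i t ti; exact: df.
  rewrite [h 0 i * _]mulrC -mulrBl normrM ler_pM ?norm_coord_le //.
  by have [_ /(_ i)] := Hp i t th; rewrite distrC.
rewrite sumr_const card_ord -mulrnAl ler_wpM2r // -mulr_natr.
rewrite -mulrA ler_piMr // mulrC ler_pdivrMr // mul1r ler_nat //.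
Qed.

Lemma C1_diff U f x : open U -> U x ->
  (forall y, U y -> forall i, derivable f y (delta_mx 0 i)) ->
  (forall i, {for x, continuous (pd i f)}) ->
  differentiable f x /\ forall h, 'd f x h = pdiff f x h.
Proof.
move=> oU Ux df cdf.
have dE : 'd f x = pdiff f x :> (scal R n).
  by apply: diff_unique; [exact: pdiff_continuous|exact: (C1_taylor oU Ux)].
split=> [|h]; last by rewrite dE.
apply/diff_locallyP; rewrite dE; split; first exact: pdiff_continuous.
exact: (C1_taylor oU Ux).
Qed.

(* Both mixed derivatives are limits of the second difference quotient. *)
Lemma schwarz U f x (i j : 'I_n) : open U -> U x ->
  (forall y, U y -> forall k, derivable f y (delta_mx 0 k)) ->
  (forall y, U y -> forall k l, derivable (pd k f) y (delta_mx 0 l)) ->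
  (forall k l, {for x, continuous (pd l (pd k f))}) ->
  pd i (pd j f) x = pd j (pd i f) x.
Proof.
move=> oU Ux df ddf cddf; apply/eqP; rewrite -subr_eq0 -normr_le0; apply/ler_addgt0Pr => e e0.
rewrite add0r; have e2 : 0 < e / 2 by rewrite divr_gt0.
have : \forall y \near x, [/\ U y, `|pd i (pd j f) x - pd i (pd j f) y| <= e / 2 &
    `|pd j (pd i f) x - pd j (pd i f) y| <= e / 2].
  have cd k l : \forall y \near x, `|pd l (pd k f) x - pd l (pd k f) y| <= e / 2.
    by move/cvgrPdist_le: (cddf k l) => /(_ _ e2).
  apply: filterS3 (cd j i) (cd i j) (open_nbhs_nbhs (conj oU Ux)) => y yj yi Uy.
  by split.
move/nbhs_ballP => [d /= d0]; rewrite -ball_normE => Hd.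
(* Side of the square: all points used below lie within 2 s = d / 2 of x. *)
have s0 : 0 < d / 4 by rewrite divr_gt0.
set s := d / 4 in s0.
have near_x a b k l : `|a| <= `|s| -> `|b| <= `|s| ->
    ball_ Num.Def.normr x d (x + a *: delta_mx 0 k + b *: delta_mx 0 l).
  move=> as_ bs; rewrite /ball_ /= -addrA opprD addNKr normrN.
  have le1 (c : R) (m : 'I_n) : `|c| <= `|s| -> `|c *: delta_mx 0 m : 'rV[R]_n| <= s.
    move=> cs; rewrite -(gtr0_norm s0); apply: norm_rV_le => // p; rewrite !mxE /=.
    by case: eqP => _; rewrite ?mulr1 ?mulr0 ?normr0.
  apply: le_lt_trans (ler_normD _ _) _; apply: le_lt_trans (lerD (le1 _ _ as_) (le1 _ _ bs)) _.
  by rewrite /s; lra.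
(* The second difference is the increment in direction k of the increment [g] in direction l, so two
   applications of the mean value theorem produce one mixed derivative. *)
have mixed (k l : 'I_n) : exists2 y, ball_ Num.Def.normr x d y &
    (f (x + s *: delta_mx 0 k + s *: delta_mx 0 l) - f (x + s *: delta_mx 0 k))
    - (f (x + s *: delta_mx 0 l) - f x) = pd l (pd k f) y * s * s.
  pose g y := f (y + s *: delta_mx 0 l) - f y.
  have dg t : `|t| <= `|s| -> is_derive (x + t *: delta_mx 0 k) (delta_mx 0 k) g
      (pd k f (x + t *: delta_mx 0 k + s *: delta_mx 0 l) - pd k f (x + t *: delta_mx 0 k)).
    move=> ts; apply: is_deriveB.
      have [Uy _ _] := Hd _ (near_x t s k l ts (lexx _)).
      pose y := x + t *: delta_mx 0 k.
      have E : (fun h : R => h^-1 *: (((fun y => f (y + s *: delta_mx 0 l)) \o shift y) (h *: delta_mx 0 k)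
            - f (y + s *: delta_mx 0 l)))
        = (fun h : R => h^-1 *: ((f \o shift (y + s *: delta_mx 0 l)) (h *: delta_mx 0 k) - f (y + s *:
          delta_mx 0 l))).
        by apply/funext => h /=; rewrite [h *: _ + (y + _)]addrA.
      by split; rewrite /derivable /derive E; [exact: (df _ Uy k)|].
    have s0' : `|0 : R| <= `|s| by rewrite normr0.
    have [Uy _ _] := Hd _ (near_x t 0 k l ts s0').
    by move: Uy; rewrite scale0r addr0 => Uy; apply/derivableP/df.
  have [t /dg[]//|t ts] := @mean_value_line g x (delta_mx 0 k) s.
  have [_ ->] := dg t ts; rewrite /g => E.
  have [r rs|r rs] := @mean_value_line (pd k f) (x + t *: delta_mx 0 k) (delta_mx 0 l) s.
    by have [Uy _ _] := Hd _ (near_x t r k l ts rs); exact: ddf.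
  rewrite -/(pd _ _ _) => E2; exists (x + t *: delta_mx 0 k + r *: delta_mx 0 l); first exact: near_x.
  by rewrite -E2 -E; ring.
have [y /Hd[_ _ yP] yE] := mixed i j; have [z /Hd[_ zP _] zE] := mixed j i.
have yz : pd j (pd i f) y = pd i (pd j f) z.
  have /(mulIf (lt0r_neq0 s0))/(mulIf (lt0r_neq0 s0)) // :
      pd j (pd i f) y * s * s = pd i (pd j f) z * s * s.
  have swap (a b c c' : R) : a - b - (c - c') = a - c - (b - c') by ring.
  by rewrite -[LHS]yE -[RHS]zE [x + s *: delta_mx 0 i + _]addrAC swap.
have tri (a b c : R) : `|a - c| <= e / 2 -> `|b - c| <= e / 2 -> `|a - b| <= e.
  rewrite [`|b - c|]distrC => ac bc; rewrite -(subrKA c) (splitr e).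
  exact: le_trans (ler_normD _ _) (lerD ac bc).
by apply: tri zP _; rewrite -yz.
Qed.

End MeanValue.

(** * Smooth functions and their closure properties *)

Section Smooth.
Variables (R : realType) (n : nat).
Implicit Types (U : set 'rV[R]_n) (f g : scal R n) (x : 'rV[R]_n).

Definition ck0 U f := forall x, U x ->
  {for x, continuous f} /\ forall i, derivable f x (delta_mx 0 i).

(** [smooth] quantifies over words of partial derivatives. Counting the order and peeling off the
    innermost derivative allows induction on [k] with the function generalised. *)
Fixpoint ck U (k : nat) f : Prop :=
  ck0 U f /\ if k is k'.+1 then forall i, ck U k' (pd i f) else True.

Lemma smoothP U f : smooth U f <-> forall k, ck U k f.
Proof.
split=> [sf k|cf s x Ux].
  elim: k f sf => [|k IH] f sf /=.
    by split => // x Ux; exact: (sf [::] x Ux).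
  split; first by move=> x Ux; exact: (sf [::] x Ux).
  by move=> i; apply: IH => s x Ux; rewrite -[foldr _ _ _]foldr_rcons; exact: sf.
elim/last_ind: s f cf => [|s i IH] f cf; first by have [/(_ x Ux)] := cf 0%N.
by rewrite foldr_rcons; apply: IH => k; have [_] := cf k.+1; apply.
Qed.

Lemma smooth_ck U f k : smooth U f -> ck U k f. Proof. by move/smoothP. Qed.

Lemma smooth_pd U f i : smooth U f -> smooth U (pd i f).
Proof. by move=> /smoothP cf; apply/smoothP => k; have [_] := cf k.+1; apply. Qed.

Lemma smooth_derivable U f x i : smooth U f -> U x -> derivable f x (delta_mx 0 i).
Proof. by move=> sf Ux; have [_] := sf [::] x Ux; apply. Qed.

Lemma smooth_continuous U f x : smooth U f -> U x -> {for x, continuous f}.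
Proof. by move=> sf Ux; have [] := sf [::] x Ux. Qed.

Lemma ckW U k f : ck U k.+1 f -> ck U k f.
Proof.
elim: k f => [|k IH] f; first by case.
by move=> [f0 fk]; split => // i; apply: IH; exact: fk.
Qed.

Lemma eq_near U f g x : open U -> {in U, f =1 g} -> U x -> \forall y \near x, f y = g y.
Proof.
move=> oU fg Ux; apply: filterS (open_nbhs_nbhs (conj oU Ux)) => y Uy.
by apply: fg; rewrite inE.
Qed.

Lemma eq_pd U f g i : open U -> {in U, f =1 g} -> {in U, pd i f =1 pd i g}.
Proof.
by move=> oU fg x; rewrite inE => Ux; apply: near_eq_derive; exact: (eq_near oU fg Ux).
Qed.

Lemma ckS U k f : ck0 U f -> (forall k' i, k = k'.+1 -> ck U k' (pd i f)) -> ck U k f.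
Proof. by case: k => [|k] f0 fk; split => // i; exact: fk. Qed.

Lemma eq_ck0 U f g : open U -> {in U, f =1 g} -> ck0 U f -> ck0 U g.
Proof.
move=> oU fg f0 x Ux; have [cf df] := f0 x Ux; have fgx := eq_near oU fg Ux.
split=> [|i]; last exact: near_eq_derivable fgx (df i).
have : f y @[y --> x] --> f x by exact: cf.
rewrite (fg x (mem_set Ux)) => cf'; exact: cvg_trans (near_eq_cvg fgx) cf'.
Qed.

Lemma eq_ck U k f g : open U -> {in U, f =1 g} -> ck U k f -> ck U k g.
Proof.
move=> oU; elim: k f g => [|k IH] f g fg [f0 fk]; split; try exact: eq_ck0 f0.
  exact: I.
by move=> i; apply: (IH (pd i f)); [exact: eq_pd|exact: fk].
Qed.

Lemma eq_smooth U f g : open U -> {in U, f =1 g} -> smooth U f -> smooth U g.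
Proof. by move=> oU fg /smoothP sf; apply/smoothP => k; exact: eq_ck (sf k). Qed.

Lemma pd_cst (c : R) i : pd i (fun _ : 'rV[R]_n => c) = fun=> 0.
Proof. by apply/funext => x; exact: derive_cst. Qed.

Lemma smooth_cst (U : set 'rV[R]_n) (c : R) : smooth U (fun=> c).
Proof.
apply/smoothP => k; elim: k c => [|k IH] c; apply: ckS => [x _|k' i].
- by split => [|i]; [exact: cst_continuous|exact: derivable_cst].
- by [].
- by split => [|i]; [exact: cst_continuous|exact: derivable_cst].
- by case=> <-; rewrite pd_cst; exact: IH.
Qed.

Lemma is_derive_coord x (j : 'I_n) (v : 'rV[R]_n) :
  is_derive x v (fun y : 'rV[R]_n => y 0 j) (v 0 j).
Proof.
have [h1 h2] := @is_derive_id R 'rV[R]_n x v.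
have dj : derivable (fun y : 'rV[R]_n => y 0 j) x v by move/derivable_mxP: h1; apply.
by split => //; move/rowP: h2 => /(_ j) <-; rewrite derive_mx // mxE.
Qed.

Lemma pd_coord x (i j : 'I_n) : pd i (fun y : 'rV[R]_n => y 0 j) x = (i == j)%:R.
Proof.
by have [_ E] := @is_derive_coord x j (delta_mx 0 i); rewrite /pd E mxE eqxx eq_sym.
Qed.

Lemma smooth_coord U (j : 'I_n) : smooth U (fun y => y 0 j).
Proof.
have c0 : ck0 U (fun y => y 0 j).
  move=> x _; split => [|i]; first exact: coord_continuous.
  by have [] := @is_derive_coord x j (delta_mx 0 i).
apply/smoothP => k; apply: ckS => // k' i _.
have -> : pd i (fun y : 'rV[R]_n => y 0 j) = fun=> (i == j)%:R.
  by apply/funext => x; exact: pd_coord.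
exact/smooth_ck/smooth_cst.
Qed.

Lemma ck0_derivable U f x i : ck0 U f -> U x -> derivable f x (delta_mx 0 i).
Proof. by move=> sf Ux; have [_] := sf x Ux; apply. Qed.

Lemma pdD U f g i : ck0 U f -> ck0 U g ->
  {in U, pd i (fun x => f x + g x) =1 fun x => pd i f x + pd i g x}.
Proof. by move=> sf sg x; rewrite inE => Ux; apply: deriveD; exact: ck0_derivable Ux. Qed.

Lemma pdM U f g i : ck0 U f -> ck0 U g ->
  {in U, pd i (fun x => f x * g x) =1 fun x => f x * pd i g x + g x * pd i f x}.
Proof. by move=> sf sg x; rewrite inE => Ux; apply: deriveM; exact: ck0_derivable Ux. Qed.

Lemma ck_ck0 U k f : ck U k f -> ck0 U f. Proof. by case: k => [|k] []. Qed.

Lemma ck_pd U k f i : ck U k.+1 f -> ck U k (pd i f). Proof. by move=> [_]; apply. Qed.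

Lemma ckD U k f g : open U -> ck U k f -> ck U k g -> ck U k (fun x => f x + g x).
Proof.
move=> oU; elim: k f g => [|k IH] f g cf cg; apply: ckS => [x Ux|k' i kE].
- have [cfx dfx] := ck_ck0 cf Ux; have [cgx dgx] := ck_ck0 cg Ux.
  by split => [|i]; [exact: (continuousD cfx cgx)|exact: (derivableD (dfx i) (dgx i))].
- by [].
- have [cfx dfx] := ck_ck0 cf Ux; have [cgx dgx] := ck_ck0 cg Ux.
  by split => [|i]; [exact: (continuousD cfx cgx)|exact: (derivableD (dfx i) (dgx i))].
- case: kE => <-; apply: (@eq_ck U k (fun x => pd i f x + pd i g x) _ oU).
    by move=> x Ux; rewrite (pdD i (ck_ck0 cf) (ck_ck0 cg)).
  by apply: IH; exact: ck_pd.
Qed.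

Lemma ckM U k f g : open U -> ck U k f -> ck U k g -> ck U k (fun x => f x * g x).
Proof.
move=> oU; elim: k f g => [|k IH] f g cf cg; apply: ckS => [x Ux|k' i kE].
- have [cfx dfx] := ck_ck0 cf Ux; have [cgx dgx] := ck_ck0 cg Ux.
  by split => [|i]; [exact: (continuousM cfx cgx)|exact: (derivableM (dfx i) (dgx i))].
- by [].
- have [cfx dfx] := ck_ck0 cf Ux; have [cgx dgx] := ck_ck0 cg Ux.
  by split => [|i]; [exact: (continuousM cfx cgx)|exact: (derivableM (dfx i) (dgx i))].
- case: kE => <-; apply: (@eq_ck U k (fun x => f x * pd i g x + g x * pd i f x) _ oU).
    by move=> x Ux; rewrite (pdM i (ck_ck0 cf) (ck_ck0 cg)).
  by apply: (ckD oU); apply: IH; (exact: ck_pd) || exact: ckW.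
Qed.

(** The derivative is -(1/f)(1/f) times that of f. Here 1/f is needed only to one order less, so the
    induction closes; the exponential is treated in the same way. *)
Lemma ckV U k f : open U -> (forall x, U x -> f x != 0) -> ck U k f -> ck U k (fun x => (f x)^-1).
Proof.
move=> oU f0.
have c0 : ck0 U f -> ck0 U (fun x => (f x)^-1).
  move=> cf x Ux; have [cfx dfx] := cf x Ux.
  by split => [|i]; [exact: (continuousV (f0 x Ux) cfx)|exact: (derivableV (f0 x Ux) (dfx i))].
elim: k => [|k IH] cf; apply: ckS; [exact/c0/ck_ck0/cf| |exact/c0/ck_ck0/cf|] => // k' i [<-].
apply: (@eq_ck U k (fun x => -1 * ((f x)^-1 * (f x)^-1) * pd i f x) _ oU).
  move=> x; rewrite inE => Ux; have [_ dfx] := ck_ck0 cf Ux.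
  rewrite [RHS](deriveV (f0 x Ux) (dfx i)) -[_ *: _]/(_ * _); congr (_ * _).
  by rewrite mulN1r -exprVn expr2.
apply: (ckM oU); last exact: ck_pd.
apply: (ckM oU); first exact/smooth_ck/smooth_cst.
by apply: (ckM oU); exact/IH/ckW.
Qed.

(** Restriction to the line x + t v reduces the claim to the one-variable chain rule at t = 0. *)
Lemma is_derive_expR_comp f x (v : 'rV[R]_n) : derivable f x v ->
  is_derive x v (fun y => expR (f y)) (expR (f x) * 'D_v f x).
Proof.
move=> df.
have d1 : is_derive (0 : R) 1 (fun t : R => f (x + t *: v)) ('D_v f x).
  by have := @is_derive_line R n f x v 0; rewrite scale0r addr0 => /(_ df).
have d2 := is_derive1_comp (is_derive_expR (f (x + 0 *: v))) d1.
have E : (fun h : R => h^-1 *: (((fun y => expR (f y)) \o shift x) (h *: v) - expR (f x))) =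
  (fun h : R => h^-1 *: (((expR \o (fun t : R => f (x + t *: v))) \o shift (0 : R)) (h *: 1)
     - (expR \o (fun t : R => f (x + t *: v))) 0)).
  by apply/funext => h /=; rewrite scale0r !addr0 [h *: 1]mulr1 [h *: v + x]addrC.
case: d2 => d2 d2E; rewrite scale0r addr0 in d2E.
by split; rewrite /derivable /derive E //; exact: d2E.
Qed.

Lemma ck_expR U k f : open U -> ck U k f -> ck U k (fun x => expR (f x)).
Proof.
move=> oU.
have c0 : ck0 U f -> ck0 U (fun x => expR (f x)).
  move=> cf x Ux; have [cfx dfx] := cf x Ux; split => [|i].
    by apply: continuous_comp => //; exact: continuous_expR.
  by have [] := is_derive_expR_comp (dfx i).
elim: k => [|k IH] cf; apply: ckS; [exact/c0/ck_ck0/cf| |exact/c0/ck_ck0/cf|] => // k' i [<-].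
apply: (@eq_ck U k (fun x => expR (f x) * pd i f x) _ oU).
  move=> x; rewrite inE => Ux; have [_ dfx] := ck_ck0 cf Ux.
  by have [_ E] := is_derive_expR_comp (dfx i); rewrite [in RHS]/pd E.
by apply: (ckM oU); [exact/IH/ckW|exact: ck_pd].
Qed.

Lemma smoothD U f g : open U -> smooth U f -> smooth U g -> smooth U (fun x => f x + g x).
Proof. by move=> oU /smoothP sf /smoothP sg; apply/smoothP => k; exact: ckD. Qed.

Lemma smoothM U f g : open U -> smooth U f -> smooth U g -> smooth U (fun x => f x * g x).
Proof. by move=> oU /smoothP sf /smoothP sg; apply/smoothP => k; exact: ckM. Qed.

Lemma smoothN U f : open U -> smooth U f -> smooth U (fun x => - f x).
Proof.
move=> oU sf; apply: (@eq_smooth U (fun x => -1 * f x) _ oU) => [x _|].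
  by rewrite mulN1r.
exact: (smoothM oU (smooth_cst (-1)) sf).
Qed.

Lemma smoothB U f g : open U -> smooth U f -> smooth U g -> smooth U (fun x => f x - g x).
Proof. by move=> oU sf sg; exact: (smoothD oU sf (smoothN oU sg)). Qed.

Lemma smoothV U f : open U -> (forall x, U x -> f x != 0) -> smooth U f ->
  smooth U (fun x => (f x)^-1).
Proof. by move=> oU f0 /smoothP sf; apply/smoothP => k; exact: ckV. Qed.

Lemma smooth_expR U f : open U -> smooth U f -> smooth U (fun x => expR (f x)).
Proof. by move=> oU /smoothP sf; apply/smoothP => k; exact: ck_expR. Qed.

Lemma smooth_sum U (I : Type) (r : seq I) (F : I -> scal R n) : open U ->
  (forall i, smooth U (F i)) -> smooth U (fun x => \sum_(i <- r) F i x).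
Proof.
move=> oU sF; elim: r => [|i r IH].
  by apply: (eq_smooth oU _ (smooth_cst 0)) => x _; rewrite big_nil.
by apply: (eq_smooth oU _ (smoothD oU (sF i) IH)) => x _; rewrite big_cons.
Qed.

Lemma smooth_prod U (I : Type) (r : seq I) (F : I -> scal R n) : open U ->
  (forall i, smooth U (F i)) -> smooth U (fun x => \prod_(i <- r) F i x).
Proof.
move=> oU sF; elim: r => [|i r IH].
  by apply: (eq_smooth oU _ (smooth_cst 1)) => x _; rewrite big_nil.
by apply: (eq_smooth oU _ (smoothM oU (sF i) IH)) => x _; rewrite big_cons.
Qed.

Lemma smooth_C1 U f x : open U -> smooth U f -> U x ->
  differentiable f x /\ forall h, 'd f x h = pdiff f x h.
Proof.
move=> oU sf Ux; apply: (@C1_diff R n U) => //.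
- by move=> y Uy i; exact: smooth_derivable Uy.
- by move=> i; exact: smooth_continuous (smooth_pd i sf) Ux.
Qed.

Lemma pd_comm U f x i j : open U -> smooth U f -> U x -> pd i (pd j f) x = pd j (pd i f) x.
Proof.
move=> oU sf Ux; apply: (@schwarz R n U) => //.
- by move=> y Uy k; exact: smooth_derivable Uy.
- by move=> y Uy k l; exact: smooth_derivable (smooth_pd k sf) Uy.
- by move=> k l; exact: smooth_continuous (smooth_pd l (smooth_pd k sf)) Ux.
Qed.

End Smooth.

Arguments smooth_cst {R n} U c.

(** * Smooth maps and the chain rule *)

Section SmoothMap.
Variables (R : realType) (n m : nat) (U : set 'rV[R]_n) (F : 'rV[R]_n -> 'rV[R]_m).
Hypotheses (oU : open U) (sF : smooth_map U F).

Lemma smooth_map_differentiable x : U x -> differentiable F x.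
Proof.
move=> Ux.
have -> : F = \sum_(j < m) (fun y => F y 0 j *: (delta_mx 0 j : 'rV[R]_m)).
  by apply/funext => y; rewrite {1}[F y]row_sum_delta fct_sumE.
apply: differentiable_sum => j; apply: differentiableZl.
by have [] := smooth_C1 oU (sF j) Ux.
Qed.

Lemma jacobianE x i j : U x -> 'J F x i j = pd i (fun y => F y 0 j) x.
Proof.
move=> Ux; have dF := smooth_map_differentiable Ux.
have := deriveEjacobian (delta_mx 0 i) dF; rewrite -rowE => /rowP/(_ j).
by rewrite mxE => <-; rewrite derive_mx ?mxE //; exact: diff_derivable.
Qed.

Variables (V : set 'rV[R]_m).
Hypotheses (oV : open V) (FUV : forall x, U x -> V (F x)).

Lemma pd_comp f x i : smooth V f -> U x ->
  pd i (fun y => f (F y)) x = \sum_j 'J F x i j * pd j f (F x).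
Proof.
move=> sf Ux; have dF := smooth_map_differentiable Ux.
have [df dfE] := smooth_C1 oV sf (FUV Ux).
have dc : differentiable (f \o F) x by exact: differentiable_comp.
rewrite -[LHS]/('D_(delta_mx 0 i) (f \o F) x) deriveE // diff_comp //= dfE.
apply: eq_bigr => j _; congr (_ * _).
by rewrite /jacobian /lin1_mx mxE.
Qed.

(** By the chain rule a partial derivative of the composite is a sum of products of smooth functions
    with composites of the same kind, so the induction on the order runs over all smooth [f] at
    once. *)
Lemma smooth_comp f : smooth V f -> smooth U (fun x => f (F x)).
Proof.
move=> sf; apply/smoothP => k.
have c0 g : smooth V g -> ck0 U (fun x => g (F x)).
  move=> sg x Ux; have dF := smooth_map_differentiable Ux.
  have [dg _] := smooth_C1 oV sg (FUV Ux).
  have dc : differentiable (g \o F) x by exact: differentiable_comp.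
  by split => [|i]; [exact: (differentiable_continuous dc)|exact: diff_derivable dc].
elim: k f sf => [|k IH] f sf; split => //; try exact: c0.
move=> i; apply: (@eq_ck _ _ U k (fun x => \sum_j pd i (fun y => F y 0 j) x * pd j f (F x))) => //.
  move=> x; rewrite inE => Ux; rewrite pd_comp //.
  by apply: eq_bigr => j _; rewrite jacobianE.
have E : forall (r : seq 'I_m), ck U k (fun x => \sum_(j <- r) pd i (fun y => F y 0 j) x * pd j f (F x)).
  elim=> [|j r IHr].
    by apply: (eq_ck oU _ (smooth_ck k (smooth_cst U 0))) => x _; rewrite big_nil.
  apply: (@eq_ck _ _ U k (fun x => pd i (fun y => F y 0 j) x * pd j f (F x) +
    \sum_(j <- r) pd i (fun y => F y 0 j) x * pd j f (F x))) => //.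
    by move=> x _; rewrite big_cons.
  apply: ckD => //; apply: ckM => //; first exact/smooth_ck/smooth_pd.
  exact/IH/smooth_pd.
exact: E.
Qed.

End SmoothMap.

Ltac smth := lazymatch goal with
  | |- open _ => assumption
  | |- forall _, _ => intro; smth
  | |- smooth _ (fun _ => ?c) => exact: smooth_cst
  | |- smooth _ (fun x => _ + _) => apply: smoothD; smth
  | |- smooth _ (fun x => - _) => apply: smoothN; smth
  | |- smooth _ (fun x => _ * _) => apply: smoothM; smth
  | |- smooth _ (fun x => expR _) => apply: smooth_expR; smth
  | |- smooth _ (fun x => \sum_(i <- _) _) => apply: smooth_sum; smth
  | |- smooth _ (pd _ _) => apply: smooth_pd; smth
  | |- smooth _ (fun x => pd _ _ x) => apply: smooth_pd; smth
  | |- smooth _ (fun x : _ => fun_of_matrix x _ _) => exact: smooth_coord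
  | |- _ => solve [assumption | match goal with H : _ |- _ => solve [apply: H] end]
  end.

(** * Forms evaluated on vectors *)

(** Values on vectors. Once forms are replaced by their values, the identities are polynomial ones
    between real numbers, within reach of [ring] and [lra]. *)
Definition ev1 (R : realType) n (a v : 'rV[R]_n) : R := (a *m v^T) 0 0.
Definition ev2 (R : realType) n (A : 'M[R]_n) (u v : 'rV[R]_n) : R := (u *m A *m v^T) 0 0.

(* [ring] compares atoms up to conversion, which is hopeless for derivatives. *)
Ltac atoms :=
  repeat match goal with |- context [@ev1 ?R ?n ?a ?v] => generalize (@ev1 R n a v); intro end;
  repeat match goal with |- context [@ev2 ?R ?n ?A ?u ?v] => generalize (@ev2 R n A u v); intro end;
  repeat match goal with |- context [@pd ?R ?n ?i ?f ?x] => generalize (@pd R n i f x); intro end;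
  repeat match goal with |- context [fun_of_matrix ?A ?i ?j] => move: (fun_of_matrix A i j) => ? end.

Section Exterior.
Variables (R : realType) (n : nat).
Implicit Types (U : set 'rV[R]_n) (f g : scal R n) (x u v z : 'rV[R]_n).
Implicit Types (a b : form1 R n) (A B : 'rV[R]_n -> 'M[R]_n).
Local Open Scope dform_scope.

Lemma ev1E (a : 'rV[R]_n) v : ev1 a v = \sum_i a 0 i * v 0 i.
Proof. by rewrite /ev1 mxE; apply: eq_bigr => i _; rewrite mxE. Qed.

Lemma ev2E (A : 'M[R]_n) u v : ev2 A u v = \sum_i \sum_j u 0 i * v 0 j * A i j.
Proof.
rewrite /ev2 mxE exchange_big /=; apply: eq_bigr => j _; rewrite !mxE mulr_suml.
by apply: eq_bigr => i _; rewrite mulrAC.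
Qed.

Lemma ev1D a b x v : ev1 ((a + b) x) v = ev1 (a x) v + ev1 (b x) v.
Proof. by rewrite /ev1 mulmxDl mxE. Qed.
Lemma ev1N a x v : ev1 ((- a) x) v = - ev1 (a x) v.
Proof. by rewrite /ev1 mulNmx mxE. Qed.
Lemma ev1Z (c : R) a x v : ev1 ((c *: a) x) v = c * ev1 (a x) v.
Proof. by rewrite /ev1 -scalemxAl mxE. Qed.
Lemma ev1F f a x v : ev1 ((f :* a) x) v = f x * ev1 (a x) v.
Proof. by rewrite /ev1 -scalemxAl mxE. Qed.
Lemma ev2D A B x u v : ev2 ((A + B) x) u v = ev2 (A x) u v + ev2 (B x) u v.
Proof. by rewrite /ev2 mulmxDr mulmxDl mxE. Qed.
Lemma ev2N A x u v : ev2 ((- A) x) u v = - ev2 (A x) u v.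
Proof. by rewrite /ev2 mulmxN mulNmx mxE. Qed.
Lemma ev2Z (c : R) A x u v : ev2 ((c *: A) x) u v = c * ev2 (A x) u v.
Proof. by rewrite /ev2 -scalemxAr -scalemxAl mxE. Qed.
Lemma ev2F f A x u v : ev2 ((f :* A) x) u v = f x * ev2 (A x) u v.
Proof. by rewrite /ev2 -scalemxAr -scalemxAl mxE. Qed.
Lemma ev2W a b x u v :
  ev2 ((a \w b) x) u v = ev1 (a x) u * ev1 (b x) v - ev1 (a x) v * ev1 (b x) u.
Proof.
rewrite ev2E !ev1E; have E (p q : 'I_n -> R) : (\sum_i p i) * (\sum_i q i) = \sum_i \sum_j p i * q j.
  by rewrite mulr_suml; apply: eq_bigr => i _; rewrite mulr_sumr.
rewrite !E [X in _ - X]exchange_big -sumrB; apply: eq_bigr => i _.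
by rewrite -sumrB; apply: eq_bigr => j _; rewrite mxE; atoms; ring.
Qed.
Definition ev2s := (ev2D, ev2N, ev2Z, ev2F, ev2W).

Lemma ev2_0 u v : ev2 (0 : 'M[R]_n) u v = 0.
Proof. by rewrite /ev2 mulmx0 mul0mx mxE. Qed.

Lemma ev2_antisym a x u v : ev2 (ext_d a x) u v = - ev2 (ext_d a x) v u.
Proof.
rewrite !ev2E exchange_big /= -sumrN; apply: eq_bigr => i _; rewrite -sumrN.
by apply: eq_bigr => j _; rewrite !mxE; atoms; ring.
Qed.

Lemma ev1Dr (a : 'rV[R]_n) u v : ev1 a (u + v) = ev1 a u + ev1 a v.
Proof. by rewrite /ev1 linearD mulmxDr mxE. Qed.
Lemma ev1Zr (a : 'rV[R]_n) c v : ev1 a (c *: v) = c * ev1 a v.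
Proof. by rewrite /ev1 linearZ -scalemxAr mxE. Qed.
Lemma ev2Dl (A : 'M[R]_n) u u' v : ev2 A (u + u') v = ev2 A u v + ev2 A u' v.
Proof. by rewrite /ev2 !mulmxDl mxE. Qed.
Lemma ev2Zl (A : 'M[R]_n) c u v : ev2 A (c *: u) v = c * ev2 A u v.
Proof. by rewrite /ev2 -!scalemxAl mxE. Qed.
(** The vector field [flat_E1] used in the existence proof has this shape. *)
Lemma ev1_comb (a : 'rV[R]_n) (p q r : form1 R n) f g x :
  ev1 a ((- p + (f :* q + g :* r)) x) = - ev1 a (p x) + (f x * ev1 a (q x) + g x * ev1 a (r x)).
Proof.
rewrite -[(_ + _) x]/(- p x + (f x *: q x + g x *: r x)).
by rewrite !ev1Dr !ev1Zr -scaleN1r ev1Zr mulN1r.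
Qed.

Lemma ev2_comb (A : 'M[R]_n) (p q r : form1 R n) f g x v :
  ev2 A ((- p + (f :* q + g :* r)) x) v =
  - ev2 A (p x) v + (f x * ev2 A (q x) v + g x * ev2 A (r x) v).
Proof.
rewrite -[(_ + _) x]/(- p x + (f x *: q x + g x *: r x)).
by rewrite !ev2Dl !ev2Zl -scaleN1r ev2Zl mulN1r.
Qed.

Lemma ev1Nr (a : 'rV[R]_n) (p : form1 R n) x : ev1 a ((- p) x) = - ev1 a (p x).
Proof. by rewrite -[(- p) x]scaleN1r ev1Zr mulN1r. Qed.

Lemma ev2_inj (A B : 'M[R]_n) : (forall u v, ev2 A u v = ev2 B u v) -> A = B.
Proof.
move=> AB; apply/matrixP => i j; have := AB (delta_mx 0 i) (delta_mx 0 j).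
by rewrite /ev2 -!rowE trmx_delta -!colE !mxE.
Qed.

Lemma ev1_inj (a b : 'rV[R]_n) : (forall v, ev1 a v = ev1 b v) -> a = b.
Proof.
move=> ab; apply/rowP => i; have := ab (delta_mx 0 i).
by rewrite /ev1 trmx_delta -!colE !mxE.
Qed.

Lemma smooth_mapD U a b : open U -> smooth_map U a -> smooth_map U b -> smooth_map U (a + b).
Proof. by move=> oU sa sb j; apply: (eq_smooth oU _ (smoothD oU (sa j) (sb j))) => x _; rewrite mxE. Qed.
Lemma smooth_mapN U a : open U -> smooth_map U a -> smooth_map U (- a).
Proof. by move=> oU sa j; apply: (eq_smooth oU _ (smoothN oU (sa j))) => x _; rewrite mxE. Qed.
Lemma smooth_mapF U f a : open U -> smooth U f -> smooth_map U a -> smooth_map U (f :* a).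
Proof. by move=> oU sf sa j; apply: (eq_smooth oU _ (smoothM oU sf (sa j))) => x _; rewrite mxE. Qed.
Lemma smooth_mapZ U (c : R) a : open U -> smooth_map U a -> smooth_map U (c *: a).
Proof. by move=> oU sa; exact: (smooth_mapF oU (smooth_cst U c) sa). Qed.
Lemma smooth_grad U f : open U -> smooth U f -> smooth_map U (grad f).
Proof. by move=> oU sf j; apply: (eq_smooth oU _ (smooth_pd j sf)) => x _; rewrite mxE. Qed.
Lemma eq_smooth_map U a b : open U -> {in U, a =1 b} -> smooth_map U a -> smooth_map U b.
Proof. by move=> oU ab sa j; apply: (eq_smooth oU _ (sa j)) => x /ab ->. Qed.
Lemma smooth_dcoord U i : smooth_map U (@dcoord R n i).
Proof. by move=> j; exact: smooth_cst. Qed.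

(** Contraction of a 2-form with a vector field. Vector fields share the type [form1] with 1-forms,
    both being row-valued functions. *)
Definition iprod a A : form1 R n := fun x => a x *m A x.

Lemma ev1_iprod a A x v : ev1 (iprod a A x) v = ev2 (A x) (a x) v.
Proof. by []. Qed.

Definition smooth2 U A := forall i j, smooth U (fun x => A x i j).

Lemma smooth_iprod U a A : open U -> smooth_map U a -> smooth2 U A -> smooth_map U (iprod a A).
Proof.
move=> oU sa sA j; apply: (@eq_smooth _ _ _ (fun x => \sum_k a x 0 k * A x k j) _ oU).
  by move=> x _; rewrite mxE.
by smth.
Qed.

Lemma smooth2D U A B : open U -> smooth2 U A -> smooth2 U B -> smooth2 U (A + B).
Proof. by move=> oU sa sb i j; apply: (eq_smooth oU _ (smoothD oU (sa i j) (sb i j))) => x _; rewrite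
  mxE. Qed.
Lemma smooth2N U A : open U -> smooth2 U A -> smooth2 U (- A).
Proof. by move=> oU sa i j; apply: (eq_smooth oU _ (smoothN oU (sa i j))) => x _; rewrite mxE. Qed.
Lemma smooth2F U f A : open U -> smooth U f -> smooth2 U A -> smooth2 U (f :* A).
Proof. by move=> oU sf sa i j; apply: (eq_smooth oU _ (smoothM oU sf (sa i j))) => x _; rewrite mxE. Qed.
Lemma smooth2Z U (c : R) A : open U -> smooth2 U A -> smooth2 U (c *: A).
Proof. by move=> oU sA; exact: (smooth2F oU (smooth_cst U c) sA). Qed.
Lemma smooth2W U a b : open U -> smooth_map U a -> smooth_map U b -> smooth2 U (a \w b).
Proof.
move=> oU sa sb i j; apply: (@eq_smooth _ _ _ (fun x => a x 0 i * b x 0 j - a x 0 j * b x 0 i) _ oU).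
  by move=> x _; rewrite mxE.
by smth.
Qed.
Lemma smooth2_ext_d U a : open U -> smooth_map U a -> smooth2 U (ext_d a).
Proof.
move=> oU sa i j; apply: (eq_smooth oU _ (smoothB oU (smooth_pd i (sa j)) (smooth_pd j (sa i)))).
by move=> x _; rewrite mxE.
Qed.

Lemma smooth_ev2 U A a b : open U -> smooth2 U A -> smooth_map U a -> smooth_map U b ->
  smooth U (fun x => ev2 (A x) (a x) (b x)).
Proof.
move=> oU sA su sv; apply: (@eq_smooth _ _ _ (fun x => \sum_i \sum_j a x 0 i * b x 0 j * A x i j) _ oU).
  by move=> x _; rewrite ev2E.
by smth.
Qed.

Lemma eq_ext_d U a b : open U -> {in U, a =1 b} -> {in U, ext_d a =1 ext_d b}.
Proof.
move=> oU ab x Ux; apply/matrixP => i j; rewrite !mxE.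
by congr (_ - _); apply: (eq_pd _ oU) Ux => y Uy; rewrite ab.
Qed.

Lemma smooth_ck0 U f : smooth U f -> ck0 U f.
Proof. by move/(smooth_ck 0); case. Qed.

Lemma ext_dD U a b x : U x -> smooth_map U a -> smooth_map U b ->
  ext_d (a + b) x = ext_d a x + ext_d b x.
Proof.
move=> Ux sa sb.
have E i j : pd i (fun y => (a + b) y 0 j) x = pd i (fun y => a y 0 j) x + pd i (fun y => b y 0 j) x.
  rewrite -(pdD i (smooth_ck0 (sa j)) (smooth_ck0 (sb j))) ?inE //.
  by congr (pd i _ x); apply/funext => y; rewrite mxE.
by apply/matrixP => i j; rewrite !mxE !E; atoms; ring.
Qed.

Lemma ext_dF U f a x : U x -> smooth U f -> smooth_map U a ->
  ext_d (f :* a) x = (grad f \w a + f :* ext_d a) x.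
Proof.
move=> Ux sf sa.
have E i j : pd i (fun y => (f :* a) y 0 j) x = f x * pd i (fun y => a y 0 j) x + a x 0 j * pd i f x.
  rewrite -(pdM i (smooth_ck0 sf) (smooth_ck0 (sa j))) ?inE //.
  by congr (pd i _ x); apply/funext => y; rewrite mxE.
by apply/matrixP => i j; rewrite !mxE !E; atoms; ring.
Qed.

Lemma grad_cst (c : R) : grad (fun=> c : R) = 0 :> (form1 R n).
Proof. by apply/funext => x; apply/rowP => i; rewrite !mxE pd_cst. Qed.

Lemma ext_dZ U (c : R) a x : U x -> smooth_map U a -> ext_d (c *: a) x = c *: ext_d a x.
Proof.
move=> Ux sa; have := ext_dF Ux (smooth_cst U c) sa.
rewrite -[fscale _ _]/(c *: a) => ->; rewrite grad_cst.
by apply/matrixP => i j; rewrite !mxE; atoms; ring.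
Qed.

Lemma ext_dN U a x : U x -> smooth_map U a -> ext_d (- a) x = - ext_d a x.
Proof. by move=> Ux sa; rewrite -[- a]scaleN1r (ext_dZ _ Ux sa) scaleN1r. Qed.

Lemma ev2_ext_dD U a b x u v : U x -> smooth_map U a -> smooth_map U b ->
  ev2 (ext_d (a + b) x) u v = ev2 (ext_d a x) u v + ev2 (ext_d b x) u v.
Proof. by move=> Ux sa sb; rewrite (ext_dD Ux sa sb) /ev2 mulmxDr mulmxDl mxE. Qed.
Lemma ev2_ext_dF U f a x u v : U x -> smooth U f -> smooth_map U a ->
  ev2 (ext_d (f :* a) x) u v =
  ev1 (grad f x) u * ev1 (a x) v - ev1 (grad f x) v * ev1 (a x) u + f x * ev2 (ext_d a x) u v.
Proof. by move=> Ux sf sa; rewrite (ext_dF Ux sf sa) !ev2s. Qed.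
Lemma ev2_ext_dZ U (c : R) a x u v : U x -> smooth_map U a ->
  ev2 (ext_d (c *: a) x) u v = c * ev2 (ext_d a x) u v.
Proof. by move=> Ux sa; rewrite (ext_dZ _ Ux sa) /ev2 -scalemxAr -scalemxAl mxE. Qed.
Lemma ev2_ext_dN U a x u v : U x -> smooth_map U a ->
  ev2 (ext_d (- a) x) u v = - ev2 (ext_d a x) u v.
Proof. by move=> Ux sa; rewrite (ext_dN Ux sa) /ev2 mulmxN mulNmx mxE. Qed.

Lemma ext_d_grad U f x : open U -> smooth U f -> U x -> ext_d (grad f) x = 0.
Proof.
move=> oU sf Ux.
have E i j : pd i (fun y => grad f y 0 j) x = pd i (pd j f) x.
  by congr (pd i _ x); apply/funext => y; rewrite mxE.
by apply/matrixP => i j; rewrite !mxE !E (pd_comm i j oU sf Ux) subrr.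
Qed.

(* The value on (u, v, z) of the exterior derivative of the 2-form A *)
Definition dd A x (i j k : 'I_n) : R :=
  pd i (fun y => A y j k) x + pd j (fun y => A y k i) x + pd k (fun y => A y i j) x.
Definition ev_dd A x u v z : R :=
  \sum_i \sum_j \sum_k u 0 i * v 0 j * z 0 k * dd A x i j k.

Lemma ev_dd_lin A B C (c d : R) x u v z :
  (forall i j k, dd A x i j k = c * dd B x i j k + d * dd C x i j k) ->
  ev_dd A x u v z = c * ev_dd B x u v z + d * ev_dd C x u v z.
Proof.
move=> E; rewrite /ev_dd !mulr_sumr -big_split; apply: eq_bigr => i _ /=.
rewrite !mulr_sumr -big_split; apply: eq_bigr => j _ /=.
rewrite !mulr_sumr -big_split; apply: eq_bigr => k _ /=.
by rewrite E; atoms; ring.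
Qed.

Lemma ev_ddD U A B x u v z : U x -> smooth2 U A -> smooth2 U B ->
  ev_dd (A + B) x u v z = ev_dd A x u v z + ev_dd B x u v z.
Proof.
move=> Ux sA sB; rewrite (@ev_dd_lin _ A B 1 1) ?mul1r // => i j k; rewrite !mul1r /dd.
have E l p q : pd l (fun y => (A + B) y p q) x = pd l (fun y => A y p q) x + pd l (fun y => B y p q) x.
  rewrite -(pdD l (smooth_ck0 (sA p q)) (smooth_ck0 (sB p q))) ?inE //.
  by congr (pd l _ x); apply/funext => y; rewrite mxE.
by rewrite !E; atoms; ring.
Qed.

Lemma eq_ev_dd U A B x u v z : open U -> U x -> {in U, A =1 B} ->
  ev_dd A x u v z = ev_dd B x u v z.
Proof.
move=> oU Ux AB; do 3![apply: eq_bigr => ? _]; congr (_ * _); rewrite /dd.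
by congr (_ + _ + _); apply: (eq_pd _ oU) (mem_set Ux) => y /AB ->.
Qed.

(** d^2 = 0: the six second derivatives cancel in pairs by their symmetry. *)
Lemma ev_dd_ext_d U a x u v z : open U -> smooth_map U a -> U x ->
  ev_dd (ext_d a) x u v z = 0.
Proof.
move=> oU sa Ux; apply: big1 => i _; apply: big1 => j _; apply: big1 => k _.
suff -> : dd (ext_d a) x i j k = 0 by rewrite mulr0.
rewrite /dd.
have E l p q : pd l (fun y => ext_d a y p q) x =
    pd l (pd p (fun y => a y 0 q)) x - pd l (pd q (fun y => a y 0 p)) x.
  have : pd l (fun y => pd p (fun y => a y 0 q) y + (-1) * pd q (fun y => a y 0 p) y) x =
      pd l (pd p (fun y => a y 0 q)) x - pd l (pd q (fun y => a y 0 p)) x.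
    rewrite (pdD l (smooth_ck0 (smooth_pd p (sa q))) (smooth_ck0 (smoothM oU (smooth_cst U (-1))
      (smooth_pd q (sa p))))) ?inE //.
    rewrite (pdM l (smooth_ck0 (smooth_cst U (-1))) (smooth_ck0 (smooth_pd q (sa p)))) ?inE //.
    by rewrite pd_cst mulr0 addr0 mulN1r.
  by move=> <-; congr (pd l _ x); apply/funext => y; rewrite mxE mulN1r.
have S p q k := pd_comm p q oU (sa k) Ux.
rewrite !E (S j i k) (S k i j) (S k j i); atoms; ring.
Qed.

(** Leibniz's rule d(a /\ b) = da /\ b - a /\ db; the product of a 2-form with a 1-form is the
    cyclic sum over (u, v, z). *)
Lemma ev_ddW U a b x u v z : U x -> smooth_map U a -> smooth_map U b ->
  ev_dd (a \w b) x u v z =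
  ev2 (ext_d a x) u v * ev1 (b x) z + ev2 (ext_d a x) v z * ev1 (b x) u
  + ev2 (ext_d a x) z u * ev1 (b x) v
  - (ev2 (ext_d b x) u v * ev1 (a x) z + ev2 (ext_d b x) v z * ev1 (a x) u
  + ev2 (ext_d b x) z u * ev1 (a x) v).
Proof.
move=> Ux sa sb.
have E (A : 'M[R]_n) (c w1 w2 w3 : 'rV[R]_n) : ev2 A w1 w2 * ev1 c w3 =
    \sum_i \sum_j \sum_k w1 0 i * w2 0 j * w3 0 k * (A i j * c 0 k).
  rewrite ev2E ev1E mulr_suml; apply: eq_bigr => i _; rewrite mulr_suml; apply: eq_bigr => j _.
  by rewrite mulr_sumr; apply: eq_bigr => k _; atoms; ring.
have rot (T : 'I_n -> 'I_n -> 'I_n -> R) : \sum_i \sum_j \sum_k T i j k = \sum_k \sum_i \sum_j T i j k.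
  under eq_bigr do rewrite exchange_big /=.
  by rewrite exchange_big.
rewrite !E.
(* The cyclically shifted sums are reindexed so that all six triple sums can be compared term by
   term in the order (u, v, z). *)
rewrite [\sum_i \sum_j \sum_k v 0 i * _ * _ * (ext_d a x _ _ * _)]rot.
rewrite [\sum_i \sum_j \sum_k v 0 i * _ * _ * (ext_d b x _ _ * _)]rot.
rewrite -[\sum_i \sum_j \sum_k z 0 i * _ * _ * (ext_d a x _ _ * _)](rot (fun j k i => z 0 i * u 0 j * v 0
  k * (ext_d a x i j * b x 0 k))).
rewrite -[\sum_i \sum_j \sum_k z 0 i * _ * _ * (ext_d b x _ _ * _)](rot (fun j k i => z 0 i * u 0 j * v 0
  k * (ext_d b x i j * a x 0 k))).
rewrite -!big_split -sumrB; apply: eq_bigr => i _ /=.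
rewrite -!big_split -sumrB; apply: eq_bigr => j _ /=.
rewrite -!big_split -sumrB; apply: eq_bigr => k _ /=.
have D l p q : pd l (fun y => (a \w b) y p q) x =
    a x 0 p * pd l (fun y => b y 0 q) x + b x 0 q * pd l (fun y => a y 0 p) x -
    (a x 0 q * pd l (fun y => b y 0 p) x + b x 0 p * pd l (fun y => a y 0 q) x).
  have M p' q' := pdM l (smooth_ck0 (sa p')) (smooth_ck0 (sb q')) (mem_set Ux).
  rewrite -!M -[RHS]deriveB; first by congr (pd l _ x); apply/funext => y; rewrite mxE.
    by apply: derivableM; [exact: smooth_derivable (sa _) Ux|exact: smooth_derivable (sb _) Ux].
  by apply: derivableM; [exact: smooth_derivable (sa _) Ux|exact: smooth_derivable (sb _) Ux].
by rewrite /dd !D !mxE; atoms; ring.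
Qed.

Lemma ev_ddF U f a b x u v z : open U -> U x -> smooth U f -> smooth_map U a -> smooth_map U b ->
  ev_dd (f :* (a \w b)) x u v z =
  ev1 (grad f x) u * ev2 ((a \w b) x) v z + ev1 (grad f x) v * ev2 ((a \w b) x) z u
  + ev1 (grad f x) z * ev2 ((a \w b) x) u v + f x * ev_dd (a \w b) x u v z.
Proof.
move=> oU Ux sf sa sb.
(* f (a /\ b) = (f a) /\ b reduces the claim to the wedge of two 1-forms. *)
have -> : (f :* (a \w b))%F = (f :* a) \w b.
  apply/funext => y; apply/matrixP => i j; rewrite !mxE.
  by atoms; move: (f y) => fy; ring.
rewrite (ev_ddW _ _ _ Ux (smooth_mapF oU sf sa) sb) (ev_ddW _ _ _ Ux sa sb).
by rewrite !(ev2_ext_dF _ _ Ux sf sa) !ev1F !ev2s; atoms; move: (f x) => ?; ring.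
Qed.

End Exterior.

(** * Pullback of forms *)

Section Pullback.
Variables (R : realType) (n m : nat) (U : set 'rV[R]_n) (F : 'rV[R]_n -> 'rV[R]_m).
Hypotheses (oU : open U) (sF : smooth_map U F).
Variables (V : set 'rV[R]_m).
Hypotheses (oV : open V) (FUV : forall x, U x -> V (F x)).
Implicit Types (a b : form1 R m).

Lemma ev1_pullback a x v : ev1 (pullback F a x) v = ev1 (a (F x)) (v *m 'J F x).
Proof. by rewrite /ev1 /pullback trmx_mul mulmxA. Qed.

Lemma pullbackE a j : {in U, (fun x => pullback F a x 0 j) =1
  fun x => \sum_k a (F x) 0 k * pd j (fun y => F y 0 k) x}.
Proof.
move=> x; rewrite inE => Ux; rewrite mxE; apply: eq_bigr => k _.
by rewrite mxE (jacobianE oU sF).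
Qed.

Lemma smooth_pullback a : smooth_map V a -> smooth_map U (pullback F a).
Proof.
move=> sa j; apply: (eq_smooth oU (fun x Ux => esym (pullbackE a j Ux))).
apply: (smooth_sum _ oU) => k; apply: (smoothM oU (smooth_comp oU sF oV FUV (sa k))).
exact/smooth_pd/sF.
Qed.

(** d commutes with pullback: the terms containing second derivatives of [F] are symmetric in the
    two indices and cancel in the antisymmetrisation. *)
Lemma ev2_pullback a x u v : smooth_map V a -> U x ->
  ev2 (ext_d (pullback F a) x) u v = ev2 (ext_d a (F x)) (u *m 'J F x) (v *m 'J F x).
Proof.
move=> sa Ux.
have E i j : pd i (fun y => pullback F a y 0 j) x =
    \sum_k \sum_l 'J F x i l * 'J F x j k * pd l (fun y => a y 0 k) (F x)
    + \sum_k a (F x) 0 k * pd i (pd j (fun y => F y 0 k)) x.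
  have -> : pd i (fun y => pullback F a y 0 j) x =
      pd i (fun x => \sum_k a (F x) 0 k * pd j (fun y => F y 0 k) x) x.
    by apply: (eq_pd i oU _ (mem_set Ux)); exact: pullbackE.
  have sc k := smooth_comp oU sF oV FUV (sa k).
  have -> : pd i (fun x => \sum_k a (F x) 0 k * pd j (fun y => F y 0 k) x) x =
      \sum_k pd i (fun x => a (F x) 0 k * pd j (fun y => F y 0 k) x) x.
    rewrite -[RHS]derive_sum; first by congr (pd i _ x); apply/funext => y; rewrite fct_sumE.
    by move=> k; apply: derivableM; [exact: smooth_derivable (sc k) Ux|exact: smooth_derivable (smooth_pd
      j (sF k)) Ux].
  rewrite -big_split; apply: eq_bigr => k _.
  rewrite (pdM i (smooth_ck0 (sc k)) (smooth_ck0 (smooth_pd j (sF k))) (mem_set Ux)).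
  rewrite (pd_comp oU sF oV FUV i (sa k) Ux) addrC (jacobianE oU sF) //; congr (_ + _).
  by rewrite mulr_sumr; apply: eq_bigr => l _; rewrite (jacobianE oU sF) //; atoms; ring.
suff -> : ext_d (pullback F a) x = 'J F x *m ext_d a (F x) *m ('J F x)^T.
  by rewrite /ev2 trmx_mul !mulmxA.
apply/matrixP => i j; rewrite mxE !E.
rewrite [X in _ + X - (_ + _)](_ : _ = \sum_k a (F x) 0 k * pd j (pd i (fun y => F y 0 k)) x); last first.
  by apply: eq_bigr => k _; rewrite (pd_comm i j oU (sF k) Ux).
rewrite opprD addrACA subrr addr0 [X in _ - X]exchange_big -sumrB mxE; apply: eq_bigr => k _.
rewrite [('J F x *m _) _ _]mxE mulr_suml -sumrB; apply: eq_bigr => l _.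
rewrite [(_^T) _ _]mxE [(ext_d a _) _ _]mxE.
by atoms; ring.
Qed.

End Pullback.

(** * The projection of R^10 = R^9 x R onto R^9 *)

Section Gauge.
Variable R : realType.

Definition bproj (q : 'rV[R]_10) : 'rV[R]_9 := q *m pid_mx 9.
Definition bsection (b : 'rV[R]_9) : 'rV[R]_10 := b *m pid_mx 9.
Definition fibre_coord (q : 'rV[R]_10) : R := q 0 ord_max.

Lemma bprojK b : bproj (bsection b) = b.
Proof. by rewrite /bproj /bsection -mulmxA mul_pid_mx pid_mx_1 mulmx1. Qed.

Lemma bprojE q j : bproj q 0 j = q 0 (widen_ord (leqnSn 9) j).
Proof.
rewrite mxE (bigD1 (widen_ord (leqnSn 9) j)) //= big1 => [|i ij].
  by rewrite mxE /= eqxx ltn_ord mulr1 addr0.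
rewrite mxE [_ == _](_ : _ = false) ?mulr0 //.
by apply/negbTE; apply: contra_neq ij => ij; apply/val_inj.
Qed.

Lemma bproj_coord j : (fun q => bproj q 0 j) = (fun q : 'rV[R]_10 => q 0 (widen_ord (leqnSn 9) j)).
Proof. by apply/funext => q; rewrite bprojE. Qed.

Lemma smooth_bproj (U : set 'rV[R]_10) : smooth_map U bproj.
Proof.
by move=> j; rewrite bproj_coord; exact: smooth_coord.
Qed.

Lemma jacobian_bproj q : 'J bproj q = pid_mx 9.
Proof.
apply/matrixP => i j; rewrite (jacobianE openT (@smooth_bproj setT)) //.
rewrite bproj_coord pd_coord mxE -val_eqE /=; case: eqP => [->|] //=; by rewrite ltn_ord.
Qed.

Lemma mul_jacobian_bproj q v : v *m 'J bproj q = bproj v.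
Proof. by rewrite jacobian_bproj. Qed.

Lemma ev1_grad_fibre q v : ev1 (grad fibre_coord q) v = fibre_coord v.
Proof.
rewrite ev1E (bigD1 ord_max) //= big1 => [|i i9]; first by rewrite mxE pd_coord eqxx mul1r addr0.
by rewrite mxE pd_coord (negbTE i9) mul0r.
Qed.

Lemma bproj_eq0 v : bproj v = 0 -> fibre_coord v = 0 -> v = 0.
Proof.
move=> /rowP b0 v9; apply/rowP => i; rewrite [RHS]mxE.
have [i9|i9] := ltnP i 9.
  have := b0 (Ordinal i9); rewrite bprojE [RHS]mxE => <-; congr (v 0 _); exact/val_inj.
rewrite -[RHS]v9; congr (v 0 _); apply/val_inj => /=.
by apply/eqP; rewrite eqn_leq i9 -ltnS ltn_ord.
Qed.

Lemma open_bproj (B : set 'rV[R]_9) : open B -> open (bproj @^-1` B).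
Proof.
move=> oB; apply: open_comp => // q _.
exact: differentiable_continuous (smooth_map_differentiable openT (@smooth_bproj setT) I).
Qed.

Lemma jacobian_comp n m p (U : set 'rV[R]_n) (V : set 'rV[R]_m) (F : 'rV[R]_n -> 'rV[R]_m)
    (G : 'rV[R]_m -> 'rV[R]_p) x :
  open U -> smooth_map U F -> open V -> (forall x, U x -> V (F x)) -> smooth_map V G -> U x ->
  'J (G \o F) x = 'J F x *m 'J G (F x).
Proof.
move=> oU sF oV FUV sG Ux.
have sGF : smooth_map U (G \o F) by move=> j; exact: (smooth_comp oU sF oV FUV (sG j)).
apply/matrixP => i j; rewrite (jacobianE oU sGF) // mxE.
rewrite (pd_comp oU sF oV FUV i (sG j) Ux); apply: eq_bigr => k _.
by rewrite (jacobianE oV sG) //; exact: FUV.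
Qed.

Lemma fibred_bproj m (B : set 'rV[R]_9) (M : set 'rV[R]_m) piB : open B ->
  fibred B M piB -> fibred (bproj @^-1` B) M (piB \o bproj).
Proof.
move=> oB [spi piM fpi]; have oP := open_bproj oB; set P := bproj @^-1` B in oP *.
have PB x : P x -> B (bproj x) by [].
split.
- by move=> j; exact: (smooth_comp oP (@smooth_bproj P) oB PB (spi j)).
- rewrite -piM; apply/seteqP; split => y /= [q qP <-]; first by exists (bproj q).
  by exists (bsection q); rewrite /= ?bprojK //; rewrite /P /= bprojK.
- move=> q Pq; rewrite (jacobian_comp oP (@smooth_bproj P) oB PB spi Pq).
  have /row_fullP[X XJ] := fpi _ (PB q Pq); rewrite jacobian_bproj; apply/row_fullP.
  exists (X *m pid_mx 9); rewrite mulmxA -[X *m _ *m _]mulmxA mul_pid_mx pid_mx_1 mulmx1.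
  exact: XJ.
Qed.

End Gauge.

(** * Coframes and structure equations *)

Ltac smth2 := lazymatch goal with
  | |- smooth_map _ (_ + _) => apply: smooth_mapD; smth2
  | |- smooth_map _ (- _) => apply: smooth_mapN; smth2
  | |- smooth_map _ (_ *: _) => apply: smooth_mapZ; smth2
  | |- smooth_map _ (fscale _ _) => apply: smooth_mapF; smth2
  | |- smooth_map _ (iprod _ _) => apply: smooth_iprod; smth2
  | |- smooth_map _ (grad _) => apply: smooth_grad; smth2
  | |- smooth2 _ (_ + _) => apply: smooth2D; smth2
  | |- smooth2 _ (- _) => apply: smooth2N; smth2
  | |- smooth2 _ (_ *: _) => apply: smooth2Z; smth2
  | |- smooth2 _ (fscale _ _) => apply: smooth2F; smth2
  | |- smooth2 _ (wedge _ _) => apply: smooth2W; smth2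
  | |- smooth2 _ (ext_d _) => apply: smooth2_ext_d; smth2
  | |- smooth_map _ _ => assumption
  | |- open _ => assumption
  | |- smooth _ _ => smth
  | |- _ => idtac
  end.

Ltac smterms := simpl; repeat match goal with
  | |- and3 _ _ _ => split
  | |- and4 _ _ _ _ => split
  | |- True => exact: I
  | |- smooth _ _ => smth2
  | |- smooth_map _ _ => smth2
  end.

Section Frames.
Variables (R : realType) (n : nat).
Implicit Types (U : set 'rV[R]_n) (x : 'rV[R]_n).

Lemma smooth_det m U (A : 'rV[R]_n -> 'M[R]_m) : open U ->
  (forall i j, smooth U (fun x => A x i j)) -> smooth U (fun x => \det (A x)).
Proof.
move=> oU sA; apply: (smooth_sum _ oU) => s.
apply: (smoothM oU (smooth_cst U _)); apply: (smooth_prod _ oU) => i; exact: sA.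
Qed.

(** Cramer's rule: cofactors divided by the nonvanishing determinant. *)
Lemma smooth_invmx m U (A : 'rV[R]_n -> 'M[R]_m) : open U ->
  (forall x, U x -> A x \in unitmx) ->
  (forall i j, smooth U (fun x => A x i j)) ->
  forall i j, smooth U (fun x => invmx (A x) i j).
Proof.
move=> oU uA sA i j.
apply: (@eq_smooth _ _ _ (fun x => (\det (A x))^-1 * cofactor (A x) j i) _ oU).
  by move=> x; rewrite inE => Ux; rewrite /invmx (uA _ Ux) !mxE.
apply: (smoothM oU); first apply: (smoothV oU).
- by move=> x /uA; rewrite unitmxE unitfE.
- exact: smooth_det.
- apply: (smoothM oU (smooth_cst U _)); apply: (smooth_det oU) => k l.
  by apply: (eq_smooth oU _ (sA (lift j k) (lift i l))) => x _; rewrite !mxE.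
Qed.

Lemma coframe_dual U (s : seq (form1 R n)) : open U -> coframe U s ->
  (forall i : 'I_n, smooth_map U (nth (fun=> 0) s i)) ->
  exists E : 'I_n -> form1 R n, (forall j, smooth_map U (E j)) /\
    forall x, U x -> forall i j : 'I_n, ev1 (nth (fun=> 0) s i x) (E j x) = (i == j)%:R.
Proof.
move=> oU [_ us] sm; pose M x : 'M[R]_n := \matrix_(i < n) (nth (fun=> 0) s i x).
exists (fun j x => \row_k invmx (M x) k j); split=> [j k|x Ux i j].
  apply: (@eq_smooth _ _ _ (fun x => invmx (M x) k j) _ oU).
    by move=> x _; rewrite mxE.
  by apply: (smooth_invmx oU us) => i l; apply: (eq_smooth oU _ (sm i l)) => x _; rewrite mxE.
have /matrixP/(_ i j) := mulmxV (us x Ux); rewrite !mxE => <-.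
by rewrite ev1E; apply: eq_bigr => k _; rewrite !mxE.
Qed.

Lemma coframe_vec U (s : seq (form1 R n)) x (c : 'I_n -> R) :
  coframe U s -> U x -> exists e, forall i : 'I_n, ev1 (nth (fun=> 0) s i x) e = c i.
Proof.
move=> [_ us] Ux; pose M : 'M[R]_n := \matrix_(i < n) (nth (fun=> 0) s i x).
exists (\row_k (invmx M *m (\col_i c i)) k 0) => i.
have uM : M \in unitmx by exact: us.
have := mulKVmx uM (\col_i c i); move/colP/(_ i); rewrite [RHS]mxE => <-.
by rewrite ev1E [RHS]mxE; apply: eq_bigr => k _; rewrite !mxE.
Qed.

Lemma coframe_inj U (s : seq (form1 R n)) x e :
  coframe U s -> U x -> (forall i : 'I_n, ev1 (nth (fun=> 0) s i x) e = 0) -> e = 0.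
Proof.
move=> [_ us] Ux e0; pose M : 'M[R]_n := \matrix_(i < n) (nth (fun=> 0) s i x).
have uM : M \in unitmx by exact: us.
have : M *m e^T = 0.
  apply/colP => i; rewrite [RHS]mxE -(e0 i) ev1E mxE; apply: eq_bigr => k _.
  by rewrite !mxE.
by move/(congr1 (mulmx (invmx M))); rewrite mulKmx // mulmx0 => /(congr1 trmx); rewrite trmxK trmx0.
Qed.

Lemma coframe_intro U (s : seq (form1 R n)) : size s = n ->
  (forall x e, U x -> (forall i : 'I_n, ev1 (nth (fun=> 0) s i x) e = 0) -> e = 0) ->
  coframe U s.
Proof.
move=> sn s0; split => // x Ux; set M := \matrix_i _.
rewrite -unitmx_tr -row_free_unit -kermx_eq0; apply/rowV0P => v /sub_kermxP vM.
apply: s0 Ux _ => i; move/rowP/(_ i): vM; rewrite [RHS]mxE => <-.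
by rewrite ev1E mxE; apply: eq_bigr => k _; rewrite !mxE mulrC.
Qed.

End Frames.

Lemma coframe9_vec (R : realType) (B : set 'rV[R]_9) w1 w2 w3 w4 w5 v1 v2 v3 v4 x :
  coframe B [:: w1; w2; w3; w4; w5; v1; v2; v3; v4] -> B x ->
  forall a1 a2 a3 a4 a5 b1 b2 b3 b4 : R, exists e,
  [/\ ev1 (w1 x) e = a1, ev1 (w2 x) e = a2, ev1 (w3 x) e = a3, ev1 (w4 x) e = a4 &
      ev1 (w5 x) e = a5] /\
  [/\ ev1 (v1 x) e = b1, ev1 (v2 x) e = b2, ev1 (v3 x) e = b3 & ev1 (v4 x) e = b4].
Proof.
move=> cB Bx a1 a2 a3 a4 a5 b1 b2 b3 b4.
have [e eE] := coframe_vec (fun i => nth 0 [:: a1; a2; a3; a4; a5; b1; b2; b3; b4] i) cB Bx.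
exists e; split; split.
- exact: (eE (@Ordinal 9 0 isT)).
- exact: (eE (@Ordinal 9 1 isT)).
- exact: (eE (@Ordinal 9 2 isT)).
- exact: (eE (@Ordinal 9 3 isT)).
- exact: (eE (@Ordinal 9 4 isT)).
- exact: (eE (@Ordinal 9 5 isT)).
- exact: (eE (@Ordinal 9 6 isT)).
- exact: (eE (@Ordinal 9 7 isT)).
- exact: (eE (@Ordinal 9 8 isT)).
Qed.

(** * Formal sums of forms and the identities d^2 = 0 *)

Section Bianchi.
Variables (R : realType) (n : nat).
Implicit Types (U : set 'rV[R]_n) (x u v z : 'rV[R]_n) (a b : form1 R n).

Lemma ev1_gradM U (f g : scal R n) x v : smooth U f -> smooth U g -> U x ->
  ev1 (grad (fun x => f x * g x) x) v = f x * ev1 (grad g x) v + g x * ev1 (grad f x) v.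
Proof.
move=> sf sg Ux; rewrite !ev1E !mulr_sumr -big_split; apply: eq_bigr => i _.
rewrite [grad _ _ _ _]mxE (pdM i (smooth_ck0 sf) (smooth_ck0 sg) (mem_set Ux)) !mxE /=.
by atoms; move: (f x) (g x) => ? ?; ring.
Qed.

Lemma eq_grad U (f g : scal R n) x : open U -> {in U, f =1 g} -> U x ->
  grad f x = grad g x.
Proof. by move=> oU fg Ux; apply/rowP => i; rewrite !mxE; exact: eq_pd (mem_set Ux). Qed.

(* A 2-form as a formal sum of terms f a /\ b. *)
Definition terms := seq ((scal R n) * (form1 R n) * (form1 R n)).
Implicit Type l : terms.

Fixpoint ev_terms l x u v : R := if l is (f, a, b) :: l' then
  f x * (ev1 (a x) u * ev1 (b x) v - ev1 (a x) v * ev1 (b x) u) + ev_terms l' x u v else 0.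

Fixpoint smooth_terms U l : Prop := if l is (f, a, b) :: l' then
  [/\ smooth U f, smooth_map U a, smooth_map U b & smooth_terms U l'] else True.

Fixpoint form_of l : 'rV[R]_n -> 'M[R]_n := if l is (f, a, b) :: l' then
  fscale f (wedge a b) + form_of l' else 0.

(** The value on (u, v, z) of df /\ a /\ b + f (da /\ b - a /\ db), summed over the terms. The
    values of [ext_d] are left in place, to be rewritten by the structure equations where these are
    known. *)
Fixpoint d_terms l x u v z : R := if l is (f, a, b) :: l' then
  ev1 (grad f x) u * (ev1 (a x) v * ev1 (b x) z - ev1 (a x) z * ev1 (b x) v)
  + ev1 (grad f x) v * (ev1 (a x) z * ev1 (b x) u - ev1 (a x) u * ev1 (b x) z)
  + ev1 (grad f x) z * (ev1 (a x) u * ev1 (b x) v - ev1 (a x) v * ev1 (b x) u)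
  + f x * (ev2 (ext_d a x) u v * ev1 (b x) z + ev2 (ext_d a x) v z * ev1 (b x) u
  + ev2 (ext_d a x) z u * ev1 (b x) v
  - (ev2 (ext_d b x) u v * ev1 (a x) z + ev2 (ext_d b x) v z * ev1 (a x) u
  + ev2 (ext_d b x) z u * ev1 (a x) v)) + d_terms l' x u v z else 0.

Definition d_eq U a l := forall x, U x -> forall u v, ev2 (ext_d a x) u v = ev_terms l x u v.

Lemma ev_form_of l x u v : ev2 (form_of l x) u v = ev_terms l x u v.
Proof.
elim: l => [|[[f a] b] l IH] /=; first by rewrite /ev2 mulmx0 mul0mx mxE.
by rewrite ev2D IH ev2F ev2W.
Qed.

Lemma smooth_form_of U l : open U -> smooth_terms U l -> smooth2 U (form_of l).
Proof.
move=> oU; elim: l => [_|[[f a] b] l IH] /=.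
  by move=> i j; apply: (eq_smooth oU _ (smooth_cst U 0)) => x _; rewrite mxE.
by move=> [sf sa sb /IH sl]; exact: (smooth2D oU (smooth2F oU sf (smooth2W oU sa sb)) sl).
Qed.

Lemma ev_dd_form_of U l x u v z : open U -> U x -> smooth_terms U l ->
  ev_dd (form_of l) x u v z = d_terms l x u v z.
Proof.
move=> oU Ux; elim: l => [_|[[f a] b] l IH] /=.
  apply: big1 => i _; apply: big1 => j _; apply: big1 => k _.
  suff -> : dd (0 : 'rV[R]_n -> 'M[R]_n) x i j k = 0 by rewrite mulr0.
  have E p q r : pd p (fun y => (0 : 'rV[R]_n -> 'M[R]_n) y q r) x = 0.
    transitivity (pd p (fun _ : 'rV[R]_n => 0 : R) x); last by rewrite pd_cst.
    by congr (pd p _ x); apply/funext => y; rewrite mxE.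
  by rewrite /dd !E !addr0.
move=> [sf sa sb sl]; rewrite -(IH sl).
rewrite (ev_ddD _ _ _ Ux (smooth2F oU sf (smooth2W oU sa sb)) (smooth_form_of oU sl)).
by rewrite (ev_ddF _ _ _ oU Ux sf sa sb) (ev_ddW _ _ _ Ux sa sb) !ev2W.
Qed.

Lemma d_eq_form_of U a l : d_eq U a l -> {in U, ext_d a =1 form_of l}.
Proof.
by move=> E x; rewrite inE => Ux; apply: ev2_inj => u v; rewrite ev_form_of (E x Ux).
Qed.

(** d(da) = 0 read through the structure equation of [a]. Where [l] contains connection forms, the
    result is a linear relation between their unknown exterior derivatives. *)
Lemma bianchi U a l : open U -> smooth_map U a -> smooth_terms U l -> d_eq U a l ->
  forall x, U x -> forall u v z, d_terms l x u v z = 0.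
Proof.
move=> oU sa sl E x Ux u v z; rewrite -(ev_dd_form_of u v z oU Ux sl).
by rewrite -(eq_ev_dd u v z oU Ux (d_eq_form_of E)) (ev_dd_ext_d u v z oU sa Ux).
Qed.

Lemma ev1_grad_cst (c : R) x v : ev1 (grad (fun=> c) x) v = 0.
Proof. by rewrite grad_cst /ev1 mul0mx mxE. Qed.

Definition terms1 := seq ((scal R n) * (form1 R n)).

Fixpoint ev_terms1 (l : terms1) x u : R :=
  if l is (f, a) :: l' then f x * ev1 (a x) u + ev_terms1 l' x u else 0.

Fixpoint smooth_terms1 U (l : terms1) : Prop :=
  if l is (f, a) :: l' then [/\ smooth U f, smooth_map U a & smooth_terms1 U l'] else True.

Fixpoint form1_of (l : terms1) : form1 R n :=
  if l is (f, a) :: l' then fscale f a + form1_of l' else 0.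

Fixpoint d_terms1 (l : terms1) x u v : R :=
  if l is (f, a) :: l' then
  ev1 (grad f x) u * ev1 (a x) v - ev1 (grad f x) v * ev1 (a x) u + f x * ev2 (ext_d a x) u v
  + d_terms1 l' x u v else 0.

Lemma smooth_form1_of U (l : terms1) : open U -> smooth_terms1 U l -> smooth_map U (form1_of l).
Proof.
move=> oU; elim: l => [_|[f a] l IH] /=.
  by move=> i; apply: (eq_smooth oU _ (smooth_cst U 0)) => x _; rewrite mxE.
by move=> [sf sa /IH sl]; exact: (smooth_mapD oU (smooth_mapF oU sf sa) sl).
Qed.

Lemma ev_form1_of (l : terms1) x u : ev1 (form1_of l x) u = ev_terms1 l x u.
Proof.
elim: l => [|[f a] l IH] /=; first by rewrite /ev1 mul0mx mxE.
by rewrite ev1D IH ev1F.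
Qed.

Lemma ext_d_form1_of U (l : terms1) x u v : open U -> smooth_terms1 U l -> U x ->
  ev2 (ext_d (form1_of l) x) u v = d_terms1 l x u v.
Proof.
move=> oU; elim: l => [_|[f a] l IH] /=.
  move=> Ux; suff -> : ext_d (0 : form1 R n) x = 0 by rewrite /ev2 mulmx0 mul0mx mxE.
  have E p q : pd p (fun y => (0 : form1 R n) y 0 q) x = 0.
    transitivity (pd p (fun _ : 'rV[R]_n => 0 : R) x); last by rewrite pd_cst.
    by congr (pd p _ x); apply/funext => y; rewrite mxE.
  by apply/matrixP => i j; rewrite [LHS]mxE [RHS]mxE !E subrr.
move=> [sf sa sl] Ux; rewrite -(IH sl Ux).
rewrite (ev2_ext_dD _ _ Ux (smooth_mapF oU sf sa) (smooth_form1_of oU sl)).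
by rewrite (ev2_ext_dF _ _ Ux sf sa).
Qed.

Lemma eq_ev_form1 U a (l : terms1) : open U -> (forall x, U x -> forall u, ev1 (a x) u = ev_terms1 l x u) ->
  {in U, a =1 form1_of l}.
Proof.
by move=> oU E x; rewrite inE => Ux; apply: ev1_inj => u; rewrite ev_form1_of E.
Qed.

Lemma eq_d_terms1 U a (l : terms1) x u v : open U -> smooth_terms1 U l -> U x ->
  (forall x, U x -> forall u, ev1 (a x) u = ev_terms1 l x u) ->
  ev2 (ext_d a x) u v = d_terms1 l x u v.
Proof.
move=> oU sl Ux /(eq_ev_form1 oU) E.
by rewrite (eq_ext_d oU E (mem_set Ux)) (ext_d_form1_of u v oU sl Ux).
Qed.

(** d(df) = 0 applied to an expansion of df in given 1-forms: the counterpart of [bianchi] for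
    functions. *)
Lemma d_grad U f (l : terms1) x u v : open U -> smooth U f -> smooth_terms1 U l -> U x ->
  (forall x, U x -> forall u, ev1 (grad f x) u = ev_terms1 l x u) ->
  d_terms1 l x u v = 0.
Proof.
move=> oU sf sl Ux E; rewrite -(eq_d_terms1 u v oU sl Ux E) (ext_d_grad oU sf Ux).
by rewrite /ev2 mulmx0 mul0mx mxE.
Qed.

(* The structure equations of the adapted coframe with K = I^3 and
   L = -I^3_{|5}/2; in this shape they are invariant under
   (w1, ..., w5) -> (-w1, w4, w5, w2, w3), which exchanges K and L. *)
Record structure_eqs U (w1 w2 w3 w4 w5 v1 v2 v3 v4 : form1 R n)
    (I1 I2 K L T : scal R n) : Prop := StructureEqs {
  str1 : d_eq U w1 [:: (fun=> -1, w1, v1); (fun=> 1, w2, w4)];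
  str2 : d_eq U w2 [:: (fun=> -1, w1, v3); (fun=> 1, w2, v2); (fun=> - 2^-1, w2, v1); (fun=> 1, w3, w4)];
  str3 : d_eq U w3 [:: (fun=> -1, w2, v3); (fun=> 2, w3, v2); (T, w1, w3); (I1, w1, w4); (K, w2, w3)];
  str4 : d_eq U w4 [:: (fun=> -1, w1, v4); (fun=> -1, w4, v2); (fun=> - 2^-1, w4, v1); (fun=> -1, w2, w5)];
  str5 : d_eq U w5 [:: (fun=> 1, w4, v4); (fun=> -2, w5, v2); (I2, w1, w2); (T, w1, w5); (L, w4, w5)] }.

End Bianchi.

(* Syntactic rewriting with d_eq; keyed unification of forms is slow. *)
Ltac rw_d E Bx := repeat match type of E with
  | @d_eq _ _ _ ?w _ => match goal with
    | |- context [@ev2 _ _ (ext_d w _) ?u ?v] => rewrite -> (E _ Bx u v) end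
  end.
Ltac rw_cst := repeat match goal with
  | |- context [@ev1 ?R ?n (grad (fun=> ?c) ?x) ?v] => rewrite -> (@ev1_grad_cst R n c x v) end.

Ltac vals h := let H1 := fresh in let H2 := fresh in
  case: (h) => H1 H2;
  let h1 := fresh in let h2 := fresh in let h3 := fresh in let h4 := fresh in let h5 := fresh in
  case: H1 => h1 h2 h3 h4 h5;
  rewrite -> ?h1, ?h2, ?h3, ?h4, ?h5; clear h1 h2 h3 h4 h5;
  case: H2 => h1 h2 h3 h4;
  rewrite -> ?h1, ?h2, ?h3, ?h4; clear h1 h2 h3 h4.

(* Unification must never unfold these: comparing two iterated derivatives by
   conversion does not terminate in practice. *)
Opaque smooth smooth_map smooth2 iprod ext_d pd grad wedge fscale ev1 ev2 pullback bproj fibre_coord.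

(** * Vanishing of I^3 from that of a coframe derivative *)

Section Torsion.
Variables (R : realType) (B : set 'rV[R]_9) (w1 w2 w3 w4 w5 v1 v2 v3 v4 : form1 R 9).
Variables (I1 I2 K L T : scal R 9).
Hypothesis oB : open B.
Hypothesis cB : coframe B [:: w1; w2; w3; w4; w5; v1; v2; v3; v4].
Hypothesis sw : [/\ smooth_map B w1, smooth_map B w2, smooth_map B w3, smooth_map B w4 & smooth_map B w5].
Hypothesis sv : [/\ smooth_map B v1, smooth_map B v2, smooth_map B v3 & smooth_map B v4].
Hypothesis str : structure_eqs B w1 w2 w3 w4 w5 v1 v2 v3 v4 I1 I2 K L T.

(** Both values follow from d^2 = 0, for w1 on (e1, e3, e5) and for w2 on (e2, e3, e5). The -1 comes
    from the term -w2 /\ w5 of d w4, which enters through w3 /\ w4 in d w2. *)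
Lemma dv_35 x e3 e5 : B x ->
  [/\ ev1 (w1 x) e3 = 0, ev1 (w2 x) e3 = 0, ev1 (w3 x) e3 = 1, ev1 (w4 x) e3 = 0 &
      ev1 (w5 x) e3 = 0] ->
  [/\ ev1 (v1 x) e3 = 0, ev1 (v2 x) e3 = 0, ev1 (v3 x) e3 = 0 & ev1 (v4 x) e3 = 0] ->
  [/\ ev1 (w1 x) e5 = 0, ev1 (w2 x) e5 = 0, ev1 (w3 x) e5 = 0, ev1 (w4 x) e5 = 0 &
      ev1 (w5 x) e5 = 1] ->
  [/\ ev1 (v1 x) e5 = 0, ev1 (v2 x) e5 = 0, ev1 (v3 x) e5 = 0 & ev1 (v4 x) e5 = 0] ->
  ev2 (ext_d v1 x) e3 e5 = 0 /\ ev2 (ext_d v2 x) e3 e5 = -1.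
Proof.
move=> Bx [a1 a2 a3 a4 a5] [b1 b2 b3 b4] [c1 c2 c3 c4 c5] [d1 d2 d3 d4].
have [[s1 s2 s3 s4 s5] [t1 t2 t3 t4]] := (sw, sv).
have [e1 [[k1 k2 k3 k4 k5] [l1 l2 l3 l4]]] := coframe9_vec cB Bx 1 0 0 0 0 0 0 0 0.
have [e2 [[m1 m2 m3 m4 m5] [n1 n2 n3 n4]]] := coframe9_vec cB Bx 0 1 0 0 0 0 0 0 0.
have S1 : smooth_terms B [:: (fun=> -1, w1, v1); (fun=> 1, w2, w4)].
  by smterms.
have S2 : smooth_terms B [:: (fun=> -1, w1, v3); (fun=> 1, w2, v2); (fun=> - 2^-1, w2, v1); (fun=> 1, w3,
  w4)].
  by smterms.
have := bianchi oB s1 S1 (str1 str) Bx e1 e3 e5.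
have := bianchi oB s2 S2 (str2 str) Bx e2 e3 e5.
rewrite /=; rw_cst; rw_d (str1 str) Bx; rw_d (str2 str) Bx; rw_d (str3 str) Bx; rw_d (str4 str) Bx.
simpl.
rewrite -> ?a1, ?a2, ?a3, ?a4, ?a5, ?b1, ?b2, ?b3, ?b4, ?c1, ?c2, ?c3, ?c4, ?c5, ?d1, ?d2, ?d3, ?d4.
rewrite -> ?k1, ?k2, ?k3, ?k4, ?k5, ?l1, ?l2, ?l3, ?l4, ?m1, ?m2, ?m3, ?m4, ?m5, ?n1, ?n2, ?n3, ?n4.
atoms.
move=> H1 H2.
split.
  lra.
lra.
Qed.

(** On (e3, e5) the identity d(d I3) = 0 reads (4 - 1) I3 = 0: the 4 is the w3-coefficient of d I35,
    the -1 is dv2(e3, e5). *)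
Lemma I33_zero (I3 I31 I32 I33 I34 I35 I351 I352 I354 I355 : scal R 9) :
  smooth B I3 -> smooth B I31 -> smooth B I32 -> smooth B I34 -> smooth B I35 ->
  (forall x, B x -> forall u, ev1 (grad I3 x) u = ev_terms1 [:: (I31, w1); (I32, w2); (I33, w3);
    (I34, w4); (I35, w5); (fun x => - 2^-1 * I3 x, v1); (I3, v2)] x u) ->
  (forall x, B x -> forall u, ev1 (grad I35 x) u = ev_terms1 [:: (I351, w1); (I352, w2);
    (fun x => 4 * I3 x, w3); (I354, w4); (I355, w5); (fun x => - 2^-1 * I35 x, v1);
    (fun x => -1 * I35 x, v2)] x u) ->
  vanishes B I33 -> vanishes B I3.
Proof.
move=> sI3 sI31 sI32 sI34 sI35 g3 g35 I33_0 x; rewrite inE => Bx.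
have [[s1 s2 s3 s4 s5] [t1 t2 t3 t4]] := (sw, sv).
have [e3 [a b]] := coframe9_vec cB Bx 0 0 1 0 0 0 0 0 0.
have [e5 [c d]] := coframe9_vec cB Bx 0 0 0 0 1 0 0 0 0.
have [dv1E dv2E] := dv_35 Bx a b c d.
move: a b c d => [a1 a2 a3 a4 a5] [b1 b2 b3 b4] [c1 c2 c3 c4 c5] [d1 d2 d3 d4].
have S : smooth_terms1 B [:: (I31, w1); (I32, w2);
    (I34, w4); (I35, w5); (fun x => - 2^-1 * I3 x, v1); (I3, v2)] by smterms.
have g3' y : B y -> forall u, ev1 (grad I3 y) u = ev_terms1 [:: (I31, w1); (I32, w2);
    (I34, w4); (I35, w5); (fun x => - 2^-1 * I3 x, v1); (I3, v2)] y u.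
  by move=> By u; rewrite (g3 y By) /= (I33_0 y (mem_set By)) mul0r add0r.
have := d_grad e3 e5 oB sI3 S Bx g3'.
simpl.
rewrite -> dv1E, dv2E.
rw_d (str1 str) Bx; rw_d (str2 str) Bx; rw_d (str4 str) Bx; rw_d (str5 str) Bx.
rewrite -> (g35 x Bx e3).
simpl.
rewrite -> ?a1, ?a2, ?a3, ?a4, ?a5, ?b1, ?b2, ?b3, ?b4, ?c1, ?c2, ?c3, ?c4, ?c5, ?d1, ?d2, ?d3, ?d4.
atoms; move: (I3 x) (I35 x) => p q.
lra.
Qed.

(** The same two numbers appear with opposite signs: d(d I35) = 0 on (e3, e5) reads (-4 + 1) I35 =
    0. The w3-coefficient of d I35 = 0 is then 4 I3. *)
Lemma I355_zero (I3 I31 I32 I33 I34 I35 I351 I352 I354 I355 : scal R 9) :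
  smooth B I3 -> smooth B I35 -> smooth B I351 -> smooth B I352 -> smooth B I354 ->
  (forall x, B x -> forall u, ev1 (grad I3 x) u = ev_terms1 [:: (I31, w1); (I32, w2); (I33, w3);
    (I34, w4); (I35, w5); (fun x => - 2^-1 * I3 x, v1); (I3, v2)] x u) ->
  (forall x, B x -> forall u, ev1 (grad I35 x) u = ev_terms1 [:: (I351, w1); (I352, w2);
    (fun x => 4 * I3 x, w3); (I354, w4); (I355, w5); (fun x => - 2^-1 * I35 x, v1);
    (fun x => -1 * I35 x, v2)] x u) ->
  vanishes B I355 -> vanishes B I3.
Proof.
move=> sI3 sI35 sI351 sI352 sI354 g3 g35 I355_0.
have I35_0 : vanishes B I35.
  move=> x; rewrite inE => Bx.
  have [[s1 s2 s3 s4 s5] [t1 t2 t3 t4]] := (sw, sv).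
  have [e3 [a b]] := coframe9_vec cB Bx 0 0 1 0 0 0 0 0 0.
  have [e5 [c d]] := coframe9_vec cB Bx 0 0 0 0 1 0 0 0 0.
  have [dv1E dv2E] := dv_35 Bx a b c d.
  move: a b c d => [a1 a2 a3 a4 a5] [b1 b2 b3 b4] [c1 c2 c3 c4 c5] [d1 d2 d3 d4].
  have S : smooth_terms1 B [:: (I351, w1); (I352, w2); (fun x => 4 * I3 x, w3);
      (I354, w4); (fun x => - 2^-1 * I35 x, v1); (fun x => -1 * I35 x, v2)] by smterms.
  have g35' y : B y -> forall u, ev1 (grad I35 y) u = ev_terms1 [:: (I351, w1); (I352, w2);
      (fun x => 4 * I3 x, w3); (I354, w4); (fun x => - 2^-1 * I35 x, v1); (fun x => -1 * I35 x, v2)] y u.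
    by move=> By u; rewrite (g35 y By) /= (I355_0 y (mem_set By)) mul0r add0r.
  have := d_grad e3 e5 oB sI35 S Bx g35'.
  simpl.
  rewrite -> dv1E, dv2E.
  rewrite -> (ev1_gradM e3 (smooth_cst B 4) sI3 Bx), (ev1_gradM e5 (smooth_cst B 4) sI3 Bx).
  rw_cst; rw_d (str1 str) Bx; rw_d (str2 str) Bx; rw_d (str3 str) Bx; rw_d (str4 str) Bx.
  rewrite -> (g3 x Bx e5).
  simpl.
  rewrite -> ?a1, ?a2, ?a3, ?a4, ?a5, ?b1, ?b2, ?b3, ?b4, ?c1, ?c2, ?c3, ?c4, ?c5, ?d1, ?d2, ?d3, ?d4.
  atoms; move: (I3 x) (I35 x) => p q.
  lra.
move=> x; rewrite inE => Bx.
have [e3 [[a1 a2 a3 a4 a5] [b1 b2 b3 b4]]] := coframe9_vec cB Bx 0 0 1 0 0 0 0 0 0.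
have := g35 x Bx e3; rewrite (eq_grad oB I35_0 Bx) ev1_grad_cst.
simpl; rewrite -> ?a1, ?a2, ?a3, ?a4, ?a5, ?b1, ?b2, ?b3, ?b4.
by move: (I3 x) => p; lra.
Qed.

End Torsion.

(** * The theta equations *)

Section ThetaEquations.
Variables (R : realType) (n : nat) (P : set 'rV[R]_n) (oP : open P).
Variables (W1 W2 W3 W4 W5 V1 V2 V3 V4 : form1 R n).
Variables (I1 I2 K L T : scal R n).
Variables (t1 t2 t3 t4 t5 O1 O2 O3 O4 : form1 R n).
Variables (f1 f2 a f4 f5 f6 f7 g2 b g4 g5 g6 g7 : scal R n).
Variables (A1 A2 A5 A7 Z1 Z3 Z4 : scal R n).

Hypothesis str : structure_eqs P W1 W2 W3 W4 W5 V1 V2 V3 V4 I1 I2 K L T.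
Hypothesis sW : [/\ smooth_map P W1, smooth_map P W2, smooth_map P W3, smooth_map P W4
  & smooth_map P W5].
Hypothesis sf : [/\ smooth P f1, smooth P f2, smooth P a & smooth P f4] /\
  [/\ smooth P f5, smooth P f6 & smooth P f7].
Hypothesis sg : [/\ smooth P g2, smooth P b & smooth P g4] /\
  [/\ smooth P g5, smooth P g6 & smooth P g7].
Hypothesis f1_neq0 : forall x, P x -> f1 x != 0.

Hypothesis T1 : forall x, P x -> forall u, ev1 (t1 x) u = ev_terms1 [:: (f1, W1)] x u.
Hypothesis T2 : forall x, P x -> forall u, ev1 (t2 x) u = ev_terms1 [:: (f2, W1); (a, W2); (f4, W3)] x u.
Hypothesis T3 : forall x, P x -> forall u, ev1 (t3 x) u = ev_terms1 [:: (f5, W1); (f6, W2); (f7, W3)] x u.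
Hypothesis T4 : forall x, P x -> forall u, ev1 (t4 x) u = ev_terms1 [:: (g2, W1); (b, W4); (g4, W5)] x u.
Hypothesis T5 : forall x, P x -> forall u, ev1 (t5 x) u = ev_terms1 [:: (g5, W1); (g6, W4); (g7, W5)] x u.

Hypothesis E1 : d_eq P t1 [:: (fun=> 1, O1, t1); (fun=> 1, t4, t2)].
Hypothesis E2 : d_eq P t2 [:: (fun=> 1, O2, t1); (fun=> 1, O3, t2); (fun=> 1, t4, t3)].
Hypothesis E3 : d_eq P t3 [:: (fun=> 1, O2, t2); (fun=> 2, O3, t3); (fun=> -1, O1, t3);
  (A2, t2, t1); (A1, t4, t1)].
Hypothesis E4 : d_eq P t4 [:: (fun=> 1, O4, t1); (fun=> 1, O1, t4); (fun=> -1, O3, t4);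
  (fun=> 1, t5, t2)].
Hypothesis E5 : d_eq P t5 [:: (fun=> 1, O4, t4); (fun=> 1, O1, t5); (fun=> -2, O3, t5);
  (fun x => A7 x + Z3 x, t1, t2); (Z4, t1, t3); (fun x => -1 * A5 x, t1, t4); (Z1, t2, t3)].

(** On such vectors only the terms without O1, ..., O4 survive on the right-hand sides of [E1], ...,
    [E5]. The values of V1, ..., V4 are not prescribed; they remain as unknowns to be eliminated. *)
Definition horizontal x e (c1 c2 c3 c4 c5 : R) :=
  [/\ ev1 (W1 x) e = c1, ev1 (W2 x) e = c2, ev1 (W3 x) e = c3, ev1 (W4 x) e = c4
    & ev1 (W5 x) e = c5] /\
  [/\ ev1 (O1 x) e = 0, ev1 (O2 x) e = 0, ev1 (O3 x) e = 0 & ev1 (O4 x) e = 0].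

Hypothesis frame : forall x, P x -> forall c1 c2 c3 c4 c5, exists e, horizontal x e c1 c2 c3 c4 c5.

Ltac rw_1 T Px := repeat match type of T with
  | forall x, _ x -> forall u, ev1 (?t x) u = _ => match goal with
    | |- context [@ev1 _ _ (t _) ?u] => rewrite -> (T _ Px u) end
  end.

Ltac rw_str Px := rw_d (str1 str) Px; rw_d (str2 str) Px; rw_d (str3 str) Px;
  rw_d (str4 str) Px; rw_d (str5 str) Px.
Ltac rw_t Px := rw_1 T1 Px; rw_1 T2 Px; rw_1 T3 Px; rw_1 T4 Px; rw_1 T5 Px.

(** The coefficients of d theta^1 on (e2, e4), (e3, e4) and (e2, e5) contain no derivatives: f1 =
    -ab, b f4 = 0 and a g4 = 0. As f1 is nonzero, so are a and b. *)
Lemma f1E x : P x -> [/\ f1 x = - (a x * b x), f4 x = 0 & g4 x = 0].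
Proof.
move=> Px.
have [e1 h1] := frame Px 1 0 0 0 0; have [e2 h2] := frame Px 0 1 0 0 0.
have [e3 h3] := frame Px 0 0 1 0 0; have [e4 h4] := frame Px 0 0 0 1 0.
have [e5 h5] := frame Px 0 0 0 0 1.
have [[s1 s2 s3 s4 s5] [[r1 r2 r3 r4] [r5 r6 r7]]] := (sW, sf).
have S1 : smooth_terms1 P [:: (f1, W1)] by smterms.
have D1 u v := etrans (esym (eq_d_terms1 u v oP S1 Px T1)) (E1 Px u v).
have q24 : f1 x = - (a x * b x).
  by move: (D1 e2 e4); simpl; rw_str Px; simpl; rw_t Px; simpl; vals h2; vals h4; atoms; lra.
have q34 : b x * f4 x = 0.
  by move: (D1 e3 e4); simpl; rw_str Px; simpl; rw_t Px; simpl; vals h3; vals h4; atoms; lra.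
have q25 : a x * g4 x = 0.
  by move: (D1 e2 e5); simpl; rw_str Px; simpl; rw_t Px; simpl; vals h2; vals h5; atoms; lra.
have := f1_neq0 Px; rewrite q24 oppr_eq0 mulf_eq0 negb_or => /andP[a0 b0].
by split => //; [apply: (mulfI b0)|apply: (mulfI a0)]; rewrite mulr0.
Qed.

(** The expansions with f4 = g4 = 0, which [f1E] makes available. The remaining computations start
    from this shorter form. *)
Hypothesis T2' : forall x, P x -> forall u, ev1 (t2 x) u = ev_terms1 [:: (f2, W1); (a, W2)] x u.
Hypothesis T4' : forall x, P x -> forall u, ev1 (t4 x) u = ev_terms1 [:: (g2, W1); (b, W4)] x u.
Ltac rw_t' Px := rw_1 T1 Px; rw_1 T2' Px; rw_1 T3 Px; rw_1 T4' Px; rw_1 T5 Px.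

Section Point.
Variables (x e1 e2 e3 e4 e5 : 'rV[R]_n).
Hypothesis Px : P x.
Hypotheses (h1 : horizontal x e1 1 0 0 0 0) (h2 : horizontal x e2 0 1 0 0 0).
Hypotheses (h3 : horizontal x e3 0 0 1 0 0) (h4 : horizontal x e4 0 0 0 1 0).
Hypothesis h5 : horizontal x e5 0 0 0 0 1.
Local Notation "f \d e" := (ev1 (grad f x) e) (at level 30).
Local Notation "V \@ e" := (ev1 (V x) e) (at level 30).

(** This lemma and the following ones list the coefficients of the theta equations on those pairs of
    dual vectors that the elimination uses. *)
Lemma theta1_eqs : [/\ - (f1 \d e2) - f1 x * V1 \@ e2 = g2 x * a x
  & - (f1 \d e4) - f1 x * V1 \@ e4 = - (b x * f2 x)].
Proof.
have [[s1 s2 s3 s4 s5] [[[r1 r2 r3 r4] [r5 r6 r7]] [[p1 p2 p3] [p4 p5 p6]]]] := (sW, (sf, sg)).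
have S : smooth_terms1 P [:: (f1, W1)] by smterms.
have D u v := etrans (esym (eq_d_terms1 u v oP S Px T1)) (E1 Px u v).
split.
- by move: (D e1 e2); simpl; rw_str Px; simpl; rw_t' Px; simpl; vals h1; vals h2; atoms; lra.
- by move: (D e1 e4); simpl; rw_str Px; simpl; rw_t' Px; simpl; vals h1; vals h4; atoms; lra.
Qed.

Lemma theta2_eqs : [/\ - (f2 \d e3) - f2 x * V1 \@ e3 - a x * V3 \@ e3 = g2 x * f7 x, - (f2 \d e4) - f2 x
  * V1 \@ e4 - a x * V3 \@ e4 = - (b x * f5 x), a \d e3 = a x * (V2 \@ e3 - 2^-1 * V1 \@ e3)
  & - (a \d e4) + f2 x + a x * (V2 \@ e4 - 2^-1 * V1 \@ e4) = - (b x * f6 x)].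
Proof.
have [[s1 s2 s3 s4 s5] [[[r1 r2 r3 r4] [r5 r6 r7]] [[p1 p2 p3] [p4 p5 p6]]]] := (sW, (sf, sg)).
have S : smooth_terms1 P [:: (f2, W1); (a, W2)] by smterms.
have D u v := etrans (esym (eq_d_terms1 u v oP S Px T2')) (E2 Px u v).
split.
- by move: (D e1 e3); simpl; rw_str Px; simpl; rw_t' Px; simpl; vals h1; vals h3; atoms; lra.
- by move: (D e1 e4); simpl; rw_str Px; simpl; rw_t' Px; simpl; vals h1; vals h4; atoms; lra.
- by move: (D e2 e3); simpl; rw_str Px; simpl; rw_t' Px; simpl; vals h2; vals h3; atoms; lra.
- by move: (D e2 e4); simpl; rw_str Px; simpl; rw_t' Px; simpl; vals h2; vals h4; atoms; lra.
Qed.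

Lemma theta2_eqs' : [/\ a \d e5 = a x * (V2 \@ e5 - 2^-1 * V1 \@ e5)
  & a x = - (b x * f7 x)].
Proof.
have [[s1 s2 s3 s4 s5] [[[r1 r2 r3 r4] [r5 r6 r7]] [[p1 p2 p3] [p4 p5 p6]]]] := (sW, (sf, sg)).
have S : smooth_terms1 P [:: (f2, W1); (a, W2)] by smterms.
have D u v := etrans (esym (eq_d_terms1 u v oP S Px T2')) (E2 Px u v).
split.
- by move: (D e2 e5); simpl; rw_str Px; simpl; rw_t' Px; simpl; vals h2; vals h5; atoms; lra.
- by move: (D e3 e4); simpl; rw_str Px; simpl; rw_t' Px; simpl; vals h3; vals h4; atoms; lra.
Qed.

Lemma theta3_eqs : [/\ - (f5 \d e4) - f5 x * V1 \@ e4 - f6 x * V3 \@ e4 + f7 x * I1 x = - (A1 x * b x *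
  f1 x), - (f6 \d e3) + f6 x * (V2 \@ e3 - 2^-1 * V1 \@ e3) + f7 \d e2 + f7 x * (K x - V3 \@ e3 - 2 * V2
    \@ e2) = 0, f5 x - (f6 \d e4) + f6 x * (V2 \@ e4 - 2^-1 * V1 \@ e4) - f7 x * V3 \@ e4 = 0
  & f6 x - (f7 \d e4) + 2 * f7 x * V2 \@ e4 = 0].
Proof.
have [[s1 s2 s3 s4 s5] [[[r1 r2 r3 r4] [r5 r6 r7]] [[p1 p2 p3] [p4 p5 p6]]]] := (sW, (sf, sg)).
have S : smooth_terms1 P [:: (f5, W1); (f6, W2); (f7, W3)] by smterms.
have D u v := etrans (esym (eq_d_terms1 u v oP S Px T3)) (E3 Px u v).
split.
- by move: (D e1 e4); simpl; rw_str Px; simpl; rw_t' Px; simpl; vals h1; vals h4; atoms; lra.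
- by move: (D e2 e3); simpl; rw_str Px; simpl; rw_t' Px; simpl; vals h2; vals h3; atoms; lra.
- by move: (D e2 e4); simpl; rw_str Px; simpl; rw_t' Px; simpl; vals h2; vals h4; atoms; lra.
- by move: (D e3 e4); simpl; rw_str Px; simpl; rw_t' Px; simpl; vals h3; vals h4; atoms; lra.
Qed.

Lemma theta4_eqs : [/\ - (g2 \d e5) - g2 x * V1 \@ e5 - b x * V4 \@ e5 = - (g7 x * f2 x), g2 x + b \d e2
  + b x * (V2 \@ e2 + 2^-1 * V1 \@ e2) = - (g6 x * a x), b \d e3 = - (b x * (V2 \@ e3 + 2^-1 * V1 \@
    e3)), b \d e5 = - (b x * (V2 \@ e5 + 2^-1 * V1 \@ e5))
  & b x = g7 x * a x].
Proof.
have [[s1 s2 s3 s4 s5] [[[r1 r2 r3 r4] [r5 r6 r7]] [[p1 p2 p3] [p4 p5 p6]]]] := (sW, (sf, sg)).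
have S : smooth_terms1 P [:: (g2, W1); (b, W4)] by smterms.
have D u v := etrans (esym (eq_d_terms1 u v oP S Px T4')) (E4 Px u v).
split.
- by move: (D e1 e5); simpl; rw_str Px; simpl; rw_t' Px; simpl; vals h1; vals h5; atoms; lra.
- by move: (D e2 e4); simpl; rw_str Px; simpl; rw_t' Px; simpl; vals h2; vals h4; atoms; lra.
- by move: (D e3 e4); simpl; rw_str Px; simpl; rw_t' Px; simpl; vals h3; vals h4; atoms; lra.
- by move: (D e4 e5); simpl; rw_str Px; simpl; rw_t' Px; simpl; vals h4; vals h5; atoms; lra.
- by move: (D e2 e5); simpl; rw_str Px; simpl; rw_t' Px; simpl; vals h2; vals h5; atoms; lra.
Qed.

Lemma theta5_eqs : [/\ Z1 x * a x * f7 x = 0, - g6 x + g7 \d e2 + 2 * g7 x * V2 \@ e2 = 0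
  & - (g6 \d e5) - g6 x * (V2 \@ e5 + 2^-1 * V1 \@ e5) + g7 \d e4 + g7 x * (V4 \@ e5 + 2 * V2 \@ e4 + L
    x) = 0].
Proof.
have [[s1 s2 s3 s4 s5] [[[r1 r2 r3 r4] [r5 r6 r7]] [[p1 p2 p3] [p4 p5 p6]]]] := (sW, (sf, sg)).
have S : smooth_terms1 P [:: (g5, W1); (g6, W4); (g7, W5)] by smterms.
have D u v := etrans (esym (eq_d_terms1 u v oP S Px T5)) (E5 Px u v).
split.
- by move: (D e2 e3); simpl; rw_str Px; simpl; rw_t' Px; simpl; vals h2; vals h3; atoms; lra.
- by move: (D e2 e5); simpl; rw_str Px; simpl; rw_t' Px; simpl; vals h2; vals h5; atoms; lra.
- by move: (D e4 e5); simpl; rw_str Px; simpl; rw_t' Px; simpl; vals h4; vals h5; atoms; lra.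
Qed.

End Point.

(** Differentiates a relation already found along [e]. The relation has to hold on all of the open
    set P, not only at x. *)
Lemma grad_mul_eq (p q r : scal R n) (c : R) x e :
  smooth P p -> smooth P q -> smooth P r -> (forall y, P y -> p y * q y = c * r y) -> P x ->
  p x * ev1 (grad q x) e + q x * ev1 (grad p x) e = c * ev1 (grad r x) e.
Proof.
move=> sp sq sr pq Px; rewrite -(ev1_gradM e sp sq Px).
have E : {in P, (fun y => p y * q y) =1 (fun y => c * r y)} by move=> y; rewrite inE => /pq.
rewrite (eq_grad oP E Px) (ev1_gradM e (smooth_cst P c) sr Px) ev1_grad_cst.
by rewrite mulr0 addr0.
Qed.

Lemma ab_neq0 x : P x -> a x != 0 /\ b x != 0.
Proof.
move=> Px; have := f1_neq0 Px; have [-> _ _] := f1E Px.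
by rewrite oppr_eq0 mulf_eq0 negb_or => /andP.
Qed.

Ltac frames Px e1 h1 e2 h2 e3 h3 e4 h4 e5 h5 :=
  have [e1 h1] := frame Px 1 0 0 0 0; have [e2 h2] := frame Px 0 1 0 0 0;
  have [e3 h3] := frame Px 0 0 1 0 0; have [e4 h4] := frame Px 0 0 0 1 0;
  have [e5 h5] := frame Px 0 0 0 0 1.

Lemma f7E x : P x -> b x * f7 x = -1 * a x.
Proof.
move=> Px; frames Px e1 h1 e2 h2 e3 h3 e4 h4 e5 h5.
have [_ q] := theta2_eqs' Px h2 h3 h4 h5.
by move: (a x) (b x) (f7 x) q => *; lra.
Qed.

Lemma g7E x : P x -> a x * g7 x = 1 * b x.
Proof.
move=> Px; frames Px e1 h1 e2 h2 e3 h3 e4 h4 e5 h5.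
have [_ _ _ _ q] := theta4_eqs Px h1 h2 h3 h4 h5.
by move: (a x) (b x) (g7 x) q => *; lra.
Qed.

Lemma abE x : P x -> a x * b x = -1 * f1 x.
Proof. by move=> Px; have [-> _ _] := f1E Px; rewrite mulN1r opprK. Qed.

(** [lra] treats products of variables as atoms, so the nonlinear multipliers of an elimination are
    supplied by hand. *)
Let mul2 (c u v : R) : u = v -> c * u = c * v. Proof. by move->. Qed.

(* The remaining steps eliminate the derivatives: each is a linear combination
   of the listed multiples of the theta equations and of the derivatives of the
   relations found before. *)
Lemma f6E x : P x -> b x * f6 x = -1 * f2 x.
Proof.
move=> Px; frames Px e1 h1 e2 h2 e3 h3 e4 h4 e5 h5.
have [[r1 r2 r3 r4] [r5 r6 r7]] := sf; have [[p1 p2 p3] [p4 p5 p6]] := sg.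
have := grad_mul_eq e4 r3 p2 r1 abE Px.
have := grad_mul_eq e4 p2 r7 r3 f7E Px.
have [_] := theta1_eqs Px h1 h2 h4; have [_ _ _] := theta2_eqs Px h1 h2 h3 h4.
have [_ _ _] := theta3_eqs Px h1 h2 h3 h4; have [a0 b0] := ab_neq0 Px.
move: (f7E Px) (abE Px) => F7E ABE; move: a0 b0 F7E ABE.
move: (ev1 (grad b x) e4) (ev1 (V1 x) e4) (ev1 (V2 x) e4) => b4 Y X; atoms.
move: (a x) (b x) (f1 x) (f2 x) (f6 x) (f7 x) => A B F1 F2 F6 F7 a0 b0 c1 c2 q3 q2 q1 d2 d1.
apply: (mulfI b0).
move: (mul2 (B * B) q3) (mul2 B d2) (mul2 b4 c1) (mul2 (B * X) c1) d1 q1 (mul2 Y c2) (mul2 B q2).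
by move=> *; lra.
Qed.

Lemma g6E x : P x -> a x * g6 x = -1 * g2 x.
Proof.
move=> Px; frames Px e1 h1 e2 h2 e3 h3 e4 h4 e5 h5.
have [[r1 r2 r3 r4] [r5 r6 r7]] := sf; have [[p1 p2 p3] [p4 p5 p6]] := sg.
have := grad_mul_eq e2 r3 p2 r1 abE Px.
have := grad_mul_eq e2 r3 p6 p2 g7E Px.
have [+ _] := theta1_eqs Px h1 h2 h4; have [_ + _ _ _] := theta4_eqs Px h1 h2 h3 h4 h5.
have [_ + _] := theta5_eqs Px h2 h3 h4 h5; have [a0 b0] := ab_neq0 Px.
move: (g7E Px) (abE Px) => G7E ABE; move: a0 b0 G7E ABE.
move: (ev1 (grad a x) e2) (ev1 (V1 x) e2) (ev1 (V2 x) e2) => a2 Y X; atoms.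
move: (a x) (b x) (f1 x) (g2 x) (g6 x) (g7 x) => A B F1 G2 G6 G7 a0 b0 c1 c2 q3 q2 q1 d2 d1.
apply: (mulfI a0).
move: (mul2 (A * A) q3) (mul2 A d2) (mul2 a2 c1) (mul2 (A * X) c1) d1 q1 (mul2 Y c2) (mul2 A q2).
by move=> *; lra.
Qed.

(** K multiplies w2 /\ w3 in d w3 and therefore appears in the coefficient of d theta^3 on (e2, e3).
    Everything else there cancels against the derivatives of b f7 = -a and ab = -f1 along e2 and of
    b f6 = -f2 along e3. *)
Lemma K_zero x : P x -> K x = 0.
Proof.
move=> Px; frames Px e1 h1 e2 h2 e3 h3 e4 h4 e5 h5.
have [[r1 r2 r3 r4] [r5 r6 r7]] := sf; have [[p1 p2 p3] [p4 p5 p6]] := sg.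
have := grad_mul_eq e2 r3 p2 r1 abE Px.
have := grad_mul_eq e2 p2 r7 r3 f7E Px.
have := grad_mul_eq e3 p2 r6 r2 f6E Px.
have [+ _] := theta1_eqs Px h1 h2 h4; have [+ _ _ _] := theta2_eqs Px h1 h2 h3 h4.
have [_ + _ _] := theta3_eqs Px h1 h2 h3 h4.
have [_ + + _ _] := theta4_eqs Px h1 h2 h3 h4 h5.
have [a0 b0] := ab_neq0 Px.
move: (f7E Px) (abE Px) (f6E Px) (g6E Px) => F7E ABE F6E G6E.
move: a0 b0 F7E ABE F6E G6E.
move: (ev1 (grad b x) e2) (ev1 (grad b x) e3) (ev1 (V1 x) e2) (ev1 (V1 x) e3)
  (ev1 (V2 x) e2) (ev1 (V2 x) e3) (ev1 (V3 x) e3) => b2 b3 Y2 Y3 X2 X3 S3; atoms.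
move: (a x) (b x) (f1 x) (f2 x) (f6 x) (f7 x) (g2 x) (g6 x) (K x)
  => A B F1 F2 F6 F7 G2 G6 k a0 b0 c7 c1 c6 c8 q42 q43 q3 q2 q1 d6 d7 d1.
apply: (mulfI a0); apply: (mulfI b0).
move: (mul2 (B * B) q3) (mul2 B q2) q1 (mul2 A q42) (mul2 F2 q43) (mul2 B d6) (mul2 B d7) d1
  (mul2 b2 c7) (mul2 b3 c6) (mul2 (B * (X3 - 2^-1 * Y3)) c6) (mul2 (B * (k - S3 - 2 * X2)) c7) (mul2 Y2 c1)
  (mul2 A c8) (mul2 G2 c7).
by move=> *; lra.
Qed.

(** The mirror image of [K_zero]: L appears in the coefficient of d theta^5 on (e4, e5), and the
    relations for f1, g7 and g6 are differentiated along e4 and e5. *)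
Lemma L_zero x : P x -> L x = 0.
Proof.
move=> Px; frames Px e1 h1 e2 h2 e3 h3 e4 h4 e5 h5.
have [[r1 r2 r3 r4] [r5 r6 r7]] := sf; have [[p1 p2 p3] [p4 p5 p6]] := sg.
have := grad_mul_eq e4 r3 p2 r1 abE Px.
have := grad_mul_eq e4 r3 p6 p2 g7E Px.
have := grad_mul_eq e5 r3 p5 p1 g6E Px.
have [_ +] := theta1_eqs Px h1 h2 h4; have [+ _ _ _ _] := theta4_eqs Px h1 h2 h3 h4 h5.
have [_ _ +] := theta5_eqs Px h2 h3 h4 h5.
have [_ _ _ +] := theta2_eqs Px h1 h2 h3 h4; have [+ _] := theta2_eqs' Px h2 h3 h4 h5.
have [a0 b0] := ab_neq0 Px.
move: (g7E Px) (abE Px) (f6E Px) (g6E Px) => G7E ABE F6E G6E.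
move: a0 b0 G7E ABE F6E G6E.
move: (ev1 (grad a x) e4) (ev1 (grad a x) e5) (ev1 (V1 x) e4) (ev1 (V1 x) e5)
  (ev1 (V2 x) e4) (ev1 (V2 x) e5) (ev1 (V4 x) e5) => a4 a5 Y4 Y5 X4 X5 S5; atoms.
move: (a x) (b x) (f1 x) (f2 x) (f6 x) (g7 x) (g2 x) (g6 x) (L x)
  => A B F1 F2 F6 G7 G2 G6 l a0 b0 c7 c1 c6 c8 q25 q24 q3 q2 q1 d6 d7 d1.
apply: (mulfI a0); apply: (mulfI b0).
move: (mul2 (A * A) q3) (mul2 A q2) q1 (mul2 B q24) (mul2 G2 q25) (mul2 A d6) (mul2 A d7) d1
  (mul2 a4 c7) (mul2 a5 c8) (mul2 (A * (X5 + 2^-1 * Y5)) c8) (mul2 (A * (S5 + 2 * X4 + l)) c7) (mul2 Y4 c1)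
  (mul2 B c6) (mul2 F2 c7).
by move=> *; lra.
Qed.

(** f5 appears in d theta^2 on (e1, e4) and in d theta^3 on (e2, e4); together these eliminate the
    derivative of f2 and the value of V3 on e4. *)
Lemma f5E x : P x -> f1 x * f5 x = 2^-1 * (f2 x * f2 x).
Proof.
move=> Px; frames Px e1 h1 e2 h2 e3 h3 e4 h4 e5 h5.
have [[r1 r2 r3 r4] [r5 r6 r7]] := sf; have [[p1 p2 p3] [p4 p5 p6]] := sg.
have := grad_mul_eq e4 r3 p2 r1 abE Px.
have := grad_mul_eq e4 p2 r6 r2 f6E Px.
have [_ +] := theta1_eqs Px h1 h2 h4; have [_ + _ +] := theta2_eqs Px h1 h2 h3 h4.
have [_ _ + _] := theta3_eqs Px h1 h2 h3 h4.
have [a0 b0] := ab_neq0 Px.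
move: (f7E Px) (abE Px) (f6E Px) => F7E ABE F6E.
move: a0 b0 F7E ABE F6E.
move: (ev1 (grad a x) e4) (ev1 (grad b x) e4) (ev1 (V1 x) e4) (ev1 (V2 x) e4)  (ev1 (V3 x) e4)
  (ev1 (grad f2 x) e4) => a4 b4 Y X S f24; atoms.
move: (a x) (b x) (f1 x) (f2 x) (f5 x) (f6 x) (f7 x)
  => A B F1 F2 F5 F6 F7 a0 b0 c7 c1 c6 q3 q2 q2' q1 d6 d1.
apply: (mulfI b0).
move: (mul2 (A * (B * B)) q3) (mul2 (A * B) q2) (mul2 F2 q1) (mul2 (B * F2) q2') (mul2 (A * B) d6) (mul2
  F2 d1)
  (mul2 (A * b4) c6) (mul2 (A * B * (X - 2^-1 * Y)) c6) (mul2 (A * B * S) c7) (mul2 (F2 * Y) c1)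
  (mul2 (B * F5) c1) (mul2 (B * F2) c6).
by move=> *; lra.
Qed.

Lemma Z1_zero x : P x -> Z1 x = 0.
Proof.
move=> Px; frames Px e1 h1 e2 h2 e3 h3 e4 h4 e5 h5.
have [+ _ _] := theta5_eqs Px h2 h3 h4 h5; have [a0 b0] := ab_neq0 Px.
have F7E := f7E Px; move=> /(mul2 (b x)); rewrite mulr0 => E.
move: a0 b0 F7E E.
move: (a x) (b x) (f7 x) (Z1 x) => A B F7 z a0 b0 c7 E.
apply: (mulfI a0); apply: (mulfI a0).
by move: (mul2 (A * z) c7) E; move=> *; lra.
Qed.

(** The coefficient of d theta^3 on (e1, e4) relates f7 I1 to A1 b f1. Differentiating f1 f5 = f2^2
    / 2 along e4 removes the derivative of f5, after which f7 = -a/b and f1 = -ab give the claim. *)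
Lemma A1E x : P x -> A1 x * b x ^+ 3 = - I1 x.
Proof.
move=> Px; frames Px e1 h1 e2 h2 e3 h3 e4 h4 e5 h5.
have [[r1 r2 r3 r4] [r5 r6 r7]] := sf; have [[p1 p2 p3] [p4 p5 p6]] := sg.
have := grad_mul_eq e4 r1 r5 (smoothM oP r2 r2) f5E Px.
rewrite (ev1_gradM e4 r2 r2 Px).
have [_ +] := theta1_eqs Px h1 h2 h4; have [_ + _ _] := theta2_eqs Px h1 h2 h3 h4.
have [+ _ _ _] := theta3_eqs Px h1 h2 h3 h4.
have [a0 b0] := ab_neq0 Px.
move: (f7E Px) (abE Px) (f6E Px) (f5E Px) => F7E ABE F6E F5E.
move: a0 b0 F7E ABE F6E F5E.
move: (ev1 (V1 x) e4) (ev1 (V3 x) e4) (ev1 (grad f2 x) e4) (ev1 (grad f5 x) e4) (ev1 (grad f1 x) e4)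
  => Y S f24 f54 f14; atoms.
move: (a x) (b x) (f1 x) (f2 x) (f5 x) (f6 x) (f7 x) (A1 x) (I1 x)
  => A B F1 F2 F5 F6 F7 AA i1 a0 b0 c7 c1 c6 c5 q3 q2 q1 d5.
apply: (mulfI a0); apply: (mulfI a0).
have {}c1 : F1 = - (A * B) by lra.
subst F1.
move: (mul2 (A * B) q3) (mul2 F2 q2) (mul2 F5 q1) d5 (mul2 (A * S) c6) (mul2 (A * i1) c7) (mul2 Y c5).
by move=> *; lra.
Qed.

End ThetaEquations.

(** * The normal coframe of a contact class of third-order ODEs *)

Section NormalForm.
Variables (R : realType) (n : nat) (U : set 'rV[R]_n) (oU : open U).
Variables (t1 t2 t3 t4 t5 o1 o2 o3 o4 E1 E2 E3 E4 E5 : form1 R n).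
Variables (A1 A2 A5 C : scal R n).
Hypothesis st : [/\ smooth_map U t1, smooth_map U t2, smooth_map U t3, smooth_map U t4
  & smooth_map U t5].
Hypothesis so : [/\ smooth_map U o1, smooth_map U o2, smooth_map U o3 & smooth_map U o4].
Hypothesis sE : [/\ smooth_map U E1, smooth_map U E2, smooth_map U E3, smooth_map U E4
  & smooth_map U E5].
Hypothesis sA : [/\ smooth U A1, smooth U A2, smooth U A5 & smooth U C].

Definition dual_vec x e (c1 c2 c3 c4 c5 : R) :=
  [/\ ev1 (t1 x) e = c1, ev1 (t2 x) e = c2, ev1 (t3 x) e = c3, ev1 (t4 x) e = c4
    & ev1 (t5 x) e = c5] /\
  [/\ ev1 (o1 x) e = 0, ev1 (o2 x) e = 0, ev1 (o3 x) e = 0 & ev1 (o4 x) e = 0].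

Hypothesis dE1 : forall x, U x -> dual_vec x (E1 x) 1 0 0 0 0.
Hypothesis dE2 : forall x, U x -> dual_vec x (E2 x) 0 1 0 0 0.
Hypothesis dE3 : forall x, U x -> dual_vec x (E3 x) 0 0 1 0 0.
Hypothesis dE4 : forall x, U x -> dual_vec x (E4 x) 0 0 0 1 0.
Hypothesis dE5 : forall x, U x -> dual_vec x (E5 x) 0 0 0 0 1.

Local Notation l1 := ([:: (fun=> 1, o1, t1); (fun=> 1, t4, t2)] : terms R n).
Local Notation l2 := ([:: (fun=> 1, o2, t1); (fun=> 1, o3, t2); (fun=> 1, t4, t3)] : terms R n).
Local Notation l3 := ([:: (fun=> 1, o2, t2); (fun=> 2, o3, t3); (fun=> -1, o1, t3); (A2, t2, t1); (A1,
  t4, t1)] : terms R n).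
Local Notation l4 := ([:: (fun=> 1, o4, t1); (fun=> 1, o1, t4); (fun=> -1, o3, t4); (fun=> 1, t5, t2)] :
  terms R n).
Local Notation l5 := ([:: (fun=> 1, o4, t4); (fun=> 1, o1, t5); (fun=> -2, o3, t5); (C, t1, t2);
    (fun x => -1 * A5 x, t1, t4)] : terms R n).
Hypothesis S1 : d_eq U t1 l1.
Hypothesis S2 : d_eq U t2 l2.
Hypothesis S3 : d_eq U t3 l3.
Hypothesis S4 : d_eq U t4 l4.
Hypothesis S5 : d_eq U t5 l5.

(** The normalisation of A2 and A5, necessary under (E): the combination d Omega_3 - (1/2) d Omega_1
    is free of Omega_5 and takes these values on the dual vectors. *)
Hypothesis A5E : forall x, U x ->
  A5 x = ev2 (ext_d o3 x) (E1 x) (E2 x) - 2^-1 * ev2 (ext_d o1 x) (E1 x) (E2 x).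
Hypothesis A2E : forall x, U x ->
  A2 x = ev2 (ext_d o3 x) (E1 x) (E4 x) - 2^-1 * ev2 (ext_d o1 x) (E1 x) (E4 x).

Ltac rw_S Ux := rw_d S1 Ux; rw_d S2 Ux; rw_d S3 Ux; rw_d S4 Ux; rw_d S5 Ux.

Let sm1 : smooth_terms U l1.
Proof. by move: st so sA => [? ? ? ? ?] [? ? ? ?] [? ? ? ?]; smterms. Qed.
Let sm2 : smooth_terms U l2.
Proof. by move: st so sA => [? ? ? ? ?] [? ? ? ?] [? ? ? ?]; smterms. Qed.
Let sm3 : smooth_terms U l3.
Proof. by move: st so sA => [? ? ? ? ?] [? ? ? ?] [? ? ? ?]; smterms. Qed.
Let sm4 : smooth_terms U l4.
Proof. by move: st so sA => [? ? ? ? ?] [? ? ? ?] [? ? ? ?]; smterms. Qed.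
Let sm5 : smooth_terms U l5.
Proof. by move: st so sA => [? ? ? ? ?] [? ? ? ?] [? ? ? ?]; smterms. Qed.

Let b1 x (Ux : U x) : forall u v z, d_terms l1 x u v z = 0.
Proof. by case: st => ? ? ? ? ?; exact: (bianchi oU _ sm1 S1 Ux). Qed.
Let b2 x (Ux : U x) : forall u v z, d_terms l2 x u v z = 0.
Proof. by case: st => ? ? ? ? ?; exact: (bianchi oU _ sm2 S2 Ux). Qed.
Let b3 x (Ux : U x) : forall u v z, d_terms l3 x u v z = 0.
Proof. by case: st => ? ? ? ? ?; exact: (bianchi oU _ sm3 S3 Ux). Qed.
Let b4 x (Ux : U x) : forall u v z, d_terms l4 x u v z = 0.
Proof. by case: st => ? ? ? ? ?; exact: (bianchi oU _ sm4 S4 Ux). Qed.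
Let b5 x (Ux : U x) : forall u v z, d_terms l5 x u v z = 0.
Proof. by case: st => ? ? ? ? ?; exact: (bianchi oU _ sm5 S5 Ux). Qed.

(* The connection form of the one-dimensional part of the isotropy algebra:
   contraction of d Omega_1 with the first vector of the dual frame. *)
Definition nf_gamma : form1 R n := - iprod E1 (ext_d o1).

Lemma ev_nf_gamma x u : ev1 (nf_gamma x) u = ev2 (ext_d o1 x) u (E1 x).
Proof. by rewrite ev2_antisym ev1N ev1_iprod. Qed.

Lemma smooth_nf_gamma : smooth_map U nf_gamma.
Proof. by have [? _ _ _ _] := sE; have [? _ _ _] := so; rewrite /nf_gamma; smth2. Qed.

Local Notation l6 := ([:: (fun=> 1, nf_gamma, t1); (fun=> 1, o4, t2); (fun=> -1, o2, t4)] : terms R n).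

(** d^2 theta^1 = 0 evaluated on (u, v, E1). *)
Lemma nf_d_Omega1_gamma : d_eq U o1 l6.
Proof.
move=> x Ux u v; have := b1 Ux u v (E1 x); simpl; rewrite -> !ev_nf_gamma.
rewrite -> ?(ev2_antisym o1 x v (E1 x)), ?(ev2_antisym o1 x u (E1 x)).
by rw_cst; rw_S Ux; simpl; vals (dE1 Ux); atoms; move=> *; lra.
Qed.

Let sm6 : smooth_terms U l6.
Proof. by have sg := smooth_nf_gamma; move: st so => [? ? ? ? ?] [? ? ? ?]; smterms. Qed.
Let b6 x (Ux : U x) : forall u v z, d_terms l6 x u v z = 0.
Proof. by case: so => ? ? ? ?; exact: (bianchi oU _ sm6 nf_d_Omega1_gamma Ux). Qed.

Lemma nf_gamma_E1 x : ev1 (nf_gamma x) (E1 x) = 0.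
Proof. by rewrite ev_nf_gamma; have := ev2_antisym o1 x (E1 x) (E1 x); atoms; move=> *; lra. Qed.

Let mul2 (c p q : R) : p = q -> c * p = c * q. Proof. by move->. Qed.

Section Point.
Variables (x : 'rV[R]_n) (Ux : U x).
Local Notation "w @[ u ]" := (ev1 (w x) u) (at level 9, format "w @[ u ]").
Local Notation "w @[ u , v ]" := (ev2 (ext_d w x) u v) (at level 9, format "w @[ u , v ]").
Local Notation "f \d u" := (ev1 (grad f x) u) (at level 9).
Local Notation e1 := (E1 x).
Local Notation e2 := (E2 x).
Local Notation e3 := (E3 x).
Local Notation e4 := (E4 x).
Local Notation e5 := (E5 x).

(* Curvature forms: d Omega_k minus its expression in the flat model *)
Local Notation D3 u v := (o3@[u, v] - (2^-1 * (nf_gamma@[u] * t1@[v] - nf_gamma@[v] * t1@[u])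
  + (o4@[u] * t2@[v] - o4@[v] * t2@[u]) + (t5@[u] * t3@[v] - t5@[v] * t3@[u]))).
Local Notation D2 u v := (o2@[u, v] - ((o3@[u] - o1@[u]) * o2@[v] - (o3@[v] - o1@[v]) * o2@[u]
  + 2^-1 * (nf_gamma@[u] * t2@[v] - nf_gamma@[v] * t2@[u]) + (o4@[u] * t3@[v] - o4@[v] * t3@[u]))).
Local Notation D4 u v := (o4@[u, v] - ((t5@[u] * o2@[v] - t5@[v] * o2@[u])
  + (o4@[u] * o3@[v] - o4@[v] * o3@[u]) + 2^-1 * (nf_gamma@[u] * t4@[v] - nf_gamma@[v] * t4@[u]))).
(** [sig], [kap] and [lam] are the contractions of the curvature forms D3, D2 and D4 with E1: E1 is
    killed by theta^2, ..., theta^5, by Omega_1, ..., Omega_4 and by gamma, so little of the flat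
    part survives. *)
Local Notation sig u := (o3@[e1, u] + 2^-1 * nf_gamma@[u]).
Local Notation kap u := (o2@[e1, u]).
Local Notation lam u := (o4@[e1, u]).

Ltac rw_E := rw_cst; rw_S Ux; rw_d nf_d_Omega1_gamma Ux; simpl.

(** In d^2 theta^2 = 0 the form d Omega_2 is multiplied by theta^1, so evaluation on (u, v, E1)
    isolates D2(u, v). [D4E] follows from d^2 theta^4 = 0 in the same way. *)
Lemma D2E u v : D2 u v = A2 x * (t4@[u] * t2@[v] - t2@[u] * t4@[v])
  + (kap v * t1@[u] - kap u * t1@[v]) + (sig v * t2@[u] - sig u * t2@[v]).
Proof.
have := b2 Ux u v e1; simpl.
rewrite -> ?(ev2_antisym o2 x v e1), ?(ev2_antisym o2 x u e1), ?(ev2_antisym o3 x v e1), ?(ev2_antisym o3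
  x u e1).
by rw_E; vals (dE1 Ux); atoms; move=> *; lra.
Qed.

Lemma D4E u v : D4 u v = A5 x * (t4@[u] * t2@[v] - t2@[u] * t4@[v])
  + (lam v * t1@[u] - lam u * t1@[v]) - (sig v * t4@[u] - sig u * t4@[v]).
Proof.
have := b4 Ux u v e1; simpl.
rewrite -> ?(ev2_antisym o4 x v e1), ?(ev2_antisym o4 x u e1), ?(ev2_antisym o3 x v e1), ?(ev2_antisym o3
  x u e1).
by rw_E; rewrite -> (nf_gamma_E1 x); vals (dE1 Ux); atoms; move=> *; lra.
Qed.

Lemma D3_42 : D3 e4 e2 = 0.
Proof.
have := b3 Ux e3 e4 e2; simpl; have := D2E e3 e4.
rewrite -> ?(ev2_antisym o2 x e4 e3), ?(ev2_antisym o3 x e4 e2).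
by rw_E; vals (dE2 Ux); vals (dE3 Ux); vals (dE4 Ux); atoms; move=> *; lra.
Qed.

Lemma D3_u4 u : D3 u e4 = sig e4 * t1@[u].
Proof.
have := b2 Ux u e4 e2; simpl; have := mul2 t1@[u] (D2E e4 e2); have := mul2 t2@[u] D3_42.
rewrite -> ?(ev2_antisym o3 x e2 u), ?(ev2_antisym o2 x e2 u).
by rw_E; vals (dE2 Ux); vals (dE4 Ux); atoms; move=> *; lra.
Qed.

(** D3 enters d^2 theta^4 multiplied by theta^4, so evaluation on (u, v, E4) isolates D3(u, v); the
    contraction of D3 with E4 is already known from [D3_u4]. *)
Lemma D3_sig u v : D3 u v = t1@[u] * sig v - t1@[v] * sig u.
Proof.
have := b4 Ux u v e4; simpl.
have := mul2 t1@[u] (D4E v e4); have := mul2 t1@[v] (D4E u e4).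
have := mul2 t4@[u] (D3_u4 v); have := mul2 t4@[v] (D3_u4 u).
rewrite -> ?(ev2_antisym o4 x e4 u), ?(ev2_antisym o3 x e4 u).
by rw_E; vals (dE4 Ux); atoms; move=> *; lra.
Qed.

Lemma sig_e3 : sig e3 = 0.
Proof.
have := b5 Ux e3 e5 e1; simpl.
rewrite -> ?(ev2_antisym o4 x e5 e1), ?(ev2_antisym o3 x e3 e1), ?(ev2_antisym o3 x e5 e1).
by rw_E; rewrite -> ?nf_gamma_E1; vals (dE1 Ux); vals (dE3 Ux); vals (dE5 Ux); atoms; move=> *; lra.
Qed.

(** By gamma(u) = d Omega_1(u, E1), the hypotheses [A5E] and [A2E] say that sig takes the values A5
    on E2 and A2 on E4. d^2 theta^3 = 0 on (u, E3, E1), together with [sig_e3], excludes other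
    components. *)
Lemma sigE u : sig u = A5 x * t2@[u] + A2 x * t4@[u].
Proof.
have := b3 Ux u e3 e1; have := mul2 t2@[u] (b3 Ux e2 e3 e1); have := mul2 t4@[u] (b3 Ux e4 e3 e1).
have := mul2 t3@[u] sig_e3; have := mul2 t2@[u] (A5E Ux); have := mul2 t4@[u] (A2E Ux).
simpl.
rewrite -> ?(ev2_antisym o2 x e3 e1), ?(ev2_antisym o3 x e3 e1), ?(ev2_antisym o3 x e2 e1), ?(ev2_antisym
  o3 x e4 e1).
by rw_E; rewrite -> ?nf_gamma_E1; vals (dE1 Ux); vals (dE2 Ux); vals (dE3 Ux); vals (dE4 Ux); atoms;
  move=> *; lra.
Qed.

End Point.

Local Notation l8 := ([:: (fun=> 2^-1, nf_gamma, t1); (fun=> 1, o4, t2); (fun=> 1, t5, t3);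
  (A5, t1, t2); (A2, t1, t4)] : terms R n).

Lemma nf_d_Omega3_gamma : d_eq U o3 l8.
Proof.
move=> x Ux u v; have := D3_sig Ux u v.
have := mul2 (ev1 (t1 x) u) (sigE Ux v); have := mul2 (ev1 (t1 x) v) (sigE Ux u).
by simpl; atoms; move=> *; lra.
Qed.

Let sm8 : smooth_terms U l8.
Proof. by have sg := smooth_nf_gamma; move: st so sA => [? ? ? ? ?] [? ? ? ?] [? ? ? ?]; smterms. Qed.
Let b8 x (Ux : U x) : forall u v z, d_terms l8 x u v z = 0.
Proof. by case: so => ? ? ? ?; exact: (bianchi oU _ sm8 nf_d_Omega3_gamma Ux). Qed.

Section Point2.
Variables (x : 'rV[R]_n) (Ux : U x).
Local Notation "w @[ u ]" := (ev1 (w x) u) (at level 9, format "w @[ u ]").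
Local Notation "w @[ u , v ]" := (ev2 (ext_d w x) u v) (at level 9, format "w @[ u , v ]").
Local Notation e1 := (E1 x).
Local Notation e2 := (E2 x).
Local Notation e3 := (E3 x).
Local Notation e4 := (E4 x).
Local Notation e5 := (E5 x).
Local Notation kap u := (o2@[e1, u]).
Local Notation lam u := (o4@[e1, u]).
Ltac rw_E := rw_cst; rw_S Ux; rw_d nf_d_Omega1_gamma Ux; rw_d nf_d_Omega3_gamma Ux; simpl.

Lemma grad_NA5 u : ev1 (grad (fun y => -1 * A5 y) x) u = - ev1 (grad A5 x) u.
Proof.
have [_ _ sA5 _] := sA; rewrite (ev1_gradM u (smooth_cst U (-1)) sA5 Ux) ev1_grad_cst.
by rewrite mulr0 addr0 mulN1r.
Qed.

(** The exterior derivative of gamma is still unknown, but d^2 Omega_1 and d^2 Omega_3 contain it in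
    the ratio 2 : 1, so it can be eliminated. [lamE] uses the same elimination, with d^2 theta^5 in
    place of d^2 theta^3. *)
Lemma kapE u : kap u = kap e2 * t2@[u] + kap e4 * t4@[u].
Proof.
have := b3 Ux u e2 e1; have := mul2 t2@[u] (b3 Ux e4 e2 e1); have := mul2 t4@[u] (b3 Ux e4 e2 e1).
have := b8 Ux u e4 e1; have := mul2 t2@[u] (b8 Ux e2 e4 e1).
have := b6 Ux u e4 e1; have := mul2 t2@[u] (b6 Ux e2 e4 e1).
simpl.
rewrite -> ?(ev2_antisym o2 x e2 e1), ?(ev2_antisym o2 x e4 e1), ?(ev2_antisym o4 x e4 e1), ?(ev2_antisym
  o4 x e2 e1).
rewrite -> ?(ev2_antisym nf_gamma x e4 e1), ?(ev2_antisym nf_gamma x e2 e1), ?(ev2_antisym nf_gamma x e4 e2).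
by rw_E; rewrite -> ?nf_gamma_E1; vals (dE1 Ux); vals (dE2 Ux); vals (dE4 Ux); atoms; move=> *; lra.
Qed.

Lemma lamE u : lam u = lam e2 * t2@[u] + lam e3 * t3@[u] + lam e4 * t4@[u].
Proof.
have := b5 Ux u e4 e1; have := mul2 t2@[u] (b5 Ux e2 e4 e1); have := mul2 t3@[u] (b5 Ux e3 e4 e1).
have := b8 Ux u e2 e1; have := mul2 t4@[u] (b8 Ux e4 e2 e1); have := mul2 t3@[u] (b8 Ux e3 e2 e1).
have := b6 Ux u e2 e1; have := mul2 t4@[u] (b6 Ux e4 e2 e1); have := mul2 t3@[u] (b6 Ux e3 e2 e1).
simpl.
rewrite -> ?(ev2_antisym o2 x e2 e1), ?(ev2_antisym o2 x e4 e1), ?(ev2_antisym o4 x e4 e1), ?(ev2_antisym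
  o4 x e2 e1), ?(ev2_antisym o4 x e3 e1).
rewrite -> ?(ev2_antisym nf_gamma x e4 e1), ?(ev2_antisym nf_gamma x e2 e1), ?(ev2_antisym nf_gamma x e4 e2).
rewrite -> ?(grad_NA5 u), ?(grad_NA5 e2), ?(grad_NA5 e3), ?(grad_NA5 e4), ?(grad_NA5 e1).
by rw_E; rewrite -> ?nf_gamma_E1; vals (dE1 Ux); vals (dE2 Ux); vals (dE3 Ux); vals (dE4 Ux); atoms;
  move=> *; lra.
Qed.

End Point2.

Definition nf_kappa2 x := ev2 (ext_d o2 x) (E1 x) (E2 x).
Definition nf_A4 x := ev2 (ext_d o2 x) (E1 x) (E4 x).
Definition nf_lambda2 x := ev2 (ext_d o4 x) (E1 x) (E2 x).
Definition nf_lambda3 x := ev2 (ext_d o4 x) (E1 x) (E3 x).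
Definition nf_lambda4 x := ev2 (ext_d o4 x) (E1 x) (E4 x).
Definition nf_A3 x := 2^-1 * (nf_kappa2 x + -1 * nf_lambda4 x).
(** With gamma in the role of Omega_5 the coefficient of theta^1 /\ theta^2 in d Omega_2 is kappa2
    and that of theta^1 /\ theta^4 in d Omega_4 is lambda4. Adding c theta^1 to gamma lowers both by
    c/2; (E) wants them to be A3 and -A3, whence c = kappa2 + lambda4. *)
Definition nf_Omega5 : form1 R n := nf_gamma + fscale (fun x => nf_kappa2 x + nf_lambda4 x) t1.
Definition nf_C1 x := ev2 (ext_d nf_Omega5 x) (E1 x) (E2 x).
Definition nf_mu3 x := ev2 (ext_d nf_Omega5 x) (E1 x) (E3 x).
Definition nf_A8 x := ev2 (ext_d nf_Omega5 x) (E1 x) (E4 x).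

Lemma smooth_nf_derivatives :
  [/\ smooth U nf_kappa2, smooth U nf_A4, smooth U nf_lambda2, smooth U nf_lambda3 & smooth U nf_lambda4].
Proof.
have [? ? ? ? ?] := sE; have [? ? ? ?] := so.
by split; apply: (smooth_ev2 oU); smth2.
Qed.

Lemma smooth_nf_Omega5 : smooth_map U nf_Omega5.
Proof.
have sg := smooth_nf_gamma; have [? ? ? ? ?] := smooth_nf_derivatives; have [? ? ? ? ?] := st.
by rewrite /nf_Omega5; smth2.
Qed.

Lemma smooth_nf_A3 : smooth U nf_A3.
Proof. by have [? ? ? ? ?] := smooth_nf_derivatives; rewrite /nf_A3; smth2. Qed.

Lemma smooth_nf_curvature : [/\ smooth U nf_C1, smooth U nf_mu3 & smooth U nf_A8].
Proof.
have [? ? ? ? ?] := sE; have so5 := smooth_nf_Omega5.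
by split; apply: (smooth_ev2 oU); smth2.
Qed.

Lemma ev_nf_Omega5 x u : ev1 (nf_Omega5 x) u = ev1 (nf_gamma x) u + (nf_kappa2 x + nf_lambda4 x) * ev1
  (t1 x) u.
Proof. by rewrite /nf_Omega5 ev1D ev1F. Qed.

Local Notation m6 := ([:: (fun=> 1, nf_Omega5, t1); (fun=> 1, o4, t2); (fun=> -1, o2, t4)] : terms R n).
Local Notation m7 := ([:: (fun=> 1, o3, o2); (fun=> -1, o1, o2); (fun=> 2^-1, nf_Omega5, t2);
  (fun=> 1, o4, t3); (nf_A3, t1, t2); (nf_A4, t1, t4)] : terms R n).
Local Notation m8 := ([:: (fun=> 2^-1, nf_Omega5, t1); (fun=> 1, o4, t2); (fun=> 1, t5, t3);
  (A5, t1, t2); (A2, t1, t4)] : terms R n).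
Local Notation m9 := ([:: (fun=> 1, t5, o2); (fun=> 1, o4, o3); (fun=> 2^-1, nf_Omega5, t4);
  (nf_lambda2, t1, t2); (nf_lambda3, t1, t3); (fun x => -1 * nf_A3 x, t1, t4)] : terms R n).
Local Notation m10 := ([:: (fun=> 1, nf_Omega5, o1); (fun=> 2, o4, o2); (nf_C1, t1, t2);
  (nf_mu3, t1, t3); (nf_A8, t1, t4); (nf_lambda3, t2, t3)] : terms R n).

Lemma nf_d_Omega1 : d_eq U o1 m6.
Proof.
move=> x Ux u v; rewrite (nf_d_Omega1_gamma Ux); simpl; rewrite -> (ev_nf_Omega5 x u), (ev_nf_Omega5 x v).
by atoms; move: (nf_kappa2 x) (nf_lambda4 x) => *; lra.
Qed.

Lemma nf_d_Omega3 : d_eq U o3 m8.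
Proof.
move=> x Ux u v; rewrite (nf_d_Omega3_gamma Ux); simpl; rewrite -> (ev_nf_Omega5 x u), (ev_nf_Omega5 x v).
by atoms; move: (nf_kappa2 x) (nf_lambda4 x) => *; lra.
Qed.

Lemma nf_d_Omega2 : d_eq U o2 m7.
Proof.
move=> x Ux u v; have := D2E Ux u v; simpl; rewrite -> (ev_nf_Omega5 x u), (ev_nf_Omega5 x v).
rewrite -> (sigE Ux u), (sigE Ux v), (kapE Ux u), (kapE Ux v).
rewrite /nf_A3 /nf_A4 -/(nf_kappa2 x).
by atoms; move: (nf_kappa2 x) (nf_lambda4 x) => *; lra.
Qed.

Lemma nf_d_Omega4 : d_eq U o4 m9.
Proof.
move=> x Ux u v; have := D4E Ux u v; simpl; rewrite -> (ev_nf_Omega5 x u), (ev_nf_Omega5 x v).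
rewrite -> (sigE Ux u), (sigE Ux v), (lamE Ux u), (lamE Ux v).
rewrite /nf_A3 /nf_lambda2 /nf_lambda3 -/(nf_lambda4 x).
by atoms; move: (nf_kappa2 x) (nf_lambda4 x) => *; lra.
Qed.

Let sm7 : smooth_terms U m7.
Proof.
have [? ? ? ? ?] := smooth_nf_derivatives; have ? := smooth_nf_A3; have ? := smooth_nf_Omega5.
by move: st so sA => [? ? ? ? ?] [? ? ? ?] [? ? ? ?]; smterms.
Qed.
Let sm9 : smooth_terms U m9.
Proof.
have [? ? ? ? ?] := smooth_nf_derivatives; have ? := smooth_nf_A3; have ? := smooth_nf_Omega5.
by move: st so sA => [? ? ? ? ?] [? ? ? ?] [? ? ? ?]; smterms.
Qed.
Let sn6 : smooth_terms U m6.
Proof. by have ? := smooth_nf_Omega5; move: st so sA => [? ? ? ? ?] [? ? ? ?] [? ? ? ?]; smterms. Qed.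
Let c6 x (Ux : U x) : forall u v z, d_terms m6 x u v z = 0.
Proof. by case: so => ? ? ? ?; exact: (bianchi oU _ sn6 nf_d_Omega1 Ux). Qed.
Let c7 x (Ux : U x) : forall u v z, d_terms m7 x u v z = 0.
Proof. by case: so => ? ? ? ?; exact: (bianchi oU _ sm7 nf_d_Omega2 Ux). Qed.
Let c9 x (Ux : U x) : forall u v z, d_terms m9 x u v z = 0.
Proof. by case: so => ? ? ? ?; exact: (bianchi oU _ sm9 nf_d_Omega4 Ux). Qed.

Section Point3.
Variables (x : 'rV[R]_n) (Ux : U x).
Local Notation "w @[ u ]" := (ev1 (w x) u) (at level 9, format "w @[ u ]").
Local Notation "w @[ u , v ]" := (ev2 (ext_d w x) u v) (at level 9, format "w @[ u , v ]").
Ltac rw_E := rw_cst; rw_S Ux; rw_d nf_d_Omega1 Ux; rw_d nf_d_Omega2 Ux; rw_d nf_d_Omega3 Ux; rw_d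
  nf_d_Omega4 Ux; simpl.
Local Notation mu u := (nf_Omega5@[E1 x, u] - nf_Omega5@[E1 x] * o1@[u]).

(** d^2 Omega_1 = 0 on (u, v, E1) determines d Omega_5 up to its contraction with E1, which [mu]
    records. *)
Lemma D5E u v : nf_Omega5@[u, v] = nf_Omega5@[u] * o1@[v] - nf_Omega5@[v] * o1@[u]
  + 2 * (o4@[u] * o2@[v] - o4@[v] * o2@[u]) + (mu v * t1@[u] - mu u * t1@[v])
  + nf_lambda3 x * (t2@[u] * t3@[v] - t2@[v] * t3@[u]).
Proof.
have := c6 Ux u v (E1 x); simpl.
rewrite -> ?(ev2_antisym nf_Omega5 x v (E1 x)), ?(ev2_antisym nf_Omega5 x u (E1 x)).
by rw_E; vals (dE1 Ux); atoms; move: (nf_lambda3 x) (nf_lambda2 x) (nf_A3 x) (nf_A4 x) => *; lra.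
Qed.

Lemma grad_NA3 u : ev1 (grad (fun y => -1 * nf_A3 y) x) u = - ev1 (grad nf_A3 x) u.
Proof.
rewrite (ev1_gradM u (smooth_cst U (-1)) smooth_nf_A3 Ux) ev1_grad_cst.
by rewrite mulr0 addr0 mulN1r.
Qed.

(** d^2 Omega_2 on (u, E2, E1) and d^2 Omega_4 on (u, E4, E1) each contain half of d Omega_5(E1, u),
    while the derivative of A3 along u enters them with opposite signs and cancels in the sum. The
    instances with u = E2, E3, E4 remove what is left. *)
Lemma muE u : mu u = nf_C1 x * t2@[u] + nf_mu3 x * t3@[u] + nf_A8 x * t4@[u].
Proof.
rewrite /nf_C1 /nf_mu3 /nf_A8.
have := c7 Ux u (E2 x) (E1 x); have := c9 Ux u (E4 x) (E1 x).
have := mul2 t2@[u] (c9 Ux (E2 x) (E4 x) (E1 x)).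
have := mul2 t4@[u] (c7 Ux (E4 x) (E2 x) (E1 x)).
have := mul2 t3@[u] (c9 Ux (E3 x) (E4 x) (E1 x)).
have := mul2 t3@[u] (c7 Ux (E3 x) (E2 x) (E1 x)).
simpl.
rewrite -> ?(ev2_antisym nf_Omega5 x (E2 x) (E1 x)), ?(ev2_antisym nf_Omega5 x (E3 x) (E1 x)),
  ?(ev2_antisym nf_Omega5 x (E4 x) (E1 x)).
rewrite -> ?(grad_NA3 u), ?(grad_NA3 (E2 x)), ?(grad_NA3 (E3 x)), ?(grad_NA3 (E4 x)), ?(grad_NA3 (E1 x)).
rw_E; vals (dE1 Ux); vals (dE2 Ux); vals (dE3 Ux); vals (dE4 Ux); atoms.
by move: (nf_lambda3 x) (nf_lambda2 x) (nf_A3 x) (nf_A4 x) => *; lra.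
Qed.

End Point3.

Lemma nf_d_Omega5 : d_eq U nf_Omega5 m10.
Proof.
move=> x Ux u v; rewrite (D5E Ux u v) (muE Ux u) (muE Ux v); simpl.
by atoms; move: (nf_lambda3 x) (nf_C1 x) (nf_mu3 x) (nf_A8 x) => *; lra.
Qed.

End NormalForm.

(** * The system (E) as formal sums *)

Section SystemE.
Variable R : realType.
Local Open Scope dform_scope.

Lemma d_eq_iff n (U : set 'rV[R]_n) a A (l : terms R n) :
  (forall x u v, ev2 (A x) u v = ev_terms l x u v) ->
  {in U, ext_d a =1 A} <-> d_eq U a l.
Proof.
move=> Al; split=> [E x Ux u v|E x]; first by rewrite (E x (mem_set Ux)) Al.
by rewrite inE => Ux; apply: ev2_inj => u v; rewrite Al (E x Ux).
Qed.

Ltac ev_all := intros; repeat first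
  [ rewrite -> ev2D | rewrite -> ev2N | rewrite -> ev2Z | rewrite -> ev2F | rewrite -> ev2W
  | rewrite -> ev1D | rewrite -> ev1N | rewrite -> ev1Z | rewrite -> ev1F ]; simpl.

Definition system_E_eqs (P : set 'rV[R]_10) (t1 t2 t3 t4 t5 O1 O2 O3 O4 O5 : form1 R 10)
    (A1 A2 A3 A4 A5 A6 A7 A8 Z1 Z2 Z3 Z4 C1 : scal R 10) : Prop :=
  [/\ d_eq P t1 [:: (fun=> 1, O1, t1); (fun=> 1, t4, t2)],
      d_eq P t2 [:: (fun=> 1, O2, t1); (fun=> 1, O3, t2); (fun=> 1, t4, t3)],
      d_eq P t3 [:: (fun=> 1, O2, t2); (fun=> 2, O3, t3); (fun=> -1, O1, t3);
        (A2, t2, t1); (A1, t4, t1)],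
      d_eq P t4 [:: (fun=> 1, O4, t1); (fun=> 1, O1, t4); (fun=> -1, O3, t4); (fun=> 1, t5, t2)] &
      d_eq P t5 [:: (fun=> 1, O4, t4); (fun=> 1, O1, t5); (fun=> -2, O3, t5);
        (fun x => A7 x + Z3 x, t1, t2); (Z4, t1, t3); (fun x => -1 * A5 x, t1, t4); (Z1, t2, t3)]] /\
  [/\ d_eq P O1 [:: (fun=> 1, O5, t1); (fun=> 1, O4, t2); (fun=> -1, O2, t4)],
      d_eq P O2 [:: (fun=> 1, O3, O2); (fun=> -1, O1, O2); (fun=> 2^-1, O5, t2); (fun=> 1, O4, t3);
        (A3, t1, t2); (A4, t1, t4)],
      d_eq P O3 [:: (fun=> 2^-1, O5, t1); (fun=> 1, O4, t2); (fun=> 1, t5, t3); (A5, t1, t2);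
        (A2, t1, t4)],
      d_eq P O4 [:: (fun=> 1, t5, O2); (fun=> 1, O4, O3); (fun=> 2^-1, O5, t4);
        (fun x => A6 x + Z2 x, t1, t2); (fun x => 2 * Z3 x, t1, t3); (fun x => -1 * A3 x, t1, t4);
        (Z4, t2, t3)] &
      d_eq P O5 [:: (fun=> 1, O5, O1); (fun=> 2, O4, O2); (C1, t1, t2); (fun x => 2 * Z2 x, t1, t3);
        (A8, t1, t4); (fun x => 2 * Z3 x, t2, t3)]].

Lemma system_EP P t1 t2 t3 t4 t5 O1 O2 O3 O4 O5 A1 A2 A3 A4 A5 A6 A7 A8 Z1 Z2 Z3 Z4 C1 :
  system_E P (Quint t1 t2 t3 t4 t5) (Quint O1 O2 O3 O4 O5)
    (EFunctions A1 A2 A3 A4 A5 A6 A7 A8 Z1 Z2 Z3 Z4 C1) <->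
  system_E_eqs P t1 t2 t3 t4 t5 O1 O2 O3 O4 O5 A1 A2 A3 A4 A5 A6 A7 A8 Z1 Z2 Z3 Z4 C1.
Proof.
split=> -[[h1 h2 h3 h4 h5] [h6 h7 h8 h9 h10]]; (split; split;
  [move: h1|move: h2|move: h3|move: h4|move: h5|move: h6|move: h7|move: h8|move: h9|move: h10]);
  first [refine (proj1 (d_eq_iff _ _ _))|refine (proj2 (d_eq_iff _ _ _))];
  move=> x u v; ev_all; repeat match goal with
    |- context [(?f + ?g) ?z] => change ((f + g) z) with (f z + g z) end; atoms; lra.
Qed.

End SystemE.

(** * The bundle P *)

Section GaugedSystem.
Variables (R : realType) (B : set 'rV[R]_9) (oB : open B).
Variables (t1 t2 t3 t4 t5 o1 o2 o3 o4 o5 : form1 R 9).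
Variables (A1 A2 A3 A4 A5 A8 C C1 lam2 lam3 mu3 : scal R 9).
Hypothesis st : [/\ smooth_map B t1, smooth_map B t2, smooth_map B t3, smooth_map B t4
  & smooth_map B t5].
Hypothesis so : [/\ smooth_map B o1, smooth_map B o2, smooth_map B o3, smooth_map B o4
  & smooth_map B o5].
Hypothesis S1 : d_eq B t1 [:: (fun=> 1, o1, t1); (fun=> 1, t4, t2)].
Hypothesis S2 : d_eq B t2 [:: (fun=> 1, o2, t1); (fun=> 1, o3, t2); (fun=> 1, t4, t3)].
Hypothesis S3 : d_eq B t3 [:: (fun=> 1, o2, t2); (fun=> 2, o3, t3); (fun=> -1, o1, t3);
  (A2, t2, t1); (A1, t4, t1)].
Hypothesis S4 : d_eq B t4 [:: (fun=> 1, o4, t1); (fun=> 1, o1, t4); (fun=> -1, o3, t4);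
  (fun=> 1, t5, t2)].
Hypothesis S5 : d_eq B t5 [:: (fun=> 1, o4, t4); (fun=> 1, o1, t5); (fun=> -2, o3, t5); (C, t1, t2);
    (fun x => -1 * A5 x, t1, t4)].
Hypothesis S6 : d_eq B o1 [:: (fun=> 1, o5, t1); (fun=> 1, o4, t2); (fun=> -1, o2, t4)].
Hypothesis S7 : d_eq B o2 [:: (fun=> 1, o3, o2); (fun=> -1, o1, o2); (fun=> 2^-1, o5, t2);
  (fun=> 1, o4, t3); (A3, t1, t2); (A4, t1, t4)].
Hypothesis S8 : d_eq B o3 [:: (fun=> 2^-1, o5, t1); (fun=> 1, o4, t2); (fun=> 1, t5, t3);
  (A5, t1, t2); (A2, t1, t4)].
Hypothesis S9 : d_eq B o4 [:: (fun=> 1, t5, o2); (fun=> 1, o4, o3); (fun=> 2^-1, o5, t4);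
  (lam2, t1, t2); (lam3, t1, t3); (fun x => -1 * A3 x, t1, t4)].
Hypothesis S10 : d_eq B o5 [:: (fun=> 1, o5, o1); (fun=> 2, o4, o2); (C1, t1, t2);
  (mu3, t1, t3); (A8, t1, t4); (lam3, t2, t3)].

Local Notation P := (@bproj R @^-1` B).
Local Notation pull := (pullback (@bproj R)).
Let oP : open P := open_bproj oB.
Let PB q : P q -> B (bproj q). Proof. by []. Qed.

Lemma smooth_pull_bproj a : smooth_map B a -> smooth_map P (pull a).
Proof. exact: (smooth_pullback oP (@smooth_bproj R P) oB PB). Qed.

Lemma smooth_comp_bproj f : smooth B f -> smooth P (fun q => f (bproj q)).
Proof. exact: (smooth_comp oP (@smooth_bproj R P) oB PB). Qed.

Lemma ev_pull_bproj a q v : ev1 (pull a q) v = ev1 (a (bproj q)) (bproj v).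
Proof. by rewrite ev1_pullback mul_jacobian_bproj. Qed.

Lemma d_pull_bproj a l q u v : smooth_map B a -> d_eq B a l -> P q ->
  ev2 (ext_d (pull a) q) u v = ev_terms l (bproj q) (bproj u) (bproj v).
Proof.
move=> sa al Pq; rewrite (ev2_pullback oP (@smooth_bproj R P) oB PB u v sa Pq).
by rewrite !mul_jacobian_bproj; exact: (al _ (PB Pq)).
Qed.

Lemma smooth_fibre : smooth P (@fibre_coord R).
Proof. exact: smooth_coord. Qed.

(* The action of exp(u E_14) on the Cartan connection *)
Local Notation u := (@fibre_coord R).
Definition gauged_Omega1 : form1 R 10 := pull o1 + fscale (fun q => 2 * u q) (pull t1).
Definition gauged_Omega2 : form1 R 10 := pull o2 + fscale u (pull t2).
Definition gauged_Omega3 : form1 R 10 := pull o3 + fscale u (pull t1).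
Definition gauged_Omega4 : form1 R 10 := pull o4 + fscale u (pull t4).
(** With g = 1 - (u/2) E_14, the forms above are read off from g^-1 omega g + g^-1 dg. The entry of
    position (1,4) is -Omega_5 / 4, so dg contributes 2 du, which makes Omega_5 independent of the
    forms lifted from B. *)
Definition gauged_Omega5 : form1 R 10 := pull o5 + (fscale (fun=> 2) (grad u)
  + (fscale (fun q => 2 * u q) (pull o1) + fscale (fun q => 2 * (u q * u q)) (pull t1))).

Lemma smooth_gauged_Omega : [/\ smooth_map P gauged_Omega1, smooth_map P gauged_Omega2, smooth_map P
  gauged_Omega3, smooth_map P gauged_Omega4
  & smooth_map P gauged_Omega5].
Proof.
move: st so => [s1 s2 s3 s4 s5] [r1 r2 r3 r4 r5]; have ? := smooth_fibre.
have ? := smooth_pull_bproj s1; have ? := smooth_pull_bproj s2; have ? := smooth_pull_bproj s4.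
have ? := smooth_pull_bproj r1; have ? := smooth_pull_bproj r2; have ? := smooth_pull_bproj r3.
have ? := smooth_pull_bproj r4; have ? := smooth_pull_bproj r5.
by split; rewrite /gauged_Omega1 /gauged_Omega2 /gauged_Omega3 /gauged_Omega4 /gauged_Omega5; smth2.
Qed.

Let dt1 q a b (Pq : P q) := d_pull_bproj a b (let: And5 x _ _ _ _ := st in x) S1 Pq.
Let dt2 q a b (Pq : P q) := d_pull_bproj a b (let: And5 _ x _ _ _ := st in x) S2 Pq.
Let dt3 q a b (Pq : P q) := d_pull_bproj a b (let: And5 _ _ x _ _ := st in x) S3 Pq.
Let dt4 q a b (Pq : P q) := d_pull_bproj a b (let: And5 _ _ _ x _ := st in x) S4 Pq.
Let dt5 q a b (Pq : P q) := d_pull_bproj a b (let: And5 _ _ _ _ x := st in x) S5 Pq.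
Let do1 q a b (Pq : P q) := d_pull_bproj a b (let: And5 x _ _ _ _ := so in x) S6 Pq.
Let do2 q a b (Pq : P q) := d_pull_bproj a b (let: And5 _ x _ _ _ := so in x) S7 Pq.
Let do3 q a b (Pq : P q) := d_pull_bproj a b (let: And5 _ _ x _ _ := so in x) S8 Pq.
Let do4 q a b (Pq : P q) := d_pull_bproj a b (let: And5 _ _ _ x _ := so in x) S9 Pq.
Let do5 q a b (Pq : P q) := d_pull_bproj a b (let: And5 _ _ _ _ x := so in x) S10 Pq.

Let v1 q v : ev1 (gauged_Omega1 q) v = ev1 (pull o1 q) v + 2 * u q * ev1 (pull t1 q) v.
Proof. by rewrite ev1D ev1F. Qed.
Let v2 q v : ev1 (gauged_Omega2 q) v = ev1 (pull o2 q) v + u q * ev1 (pull t2 q) v.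
Proof. by rewrite ev1D ev1F. Qed.
Let v3 q v : ev1 (gauged_Omega3 q) v = ev1 (pull o3 q) v + u q * ev1 (pull t1 q) v.
Proof. by rewrite ev1D ev1F. Qed.
Let v4 q v : ev1 (gauged_Omega4 q) v = ev1 (pull o4 q) v + u q * ev1 (pull t4 q) v.
Proof. by rewrite ev1D ev1F. Qed.
Let v5 q v : ev1 (gauged_Omega5 q) v = ev1 (pull o5 q) v + 2 * u v
    + 2 * u q * ev1 (pull o1 q) v + 2 * (u q * u q) * ev1 (pull t1 q) v.
Proof. by rewrite 3!ev1D 3!ev1F ev1_grad_fibre !addrA. Qed.

Ltac fin Pq := repeat match goal with
    | |- context [ev2 (ext_d (pull t1) ?q) ?a ?b] => rewrite -> (dt1 a b Pq)
    | |- context [ev2 (ext_d (pull t2) ?q) ?a ?b] => rewrite -> (dt2 a b Pq)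
    | |- context [ev2 (ext_d (pull t3) ?q) ?a ?b] => rewrite -> (dt3 a b Pq)
    | |- context [ev2 (ext_d (pull t4) ?q) ?a ?b] => rewrite -> (dt4 a b Pq)
    | |- context [ev2 (ext_d (pull t5) ?q) ?a ?b] => rewrite -> (dt5 a b Pq)
    | |- context [ev2 (ext_d (pull o1) ?q) ?a ?b] => rewrite -> (do1 a b Pq)
    | |- context [ev2 (ext_d (pull o2) ?q) ?a ?b] => rewrite -> (do2 a b Pq)
    | |- context [ev2 (ext_d (pull o3) ?q) ?a ?b] => rewrite -> (do3 a b Pq)
    | |- context [ev2 (ext_d (pull o4) ?q) ?a ?b] => rewrite -> (do4 a b Pq)
    | |- context [ev2 (ext_d (pull o5) ?q) ?a ?b] => rewrite -> (do5 a b Pq)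
  end; simpl;
  repeat match goal with
    | |- context [ev1 (gauged_Omega1 ?q) ?v] => rewrite -> (v1 q v)
    | |- context [ev1 (gauged_Omega2 ?q) ?v] => rewrite -> (v2 q v)
    | |- context [ev1 (gauged_Omega3 ?q) ?v] => rewrite -> (v3 q v)
    | |- context [ev1 (gauged_Omega4 ?q) ?v] => rewrite -> (v4 q v)
    | |- context [ev1 (gauged_Omega5 ?q) ?v] => rewrite -> (v5 q v)
    | |- context [ev1 (pull ?w ?q) ?v] => rewrite -> (ev_pull_bproj w q v)
  end; atoms;
  repeat match goal with |- context [@fibre_coord R ?v] => generalize (@fibre_coord R v); intro end.

(** The coefficient functions are constant along the added line. The functions A6 and A7 occur in
    (E) only in the sums A6 + Z2 and A7 + Z3, and Z2 = mu3 / 2, Z3 = lam3 / 2 are fixed by other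
    coefficients; this determines the differences taken here. *)
Lemma gauged_system : system_E_eqs P (pull t1) (pull t2) (pull t3) (pull t4) (pull t5) gauged_Omega1
  gauged_Omega2 gauged_Omega3 gauged_Omega4 gauged_Omega5
  (fun q => A1 (bproj q)) (fun q => A2 (bproj q)) (fun q => A3 (bproj q)) (fun q => A4 (bproj q))
  (fun q => A5 (bproj q)) (fun q => lam2 (bproj q) + -1 * (2^-1 * mu3 (bproj q)))
  (fun q => C (bproj q) + -1 * (2^-1 * lam3 (bproj q))) (fun q => A8 (bproj q))
  (fun=> 0) (fun q => 2^-1 * mu3 (bproj q)) (fun q => 2^-1 * lam3 (bproj q)) (fun=> 0)
  (fun q => C1 (bproj q)).
Proof.
move: st so => [s1 s2 s3 s4 s5] [r1 r2 r3 r4 r5]; have su := smooth_fibre.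
have p1 := smooth_pull_bproj s1; have p2 := smooth_pull_bproj s2; have p4 := smooth_pull_bproj s4.
have q1 := smooth_pull_bproj r1; have q2 := smooth_pull_bproj r2; have q3 := smooth_pull_bproj r3.
have q4 := smooth_pull_bproj r4; have q5 := smooth_pull_bproj r5.
have s2u : smooth P (fun q => 2 * u q) by smth2.
have suu : smooth P (fun q => u q * u q) by smth2.
have s2uu : smooth P (fun q => 2 * (u q * u q)) by smth2.
have sgu : smooth_map P (grad u) by smth2.
have g2u q v : P q -> ev1 (grad (fun q => 2 * u q) q) v = 2 * fibre_coord v.
  move=> Pq; rewrite (ev1_gradM v (smooth_cst P 2) su Pq) ev1_grad_cst mulr0 addr0.
  by rewrite ev1_grad_fibre.
have g2uu q v : P q -> ev1 (grad (fun q => 2 * (u q * u q)) q) v = 4 * u q * fibre_coord v.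
  move=> Pq; rewrite (ev1_gradM v (smooth_cst P 2) suu Pq) ev1_grad_cst mulr0 addr0.
  rewrite (ev1_gradM v su su Pq) !ev1_grad_fibre; move: (u q) (fibre_coord v) => *; ring.
have d1 q a b : P q -> ev2 (ext_d gauged_Omega1 q) a b = ev2 (ext_d (pull o1) q) a b
    + (ev1 (grad (fun q => 2 * u q) q) a * ev1 (pull t1 q) b -
       ev1 (grad (fun q => 2 * u q) q) b * ev1 (pull t1 q) a + 2 * u q * ev2 (ext_d (pull t1) q) a b).
  move=> Pq; rewrite (ev2_ext_dD a b Pq q1); last by smth2.
  by rewrite (ev2_ext_dF a b Pq s2u p1).
have dgen q a b o t : P q -> smooth_map P o -> smooth_map P t ->
    ev2 (ext_d (o + fscale u t) q) a b = ev2 (ext_d o q) a b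
    + (fibre_coord a * ev1 (t q) b - fibre_coord b * ev1 (t q) a + u q * ev2 (ext_d t q) a b).
  move=> Pq so' st'; rewrite (ev2_ext_dD a b Pq so'); last by smth2.
  by rewrite (ev2_ext_dF a b Pq su st') !ev1_grad_fibre.
have d5 q a b : P q -> ev2 (ext_d gauged_Omega5 q) a b = ev2 (ext_d (pull o5) q) a b
    + (2 * fibre_coord a * ev1 (pull o1 q) b -
       2 * fibre_coord b * ev1 (pull o1 q) a + 2 * u q * ev2 (ext_d (pull o1) q) a b)
    + (4 * u q * fibre_coord a * ev1 (pull t1 q) b -
       4 * u q * fibre_coord b * ev1 (pull t1 q) a + 2 * (u q * u q) * ev2 (ext_d (pull t1) q) a b).
  have sc := smooth_mapF oP (smooth_cst P 2) sgu.
  have sd := smooth_mapF oP s2u q1; have se := smooth_mapF oP s2uu p1.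
  have sde := smooth_mapD oP sd se; have scde := smooth_mapD oP sc sde.
  move=> Pq; rewrite (ev2_ext_dD a b Pq q5 scde) (ev2_ext_dD a b Pq sc sde) (ev2_ext_dD a b Pq sd se).
  rewrite -> (ev2_ext_dF a b Pq s2u q1), (ev2_ext_dF a b Pq s2uu p1), (ev2_ext_dF a b Pq (smooth_cst P 2)
    sgu).
  rewrite -> (ext_d_grad oP su Pq), (g2u q a Pq), (g2u q b Pq), (g2uu q a Pq), (g2uu q b Pq).
  rw_cst.
  by rewrite -> ev2_0; atoms; move: (fibre_coord a) (fibre_coord b) (fibre_coord q) => *; ring.
split; split => q Pq a b.
- by fin Pq; lra.
- by fin Pq; lra.
- by fin Pq; lra.
- by fin Pq; lra.
- by fin Pq; lra.
- rewrite -> (d1 q a b Pq), (g2u q a Pq), (g2u q b Pq); by fin Pq; lra.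
- rewrite (dgen q a b _ _ Pq q2 p2); by fin Pq; lra.
- rewrite (dgen q a b _ _ Pq q3 p1); by fin Pq; lra.
- rewrite (dgen q a b _ _ Pq q4 p4); by fin Pq; lra.
- rewrite (d5 q a b Pq); by fin Pq; lra.
Qed.

End GaugedSystem.

(** * Existence when the torsion vanishes *)

Section FlatTorsion.
Variables (R : realType) (B : set 'rV[R]_9) (oB : open B).
Variables (w1 w2 w3 w4 w5 v1 v2 v3 v4 : form1 R 9).
Variables (I1 I2 K L T : scal R 9).
Hypothesis cB : coframe B [:: w1; w2; w3; w4; w5; v1; v2; v3; v4].
Hypothesis sw : [/\ smooth_map B w1, smooth_map B w2, smooth_map B w3, smooth_map B w4 & smooth_map B w5].
Hypothesis sv : [/\ smooth_map B v1, smooth_map B v2, smooth_map B v3 & smooth_map B v4].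
Hypothesis sI : smooth B I1 /\ smooth B I2.
Hypothesis str : structure_eqs B w1 w2 w3 w4 w5 v1 v2 v3 v4 I1 I2 K L T.
Hypothesis KLT : [/\ vanishes B K, vanishes B L & vanishes B T].

Definition frame_values x e (a1 a2 a3 a4 a5 b1 b2 b3 b4 : R) :=
  [/\ ev1 (w1 x) e = a1, ev1 (w2 x) e = a2, ev1 (w3 x) e = a3, ev1 (w4 x) e = a4 &
      ev1 (w5 x) e = a5] /\
  [/\ ev1 (v1 x) e = b1, ev1 (v2 x) e = b2, ev1 (v3 x) e = b3 & ev1 (v4 x) e = b4].

Let q1 : d_eq B w1 [:: (fun=> -1, w1, v1); (fun=> 1, w2, w4)] := str1 str.
Let q2 : d_eq B w2 [:: (fun=> -1, w1, v3); (fun=> 1, w2, v2); (fun=> - 2^-1, w2, v1); (fun=> 1, w3, w4)]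
  := str2 str.
Let q3 : d_eq B w3 [:: (fun=> -1, w2, v3); (fun=> 2, w3, v2); (I1, w1, w4)].
Proof.
case: KLT => K0 L0 T0 x Bx u v; rewrite -> (str3 str Bx u v); simpl.
have := K0 x (mem_set Bx); have := T0 x (mem_set Bx); atoms => -> ->; lra.
Qed.
Let q4 : d_eq B w4 [:: (fun=> -1, w1, v4); (fun=> -1, w4, v2); (fun=> - 2^-1, w4, v1); (fun=> -1, w2, w5)]
  := str4 str.
Let q5 : d_eq B w5 [:: (fun=> 1, w4, v4); (fun=> -2, w5, v2); (I2, w1, w2)].
Proof.
case: KLT => K0 L0 T0 x Bx u v; rewrite -> (str5 str Bx u v); simpl.
have := L0 x (mem_set Bx); have := T0 x (mem_set Bx); atoms => -> ->; lra.
Qed.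

(** The dual vector of theta^1 has components along the fibre directions G3 and G4, so d v2 is
    needed there as well. d^2 w1 = 0 combined with d^2 w4 = 0 or d^2 w2 = 0 gives the four
    values. *)
Lemma dv_G x F1 F2 F4 G3 G4 : B x ->
  frame_values x F1 1 0 0 0 0 0 0 0 0 -> frame_values x F2 0 1 0 0 0 0 0 0 0 ->
  frame_values x F4 0 0 0 1 0 0 0 0 0 -> frame_values x G3 0 0 0 0 0 0 0 1 0 ->
  frame_values x G4 0 0 0 0 0 0 0 0 1 ->
  [/\ ev2 (ext_d v2 x) G3 F2 = 0, ev2 (ext_d v2 x) G4 F2 = 2^-1,
      ev2 (ext_d v2 x) G3 F4 = 2^-1 & ev2 (ext_d v2 x) G4 F4 = 0].
Proof.
move=> Bx f1 f2 f4 g3 g4.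
have [[s1 s2 s3 s4 s5] [r1 r2 r3 r4]] := (sw, sv).
have m1 : smooth_terms B [:: (fun=> -1, w1, v1); (fun=> 1, w2, w4)] by smterms.
have m2 : smooth_terms B [:: (fun=> -1, w1, v3); (fun=> 1, w2, v2); (fun=> - 2^-1, w2, v1); (fun=> 1, w3, w4)]
  by smterms.
have m4 : smooth_terms B [:: (fun=> -1, w1, v4); (fun=> -1, w4, v2); (fun=> - 2^-1, w4, v1); (fun=> -1,
  w2, w5)]
  by smterms.
have b1 := bianchi oB s1 m1 q1 Bx; have b2 := bianchi oB s2 m2 q2 Bx.
have b4 := bianchi oB s4 m4 q4 Bx.
split.
- have := b4 F4 G3 F2; have := b1 F1 G3 F2; simpl; rw_cst; rw_d q1 Bx; rw_d q2 Bx; rw_d q4 Bx; rw_d q5 Bx.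
  by simpl; vals f1; vals f2; vals f4; vals g3; atoms; move=> *; lra.
- have := b4 F4 G4 F2; have := b1 F1 G4 F2; simpl; rw_cst; rw_d q1 Bx; rw_d q2 Bx; rw_d q4 Bx; rw_d q5 Bx.
  by simpl; vals f1; vals f2; vals f4; vals g4; atoms; move=> *; lra.
- have := b2 F2 G3 F4; have := b1 F1 G3 F4; simpl; rw_cst; rw_d q1 Bx; rw_d q2 Bx; rw_d q3 Bx; rw_d q4 Bx.
  by simpl; vals f1; vals f2; vals f4; vals g3; atoms; move=> *; lra.
- have := b2 F2 G4 F4; have := b1 F1 G4 F4; simpl; rw_cst; rw_d q1 Bx; rw_d q2 Bx; rw_d q3 Bx; rw_d q4 Bx.
  by simpl; vals f1; vals f2; vals f4; vals g4; atoms; move=> *; lra.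
Qed.

Lemma smooth_dual_frame : exists F1 F2 F3 F4 F5 G3 G4 : form1 R 9,
  [/\ smooth_map B F1, smooth_map B F2, smooth_map B F3, smooth_map B F4 & smooth_map B F5] /\
  [/\ smooth_map B G3, smooth_map B G4 & forall x, B x ->
    [/\ frame_values x (F1 x) 1 0 0 0 0 0 0 0 0, frame_values x (F2 x) 0 1 0 0 0 0 0 0 0,
        frame_values x (F3 x) 0 0 1 0 0 0 0 0 0, frame_values x (F4 x) 0 0 0 1 0 0 0 0 0 &
        frame_values x (F5 x) 0 0 0 0 1 0 0 0 0] /\
    frame_values x (G3 x) 0 0 0 0 0 0 0 1 0 /\ frame_values x (G4 x) 0 0 0 0 0 0 0 0 1].
Proof.
have [[s1 s2 s3 s4 s5] [r1 r2 r3 r4]] := (sw, sv).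
have sm (i : 'I_9) : smooth_map B (nth (fun=> 0) [:: w1; w2; w3; w4; w5; v1; v2; v3; v4] i).
  have : (i < 9)%N by exact: ltn_ord.
  move: (nat_of_ord i) => [_|[_|[_|[_|[_|[_|[_|[_|[_|k k9]]]]]]]]]; simpl;
    [exact s1|exact s2|exact s3|exact s4|exact s5|exact r1|exact r2|exact r3|exact r4|exfalso].
  by move: k9; rewrite !ltnS ltn0.
have [E [sE dE]] := coframe_dual oB cB sm.
pose o k (kn : (k < 9)%N) : 'I_9 := Ordinal kn.
exists (E (@o 0 isT)), (E (@o 1 isT)), (E (@o 2 isT)), (E (@o 3 isT)), (E (@o 4 isT)), (E (@o 7 isT)), (E
  (@o 8 isT)).
have dv x (k : 'I_9) : B x -> frame_values x (E k x) (0 == k :> nat)%:R (1 == k :> nat)%:R (2 == k :>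
  nat)%:R (3 == k :> nat)%:R
    (4 == k :> nat)%:R (5 == k :> nat)%:R (6 == k :> nat)%:R (7 == k :> nat)%:R (8 == k :> nat)%:R.
  move=> Bx; have d := dE x Bx ^~ k; split; split.
  - exact: (d (@o 0 isT)).
  - exact: (d (@o 1 isT)).
  - exact: (d (@o 2 isT)).
  - exact: (d (@o 3 isT)).
  - exact: (d (@o 4 isT)).
  - exact: (d (@o 5 isT)).
  - exact: (d (@o 6 isT)).
  - exact: (d (@o 7 isT)).
  - exact: (d (@o 8 isT)).
split; first by split; exact: sE.
split; [exact: sE|exact: sE|] => x Bx; split; [|split].
- by split; [exact: (dv x (@o 0 isT))|exact: (dv x (@o 1 isT))|exact: (dv x (@o 2 isT))|
    exact: (dv x (@o 3 isT))|exact: (dv x (@o 4 isT))].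
- exact: (dv x (@o 7 isT)).
- exact: (dv x (@o 8 isT)).
Qed.

End FlatTorsion.

Section Existence.
Variables (R : realType) (B : set 'rV[R]_9) (oB : open B).
Variables (w1 w2 w3 w4 w5 v1 v2 v3 v4 : form1 R 9).
Variables (I1 I2 K L T : scal R 9).
Hypothesis cB : coframe B [:: w1; w2; w3; w4; w5; v1; v2; v3; v4].
Hypothesis sw : [/\ smooth_map B w1, smooth_map B w2, smooth_map B w3, smooth_map B w4 & smooth_map B w5].
Hypothesis sv : [/\ smooth_map B v1, smooth_map B v2, smooth_map B v3 & smooth_map B v4].
Hypothesis sI : smooth B I1 /\ smooth B I2.
Hypothesis str : structure_eqs B w1 w2 w3 w4 w5 v1 v2 v3 v4 I1 I2 K L T.
Hypothesis KLT : [/\ vanishes B K, vanishes B L & vanishes B T].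

Section Frame.
Variables (F1 F2 F3 F4 F5 G3 G4 : form1 R 9).
Hypothesis sF : [/\ smooth_map B F1, smooth_map B F2, smooth_map B F3, smooth_map B F4 & smooth_map B F5].
Hypothesis sG : smooth_map B G3 /\ smooth_map B G4.
Local Notation vals9 := (frame_values w1 w2 w3 w4 w5 v1 v2 v3 v4).
Hypothesis dF1 : forall x, B x -> vals9 x (F1 x) 1 0 0 0 0 0 0 0 0.
Hypothesis dF2 : forall x, B x -> vals9 x (F2 x) 0 1 0 0 0 0 0 0 0.
Hypothesis dF3 : forall x, B x -> vals9 x (F3 x) 0 0 1 0 0 0 0 0 0.
Hypothesis dF4 : forall x, B x -> vals9 x (F4 x) 0 0 0 1 0 0 0 0 0.
Hypothesis dF5 : forall x, B x -> vals9 x (F5 x) 0 0 0 0 1 0 0 0 0.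
Hypothesis dG3 : forall x, B x -> vals9 x (G3 x) 0 0 0 0 0 0 0 1 0.
Hypothesis dG4 : forall x, B x -> vals9 x (G4 x) 0 0 0 0 0 0 0 0 1.

(* The frame_values of A2 and A5 required by the normal form are contractions with flat_E1,
   which itself depends on A2 and A5; since dv2(G4, F2) = dv2(G3, F4) = 1/2, the
   linear equations for them have these solutions. *)
Definition flat_A5 x := 2 / 3 * ev2 (ext_d v2 x) (F1 x) (F2 x).
Definition flat_A2 x := 2 / 3 * ev2 (ext_d v2 x) (F1 x) (F4 x).
Definition flat_A1 x := -1 * I1 x.
Definition flat_C x := -1 * I2 x.
Definition flat_theta1 : form1 R 9 := - w1.
Definition flat_theta3 : form1 R 9 := - w3.
Definition flat_Omega2 : form1 R 9 := - v3 + fscale flat_A2 flat_theta1.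
Definition flat_Omega3 : form1 R 9 := (2^-1 : R) *: v1 + - v2.
Definition flat_Omega4 : form1 R 9 := - v4 + fscale flat_A5 flat_theta1.
(** -F1 is dual to theta^1 = -w1; the correction along the fibre makes Omega_2 and Omega_4 vanish on
    it. *)
Definition flat_E1 : form1 R 9 := - F1 + (fscale flat_A2 G3 + fscale flat_A5 G4).
Definition flat_E3 : form1 R 9 := - F3.

Lemma smooth_flat_A : [/\ smooth B flat_A1, smooth B flat_A2, smooth B flat_A5 & smooth B flat_C].
Proof.
have [? ? ? ?] := sv; have [? ? ? ? ?] := sF; have [? ?] := sI.
have s2 : smooth B (fun x => ev2 (ext_d v2 x) (F1 x) (F4 x)) by apply: (smooth_ev2 oB); smth2.
have s5 : smooth B (fun x => ev2 (ext_d v2 x) (F1 x) (F2 x)) by apply: (smooth_ev2 oB); smth2.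
by split; rewrite /flat_A1 /flat_A2 /flat_A5 /flat_C; smth2.
Qed.

Lemma smooth_flat_theta : [/\ smooth_map B flat_theta1, smooth_map B w2, smooth_map B flat_theta3,
  smooth_map B w4 & smooth_map B w5].
Proof. by have [? ? ? ? ?] := sw; split; rewrite /flat_theta1 /flat_theta3; smth2. Qed.

Lemma smooth_flat_Omega : [/\ smooth_map B v1, smooth_map B flat_Omega2, smooth_map B flat_Omega3 &
  smooth_map B flat_Omega4].
Proof.
have [? ? ? ?] := smooth_flat_A; have [? ? ? ? ?] := smooth_flat_theta; have [? ? ? ?] := sv.
by split; rewrite /flat_Omega2 /flat_Omega3 /flat_Omega4; smth2.
Qed.

Lemma smooth_flat_E : [/\ smooth_map B flat_E1, smooth_map B F2, smooth_map B flat_E3, smooth_map B F4 &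
  smooth_map B F5].
Proof.
have [? ? ? ?] := smooth_flat_A; have [? ? ? ? ?] := sF; have [? ?] := sG.
by split; rewrite /flat_E1 /flat_E3; smth2.
Qed.

Let vth1 x u : ev1 (flat_theta1 x) u = - ev1 (w1 x) u. Proof. exact: ev1N. Qed.
Let vth3 x u : ev1 (flat_theta3 x) u = - ev1 (w3 x) u. Proof. exact: ev1N. Qed.
Let vom2 x u : ev1 (flat_Omega2 x) u = - ev1 (v3 x) u - flat_A2 x * ev1 (w1 x) u.
Proof. by rewrite /flat_Omega2 ev1D ev1N ev1F vth1 mulrN. Qed.
Let vom3 x u : ev1 (flat_Omega3 x) u = 2^-1 * ev1 (v1 x) u - ev1 (v2 x) u.
Proof. by rewrite /flat_Omega3 ev1D ev1N ev1Z. Qed.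
Let vom4 x u : ev1 (flat_Omega4 x) u = - ev1 (v4 x) u - flat_A5 x * ev1 (w1 x) u.
Proof. by rewrite /flat_Omega4 ev1D ev1N ev1F vth1 mulrN. Qed.

Ltac rw_th := repeat match goal with
    | |- context [ev1 (flat_theta1 ?x) ?u] => rewrite -> (vth1 x u)
    | |- context [ev1 (flat_theta3 ?x) ?u] => rewrite -> (vth3 x u)
    | |- context [ev1 (flat_Omega2 ?x) ?u] => rewrite -> (vom2 x u)
    | |- context [ev1 (flat_Omega3 ?x) ?u] => rewrite -> (vom3 x u)
    | |- context [ev1 (flat_Omega4 ?x) ?u] => rewrite -> (vom4 x u)
  end.

Local Notation dual9 := (dual_vec flat_theta1 w2 flat_theta3 w4 w5 v1 flat_Omega2 flat_Omega3 flat_Omega4).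

Ltac solve_dual := repeat match goal with
  | |- context [flat_A2 ?x] => generalize (flat_A2 x); intro
  | |- context [flat_A5 ?x] => generalize (flat_A5 x); intro end; lra.
Ltac dual h := split; split; rw_th; vals h; solve_dual.

Lemma flat_E2_dual x : B x -> dual9 x (F2 x) 0 1 0 0 0. Proof. by move=> Bx; dual (dF2 Bx). Qed.
Lemma flat_E4_dual x : B x -> dual9 x (F4 x) 0 0 0 1 0. Proof. by move=> Bx; dual (dF4 Bx). Qed.
Lemma flat_E5_dual x : B x -> dual9 x (F5 x) 0 0 0 0 1. Proof. by move=> Bx; dual (dF5 Bx). Qed.
Lemma flat_E3_dual x : B x -> dual9 x (flat_E3 x) 0 0 1 0 0.
Proof.
by move=> Bx; split; split; rw_th; rewrite /flat_E3; rewrite -> ?ev1Nr; vals (dF3 Bx); solve_dual.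
Qed.
Lemma flat_E1_dual x : B x -> dual9 x (flat_E1 x) 1 0 0 0 0.
Proof.
by move=> Bx; split; split; rw_th; rewrite /flat_E1; rewrite -> ?ev1_comb; vals (dF1 Bx); vals (dG3 Bx);
  vals (dG4 Bx);
  solve_dual.
Qed.

Lemma flat_d_theta1 : d_eq B flat_theta1 [:: (fun=> 1, v1, flat_theta1); (fun=> 1, w4, w2)].
Proof.
have [s1 _ _ _ _] := sw; move=> x Bx u v.
rewrite -> (ev2_ext_dN u v Bx s1 : ev2 (ext_d flat_theta1 x) u v = _), (str1 str Bx u v); simpl; rw_th;
  atoms; lra.
Qed.
Lemma flat_d_theta2 : d_eq B w2 [:: (fun=> 1, flat_Omega2, flat_theta1); (fun=> 1, flat_Omega3, w2);
  (fun=> 1, w4, flat_theta3)].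
Proof.
move=> x Bx u v; rewrite -> (str2 str Bx u v); simpl; rw_th; atoms; move: (flat_A2 x) => *; lra.
Qed.
Lemma flat_d_theta3 : d_eq B flat_theta3 [:: (fun=> 1, flat_Omega2, w2); (fun=> 2, flat_Omega3,
  flat_theta3); (fun=> -1, v1, flat_theta3); (flat_A2, w2, flat_theta1); (flat_A1, w4, flat_theta1)].
Proof.
have [_ _ s3 _ _] := sw; move=> x Bx u v.
rewrite -> (ev2_ext_dN u v Bx s3 : ev2 (ext_d flat_theta3 x) u v = _), (str3 str Bx u v); simpl; rw_th.
have [/(_ x (mem_set Bx)) -> _ /(_ x (mem_set Bx)) ->] := KLT; rewrite /flat_A1.
by atoms; move: (flat_A2 x) (I1 x) => *; lra.
Qed.
Lemma flat_d_theta4 : d_eq B w4 [:: (fun=> 1, flat_Omega4, flat_theta1); (fun=> 1, v1, w4); (fun=> -1,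
  flat_Omega3, w4); (fun=> 1, w5, w2)].
Proof.
move=> x Bx u v; rewrite -> (str4 str Bx u v); simpl; rw_th; atoms; move: (flat_A5 x) => *; lra.
Qed.
Lemma flat_d_theta5 : d_eq B w5 [:: (fun=> 1, flat_Omega4, w4); (fun=> 1, v1, w5); (fun=> -2,
  flat_Omega3, w5); (flat_C, flat_theta1, w2);
  (fun x => -1 * flat_A5 x, flat_theta1, w4)].
Proof.
move=> x Bx u v; rewrite -> (str5 str Bx u v); simpl; rw_th.
have [_ /(_ x (mem_set Bx)) -> /(_ x (mem_set Bx)) ->] := KLT; rewrite /flat_C.
by atoms; move: (flat_A5 x) (I2 x) => *; lra.
Qed.

Lemma ext_d_flat_Omega3 x u v : B x -> ev2 (ext_d flat_Omega3 x) u v = 2^-1 * ev2 (ext_d v1 x) u v - ev2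
  (ext_d v2 x) u v.
Proof.
have [s1 s2 _ _] := sv; move=> Bx; rewrite /flat_Omega3.
rewrite (ev2_ext_dD u v Bx); [|by smth2|by smth2].
by rewrite (ev2_ext_dZ _ u v Bx s1) (ev2_ext_dN u v Bx s2).
Qed.

(** As Omega_3 - v1/2 = -v2, the right-hand side is -dv2(flat_E1, F2) = dv2(F1, F2) - A5/2. The
    resulting equation (3/2) A5 = dv2(F1, F2) explains the factor 2/3; A2 is treated alike with
    F4. *)
Lemma flat_A5E x : B x ->
  flat_A5 x = ev2 (ext_d flat_Omega3 x) (flat_E1 x) (F2 x) - 2^-1 * ev2 (ext_d v1 x) (flat_E1 x) (F2 x).
Proof.
move=> Bx; have [d1 d2 _ _] := dv_G oB sw sv str KLT Bx (dF1 Bx) (dF2 Bx) (dF4 Bx) (dG3 Bx) (dG4 Bx).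
rewrite -> (ext_d_flat_Omega3 (flat_E1 x) (F2 x) Bx); rewrite /flat_E1.
rewrite -> !ev2_comb, d1, d2; rewrite [flat_A5]lock /flat_A5 -lock.
have : flat_A5 x = 2 / 3 * ev2 (ext_d v2 x) (F1 x) (F2 x) by [].
by atoms; move: (flat_A2 x) (flat_A5 x) => *; lra.
Qed.

Lemma flat_A2E x : B x ->
  flat_A2 x = ev2 (ext_d flat_Omega3 x) (flat_E1 x) (F4 x) - 2^-1 * ev2 (ext_d v1 x) (flat_E1 x) (F4 x).
Proof.
move=> Bx; have [_ _ d1 d2] := dv_G oB sw sv str KLT Bx (dF1 Bx) (dF2 Bx) (dF4 Bx) (dG3 Bx) (dG4 Bx).
rewrite -> (ext_d_flat_Omega3 (flat_E1 x) (F4 x) Bx); rewrite /flat_E1.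
rewrite -> !ev2_comb, d1, d2.
have : flat_A2 x = 2 / 3 * ev2 (ext_d v2 x) (F1 x) (F4 x) by [].
by atoms; move: (flat_A2 x) (flat_A5 x) => *; lra.
Qed.

Local Notation nfO5 := (nf_Omega5 flat_theta1 v1 flat_Omega2 flat_Omega4 flat_E1 F2 F4).
Local Notation nf3 := (nf_A3 flat_Omega2 flat_Omega4 flat_E1 F2 F4).
Local Notation nf4 := (nf_A4 flat_Omega2 flat_E1 F4).
Local Notation nf8 := (nf_A8 flat_theta1 v1 flat_Omega2 flat_Omega4 flat_E1 F2 F4).
Local Notation nfC := (nf_C1 flat_theta1 v1 flat_Omega2 flat_Omega4 flat_E1 F2 F4).
Local Notation nfl2 := (nf_lambda2 flat_Omega4 flat_E1 F2).
Local Notation nfl3 := (nf_lambda3 flat_Omega4 flat_E1 flat_E3).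
Local Notation nfm3 := (nf_mu3 flat_theta1 v1 flat_Omega2 flat_Omega4 flat_E1 F2 flat_E3 F4).

Opaque flat_theta1 flat_theta3 flat_Omega2 flat_Omega3 flat_Omega4 nf_Omega5.

Lemma frame_question (M : set 'rV[R]_5) (piB : 'rV[R]_9 -> 'rV[R]_5) (e : R) :
  fibred B M piB -> e * e = 1 -> question M B piB (Quint (e *: w1) w2 w3 w4 w5).
Proof.
move=> fB ee; have [s1 s2 s3 s4] := smooth_flat_Omega; have [sA1 sA2 sA5 sC] := smooth_flat_A.
have [_ sA4 sl2 sl3 _] := smooth_nf_derivatives oB smooth_flat_Omega smooth_flat_E.
have s5 := smooth_nf_Omega5 oB smooth_flat_theta smooth_flat_Omega smooth_flat_E.
have sA3 := smooth_nf_A3 oB smooth_flat_Omega smooth_flat_E.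
have [sC1 sm3 sA8] := smooth_nf_curvature oB smooth_flat_theta smooth_flat_Omega smooth_flat_E.
have so : [/\ smooth_map B v1, smooth_map B flat_Omega2, smooth_map B flat_Omega3, smooth_map B
  flat_Omega4 & smooth_map B nfO5].
  by split; [exact s1|exact s2|exact s3|exact s4|exact s5].
have [st so' sE sn] := And4 smooth_flat_theta smooth_flat_Omega smooth_flat_E smooth_flat_A.
have d1 := nf_d_Omega1 oB F2 F4 st so' sn flat_E1_dual flat_d_theta1 flat_d_theta2 flat_d_theta4.
have d2 := nf_d_Omega2 oB st so' sE sn flat_E1_dual flat_E2_dual flat_E3_dual flat_E4_dual flat_E5_dual
  flat_d_theta1 flat_d_theta2 flat_d_theta3 flat_d_theta4 flat_d_theta5 flat_A5E flat_A2E.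
have d3 := nf_d_Omega3 oB st so' sn flat_E1_dual flat_E2_dual flat_E3_dual flat_E4_dual flat_E5_dual
  flat_d_theta1 flat_d_theta2 flat_d_theta3 flat_d_theta4 flat_d_theta5 flat_A5E flat_A2E.
have d4 := nf_d_Omega4 oB st so' sE sn flat_E1_dual flat_E2_dual flat_E3_dual flat_E4_dual flat_E5_dual
  flat_d_theta1 flat_d_theta2 flat_d_theta3 flat_d_theta4 flat_d_theta5 flat_A5E flat_A2E.
have d5 := nf_d_Omega5 oB st so' sE sn flat_E1_dual flat_E2_dual flat_E3_dual flat_E4_dual flat_E5_dual
  flat_d_theta1 flat_d_theta2 flat_d_theta3 flat_d_theta4 flat_d_theta5 flat_A5E flat_A2E.
have gs := gauged_system oB smooth_flat_theta so flat_d_theta1 flat_d_theta2 flat_d_theta3 flat_d_theta4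
  flat_d_theta5 d1 d2 d3 d4 d5.
have [p1 p2 p3 p4 p5] := smooth_gauged_Omega oB smooth_flat_theta so.
have oP := open_bproj oB; set P := @bproj R @^-1` B in gs p1 p2 p3 p4 p5 oP *.
have sp f : smooth B f -> smooth P (fun q => f (bproj q)) by exact: smooth_comp_bproj.
have sc a : smooth P (fun=> a) by exact: smooth_cst.
exists P, (piB \o @bproj R), (@bproj R).
(* Constant parameters: rho = 1, phi = 0, f7 = -1, bf7 = 1. The first one gives theta^1 = -e (e w1)
   = -w1, since e^2 = 1. *)
pose c : pcr_coeffs R 10 := PcrCoeffs (fun=> - e) (fun=> 0) (fun=> 1) (fun=> 0) (fun=> 0) (fun=> 0)
  (fun=> 0) (fun=> -1) (fun=> 0) (fun=> 0) (fun=> 0) (fun=> 0) (fun=> 1).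
have tE : pcr_transform c (quint_map (pullback (@bproj R)) (Quint (e *: w1) w2 w3 w4 w5)) =
    Quint (pullback (@bproj R) flat_theta1) (pullback (@bproj R) w2) (pullback (@bproj R) flat_theta3)
      (pullback (@bproj R) w4) (pullback (@bproj R) w5).
  rewrite /c /pcr_transform; simpl; congr Quint; apply/funext => q; apply: ev1_inj => v.
  - rewrite -> ev1F, !ev_pull_bproj, ev1Z, vth1; atoms; rewrite mulrA mulNr ee mulN1r; reflexivity.
  - rewrite -> !ev1D, !ev1F, !ev_pull_bproj, expR0; atoms; move=> *; lra.
  - rewrite -> !ev1D, !ev1F, !ev_pull_bproj, vth3; atoms; move=> *; lra.
  - rewrite -> !ev1D, !ev1F, !ev_pull_bproj; rewrite oppr0 expR0; atoms; move=> *; lra.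
  - rewrite -> !ev1D, !ev1F, !ev_pull_bproj; atoms; move=> *; lra.
exists c.
exists (Quint (gauged_Omega1 flat_theta1 v1) (gauged_Omega2 w2 flat_Omega2) (gauged_Omega3 flat_theta1
  flat_Omega3) (gauged_Omega4 w4 flat_Omega4) (gauged_Omega5 flat_theta1 v1 nfO5)).
exists (EFunctions (fun q => flat_A1 (bproj q)) (fun q => flat_A2 (bproj q)) (fun q => nf3 (bproj q))
  (fun q => nf4 (bproj q))
  (fun q => flat_A5 (bproj q)) (fun q => nfl2 (bproj q) + -1 * (2^-1 * nfm3 (bproj q)))
  (fun q => flat_C (bproj q) + -1 * (2^-1 * nfl3 (bproj q))) (fun q => nf8 (bproj q))
  (fun=> 0) (fun q => 2^-1 * nfm3 (bproj q)) (fun q => 2^-1 * nfl3 (bproj q)) (fun=> 0)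
  (fun q => nfC (bproj q))).
rewrite /E_solution tE.
split.
- by split; [exact: oP|exact: fibred_bproj].
- split; [exact: smooth_bproj| |by move=> q _].
  by move=> y [q Pq <-].
- split; first by split; [| | | |split; [| | | |split]]; exact: sc.
    by split; [exact p1|exact p2|exact p3|exact p4|exact p5].
  have z1 : smooth P (fun q => nfl2 (bproj q)) by exact: sp.
  have z2 : smooth P (fun q => nfl3 (bproj q)) by exact: sp.
  have z3 : smooth P (fun q => nfm3 (bproj q)) by exact: sp.
  have z4 : smooth P (fun q => flat_C (bproj q)) by exact: sp.
  split; [exact: sp|exact: sp|exact: sp|exact: sp|].
  split; [exact: sp|simpl; smth2|simpl; smth2|exact: sp|].
  split; [exact: sc|simpl; smth2|simpl; smth2|exact: sc|exact: sp].
- apply: coframe_intro => // q v Pq v0.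
  have h1 := v0 (@Ordinal 10 0 isT); have h2 := v0 (@Ordinal 10 1 isT).
  have h3 := v0 (@Ordinal 10 2 isT); have h4 := v0 (@Ordinal 10 3 isT).
  have h5 := v0 (@Ordinal 10 4 isT); have h6 := v0 (@Ordinal 10 5 isT).
  have h7 := v0 (@Ordinal 10 6 isT); have h8 := v0 (@Ordinal 10 7 isT).
  have h9 := v0 (@Ordinal 10 8 isT); have h10 := v0 (@Ordinal 10 9 isT).
  clear v0; move: h1 h2 h3 h4 h5 h6 h7 h8 h9 h10; simpl.
  rewrite /gauged_Omega1 /gauged_Omega2 /gauged_Omega3 /gauged_Omega4 /gauged_Omega5; rewrite -> !ev1D,
    !ev1F, !ev_pull_bproj, !ev1_grad_fibre.
  rewrite -> vom2, vom3, vom4, !vth1, !vth3.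
  move=> /eqP; rewrite oppr_eq0 => /eqP h1 h2 /eqP; rewrite oppr_eq0 => /eqP h3 h4 h5.
  rewrite -> ?h1, ?h2, ?h4; rewrite ?oppr0 ?mulr0 ?addr0 ?subr0 => h6 /eqP.
  rewrite oppr_eq0 => /eqP h7; rewrite h6 ?mulr0 ?add0r => /eqP; rewrite oppr_eq0 => /eqP h8 /eqP.
  rewrite oppr_eq0 => /eqP h9 h10.
  have v0 : bproj v = 0.
    apply: (coframe_inj cB Pq) => -[k k9]; simpl.
    move: k k9 => [_|[_|[_|[_|[_|[_|[_|[_|[_|k k9]]]]]]]]]; simpl;
      [exact h1|exact h2|exact h3|exact h4|exact h5|exact h6|exact h8|exact h7|exact h9|exfalso].
    by move: k9; rewrite !ltnS ltn0.
  (* The projection of [v] to B vanishes, so the summand 2 du of Omega_5 gives the last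
     coordinate. *)
  apply: (bproj_eq0 v0); move: h10; rewrite v0.
  have e0 (a : 'rV[R]_9) : ev1 a 0 = 0 by rewrite ev1E big1 // => k _; rewrite mxE mulr0.
  rewrite e0.
  by move: (fibre_coord v) => *; lra.
- exact/system_EP.
Qed.

End Frame.

Lemma flat_question (M : set 'rV[R]_5) (piB : 'rV[R]_9 -> 'rV[R]_5) (e : R) :
  fibred B M piB -> e * e = 1 -> question M B piB (Quint (e *: w1) w2 w3 w4 w5).
Proof.
have [F1 [F2 [F3 [F4 [F5 [G3 [G4 [sF [sG3 sG4 dF]]]]]]]]] := smooth_dual_frame oB cB sw sv.
by apply: (@frame_question F1 F2 F3 F4 F5 G3 G4 sF (conj sG3 sG4)) => x /dF[[? ? ? ? ?] []].
Qed.

End Existence.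

(** * Invariants of an arbitrary solution *)

(** The theta's, being part of a coframe, take arbitrary values on vectors killed by the Omega's.
    This makes the matrix [C] expressing them by the pulled back forms invertible, and so the latter
    take arbitrary values on such vectors too. *)
Lemma frame_transfer (R : realType) m (V : Type) (C : 'M[R]_m) (W t : V -> 'cV[R]_m) (H : V -> Prop) :
  (forall u, t u = C *m W u) -> (forall c, exists u, H u /\ t u = c) ->
  forall c, exists u, H u /\ W u = c.
Proof.
move=> tC tH c; have [X XE] := choice (fun i : 'I_m => tH (delta_mx i 0)).
have uC : C \in unitmx.
  suff /mulmx1_unit[] : C *m \matrix_(i, j) W (X j) i 0 = 1%:M by [].
  apply/matrixP => i j; have [_] := XE j; rewrite tC => /colP/(_ i); rewrite !mxE => E.
  by rewrite andbT in E; rewrite -E; apply: eq_bigr => k _; rewrite mxE.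
have [u [Hu]] := tH (C *m c); rewrite tC => /(congr1 (mulmx (invmx C))).
by rewrite !mulKmx // => Wu; exists u.
Qed.

Section Bridge.
Variables (R : realType) (M : set 'rV[R]_5) (B : set 'rV[R]_9) (oB : open B) (piB : 'rV[R]_9 -> 'rV[R]_5).
Variables (w1 w2 w3 w4 w5 v1 v2 v3 v4 : form1 R 9).
Variables (I1 I2 K L T : scal R 9) (e : R).
Hypothesis sw : [/\ smooth_map B w1, smooth_map B w2, smooth_map B w3, smooth_map B w4 & smooth_map B w5].
Hypothesis str : structure_eqs B w1 w2 w3 w4 w5 v1 v2 v3 v4 I1 I2 K L T.
Local Notation w := (Quint (e *: w1) w2 w3 w4 w5).

Variables (P : set 'rV[R]_10) (piP : 'rV[R]_10 -> 'rV[R]_5) (s : 'rV[R]_10 -> 'rV[R]_9).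
Variables (c : pcr_coeffs R 10) (O : quint (form1 R 10)) (k : E_functions R).
Hypothesis sol : E_solution M B piB w P piP s c O k.

Let oP : open P. Proof. by case: sol => -[]. Qed.
Let ss : smooth_map P s. Proof. by case: sol => _ []. Qed.
Let PB q : P q -> B (s q).
Proof. by move=> Pq; have [_ [_ sPB _] _ _ _] := sol; apply: sPB; exists q. Qed.

Lemma pullback_structure_eqs : structure_eqs P (pullback s w1) (pullback s w2) (pullback s w3)
  (pullback s w4) (pullback s w5) (pullback s v1) (pullback s v2) (pullback s v3) (pullback s v4)
  (fun q => I1 (s q)) (fun q => I2 (s q)) (fun q => K (s q)) (fun q => L (s q)) (fun q => T (s q)).
Proof.
have [s1 s2 s3 s4 s5] := sw; split=> q Pq u v.
- rewrite (ev2_pullback oP ss oB PB u v s1 Pq); rewrite -> (str1 str (PB Pq) _ _); simpl; rewrite ->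
    !ev1_pullback; reflexivity.
- rewrite (ev2_pullback oP ss oB PB u v s2 Pq); rewrite -> (str2 str (PB Pq) _ _); simpl; rewrite ->
    !ev1_pullback; reflexivity.
- rewrite (ev2_pullback oP ss oB PB u v s3 Pq); rewrite -> (str3 str (PB Pq) _ _); simpl; rewrite ->
    !ev1_pullback; reflexivity.
- rewrite (ev2_pullback oP ss oB PB u v s4 Pq); rewrite -> (str4 str (PB Pq) _ _); simpl; rewrite ->
    !ev1_pullback; reflexivity.
- rewrite (ev2_pullback oP ss oB PB u v s5 Pq); rewrite -> (str5 str (PB Pq) _ _); simpl; rewrite ->
    !ev1_pullback; reflexivity.
Qed.

Let sW : [/\ smooth_map P (pullback s w1), smooth_map P (pullback s w2), smooth_map P (pullback s w3),
  smooth_map P (pullback s w4) & smooth_map P (pullback s w5)].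
Proof. by have [s1 s2 s3 s4 s5] := sw; split; [exact: (smooth_pullback oP ss oB PB s1)|exact:
  (smooth_pullback oP ss oB PB s2)|exact: (smooth_pullback oP ss oB PB s3)|exact: (smooth_pullback oP ss
    oB PB s4)|exact: (smooth_pullback oP ss oB PB s5)]. Qed.

Local Notation t := (pcr_transform c (quint_map (pullback s) w)).
Local Notation a := (fun x => crho c x * expR (cphi c x)).
Local Notation b := (fun x => crho c x * expR (- cphi c x)).
Local Notation f1 := (fun x => cf1 c x * e).
Local Notation f2 := (fun x => cf2 c x * e).
Local Notation f5 := (fun x => cf5 c x * e).
Local Notation g2 := (fun x => cbf2 c x * e).
Local Notation g5 := (fun x => cbf5 c x * e).
Local Notation W1 := (pullback s w1).
Local Notation W2 := (pullback s w2).
Local Notation W3 := (pullback s w3).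
Local Notation W4 := (pullback s w4).
Local Notation W5 := (pullback s w5).

Lemma smooth_crho_exp : smooth P a /\ smooth P b.
Proof.
have [_ _ [[_ _ sr sp _] _ _] _ _] := sol.
have sN : smooth P (fun x => - cphi c x) by exact: smoothN.
by split; apply: smoothM oP sr _; [exact: (smooth_expR oP sp)|exact: (smooth_expR oP sN)].
Qed.

Let sf : [/\ smooth P f1, smooth P f2, smooth P a & smooth P (cf4 c)] /\
  [/\ smooth P f5, smooth P (cf6 c) & smooth P (cf7 c)].
Proof.
have [sa _] := smooth_crho_exp.
have [_ _ [[s1 s2 _ _ [s4 s5 s6 s7 _]] _ _] _ _] := sol; have se := smooth_cst P e.
split; split.
- exact: (smoothM oP s1 se).
- exact: (smoothM oP s2 se).
- exact sa.
- exact s4.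
- exact: (smoothM oP s5 se).
- exact s6.
- exact s7.
Qed.

Let sg : [/\ smooth P g2, smooth P b & smooth P (cbf4 c)] /\
  [/\ smooth P g5, smooth P (cbf6 c) & smooth P (cbf7 c)].
Proof.
have [_ sb] := smooth_crho_exp.
have [_ _ [[_ _ _ _ [_ _ _ _ [s2 s4 s5 s6 s7]]] _ _] _ _] := sol; have se := smooth_cst P e.
split; split.
- exact: (smoothM oP s2 se).
- exact sb.
- exact s4.
- exact: (smoothM oP s5 se).
- exact s6.
- exact s7.
Qed.

Let pw1 q u : ev1 (pullback s (e *: w1) q) u = e * ev1 (W1 q) u.
Proof. by rewrite !ev1_pullback ev1Z. Qed.

Let T1 q : P q -> forall u, ev1 (q1 t q) u = ev_terms1 [:: (f1, W1)] q u.
Proof. by move=> _ u; rewrite /pcr_transform; simpl; rewrite -> !ev1F, pw1; atoms; rewrite addr0 mulrA. Qed.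
Let T2 q : P q -> forall u, ev1 (q2 t q) u = ev_terms1 [:: (f2, W1); (a, W2); (cf4 c, W3)] q u.
Proof. by move=> _ u; rewrite /pcr_transform; simpl; rewrite -> !ev1D, !ev1F, pw1; atoms; rewrite addr0
  mulrA addrA. Qed.
Let T3 q : P q -> forall u, ev1 (q3 t q) u = ev_terms1 [:: (f5, W1); (cf6 c, W2); (cf7 c, W3)] q u.
Proof. by move=> _ u; rewrite /pcr_transform; simpl; rewrite -> !ev1D, !ev1F, pw1; atoms; rewrite addr0
  mulrA addrA. Qed.
Let T4 q : P q -> forall u, ev1 (q4 t q) u = ev_terms1 [:: (g2, W1); (b, W4); (cbf4 c, W5)] q u.
Proof. by move=> _ u; rewrite /pcr_transform; simpl; rewrite -> !ev1D, !ev1F, pw1; atoms; rewrite addr0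
  mulrA addrA. Qed.
Let T5 q : P q -> forall u, ev1 (q5 t q) u = ev_terms1 [:: (g5, W1); (cbf6 c, W4); (cbf7 c, W5)] q u.
Proof. by move=> _ u; rewrite /pcr_transform; simpl; rewrite -> !ev1D, !ev1F, pw1; atoms; rewrite addr0
  mulrA addrA. Qed.

Let Es : system_E_eqs P (q1 t) (q2 t) (q3 t) (q4 t) (q5 t) (q1 O) (q2 O) (q3 O) (q4 O) (q5 O)
  (fA1 k) (fA2 k) (fA3 k) (fA4 k) (fA5 k) (fA6 k) (fA7 k) (fA8 k) (fZ1 k) (fZ2 k) (fZ3 k) (fZ4 k) (fC1 k).
Proof. by have [_ _ _ _ E] := sol; apply/system_EP; case: (O) (k) E => ? ? ? ? ? []. Qed.

Let cO q (y : 'I_10 -> R) : P q -> exists X, forall i : 'I_10, ev1 (nth (fun=> 0) (quint_seq t ++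
  quint_seq O) i q) X = y i.
Proof. by move=> Pq; have [_ _ _ cP _] := sol; exact: coframe_vec cP Pq. Qed.

Let tO q (y : 'cV[R]_5) : P q -> exists X,
  [/\ ev1 (q1 O q) X = 0, ev1 (q2 O q) X = 0, ev1 (q3 O q) X = 0 & ev1 (q4 O q) X = 0] /\
  \col_(i < 5) nth 0 [:: ev1 (q1 t q) X; ev1 (q2 t q) X; ev1 (q3 t q) X; ev1 (q4 t q) X; ev1 (q5 t q) X]
    i = y.
Proof.
move=> Pq; have [X XE] := cO (fun i => nth 0 [:: y 0 0; y 1 0; y 2 0; y 3 0; y 4 0] i) Pq; exists X; split.
  split.
  - exact: (XE (@Ordinal 10 5 isT)).
  - exact: (XE (@Ordinal 10 6 isT)).
  - exact: (XE (@Ordinal 10 7 isT)).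
  - exact: (XE (@Ordinal 10 8 isT)).
have x1 := XE (@Ordinal 10 0 isT); have x2 := XE (@Ordinal 10 1 isT); have x3 := XE (@Ordinal 10 2 isT).
have x4 := XE (@Ordinal 10 3 isT); have x5 := XE (@Ordinal 10 4 isT).
apply/colP => i; rewrite mxE; case: i => -[|[|[|[|[|i]]]]] i5; last by exfalso; move: i5; rewrite !ltnS ltn0.
- rewrite [LHS]x1 /=; congr (y _ _); exact: val_inj.
- rewrite [LHS]x2 /=; congr (y _ _); exact: val_inj.
- rewrite [LHS]x3 /=; congr (y _ _); exact: val_inj.
- rewrite [LHS]x4 /=; congr (y _ _); exact: val_inj.
- rewrite [LHS]x5 /=; congr (y _ _); exact: val_inj.
Qed.

Let frame q : P q -> forall c1 c2 c3 c4 c5, exists X,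
  horizontal W1 W2 W3 W4 W5 (q1 O) (q2 O) (q3 O) (q4 O) q X c1 c2 c3 c4 c5.
Proof.
move=> Pq c1 c2 c3 c4 c5.
pose C : 'M[R]_5 := \matrix_(i, j) nth 0 (nth [::] [::
  [:: cf1 c q * e; 0; 0; 0; 0]; [:: cf2 c q * e; a q; cf4 c q; 0; 0]; [:: cf5 c q * e; cf6 c q; cf7 c q;
    0; 0];
  [:: cbf2 c q * e; 0; 0; b q; cbf4 c q]; [:: cbf5 c q * e; 0; 0; cbf6 c q; cbf7 c q]] i) j.
have [|X [HX XE]] := frame_transfer (C := C)
  (W := fun X => \col_i nth 0 [:: ev1 (W1 q) X; ev1 (W2 q) X; ev1 (W3 q) X; ev1 (W4 q) X; ev1 (W5 q) X] i)
  _ (fun y => tO y Pq) (\col_i nth 0 [:: c1; c2; c3; c4; c5] i).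
  move=> u; apply/colP => i; rewrite [LHS]mxE [RHS]mxE !big_ord_recr big_ord0; rewrite !mxE; simpl.
  case: i => -[|[|[|[|[|i]]]]] i5; last by exfalso; move: i5; rewrite !ltnS ltn0.
  - transitivity (ev1 (q1 t q) u); [reflexivity|rewrite -> (T1 Pq u); simpl; atoms; lra].
  - transitivity (ev1 (q2 t q) u); [reflexivity|rewrite -> (T2 Pq u); simpl; atoms; lra].
  - transitivity (ev1 (q3 t q) u); [reflexivity|rewrite -> (T3 Pq u); simpl; atoms; lra].
  - transitivity (ev1 (q4 t q) u); [reflexivity|rewrite -> (T4 Pq u); simpl; atoms; lra].
  - transitivity (ev1 (q5 t q) u); [reflexivity|rewrite -> (T5 Pq u); simpl; atoms; lra].
exists X; split=> //; split.
- by have /colP/(_ (@Ordinal 5 0 isT)) := XE; rewrite !mxE.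
- by have /colP/(_ (@Ordinal 5 1 isT)) := XE; rewrite !mxE.
- by have /colP/(_ (@Ordinal 5 2 isT)) := XE; rewrite !mxE.
- by have /colP/(_ (@Ordinal 5 3 isT)) := XE; rewrite !mxE.
- by have /colP/(_ (@Ordinal 5 4 isT)) := XE; rewrite !mxE.
Qed.

Let f1_neq0 q : P q -> f1 q != 0.
Proof.
move=> Pq; have [X XE] := cO (fun=> 1) Pq; have := etrans (esym (T1 Pq X)) (XE (@Ordinal 10 0 isT)); simpl.
by move=> E; apply/eqP => f10; move: E; rewrite f10 mul0r add0r => /esym/eqP; rewrite oner_eq0.
Qed.

Theorem theta_invariants q : P q ->
  [/\ K (s q) = 0, L (s q) = 0, fZ1 k q = 0, b q != 0 & fA1 k q * b q ^+ 3 = - I1 (s q)].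
Proof.
move=> Pq; have [[E1 E2 E3 E4 E5] _] := Es; have st := pullback_structure_eqs.
have F := f1E oP st sW sf f1_neq0 T1 T2 T4 E1 frame.
(* [f1E] removes f4 and g4, which gives the short expansions that the remaining lemmas start
   from. *)
have T2' x : P x -> forall u, ev1 (q2 t x) u = ev_terms1 [:: (f2, W1); (a, W2)] x u.
  move=> Px u; rewrite (T2 Px u); simpl; have [_ -> _] := F _ Px; atoms; lra.
have T4' x : P x -> forall u, ev1 (q4 t x) u = ev_terms1 [:: (g2, W1); (b, W4)] x u.
  move=> Px u; rewrite (T4 Px u); simpl; have [_ _ ->] := F _ Px; atoms; lra.
split.
- exact: (K_zero oP st sW sf sg f1_neq0 T1 T2 T3 T4 T5 E1 E2 E3 E4 E5 frame T2' T4' Pq).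
- exact: (L_zero oP st sW sf sg f1_neq0 T1 T2 T3 T4 T5 E1 E2 E3 E4 E5 frame T2' T4' Pq).
- exact: (Z1_zero oP st sW sf sg f1_neq0 T1 T2 T3 T4 T5 E1 E2 E5 frame T2' T4' Pq).
- by have [_] := ab_neq0 oP st sW sf f1_neq0 T1 T2 T4 E1 frame Pq.
- exact: (A1E oP st sW sf sg f1_neq0 T1 T2 T3 T4 E1 E2 E3 frame T2' T4' Pq).
Qed.

End Bridge.

(** * The Cartan connection *)

Section SymplecticMatrices.
Variable R : realType.

(** The entry pattern of [omega_hat] with numbers, a_i for theta^i and b_i for Omega_i: a linear
    parametrisation of sp(4,R). *)
Definition spmx (a1 a2 a3 a4 a5 b1 b2 b3 b4 b5 : R) : 'M[R]_4 :=
  \matrix_(i, j) nth 0 (nth [::] [::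
    [:: 2^-1 * b1; 2^-1 * b2; - (2^-1 * b4); - (4^-1 * b5)];
    [:: a4; b3 - 2^-1 * b1; - a5; - (2^-1 * b4)];
    [:: a2; a3; 2^-1 * b1 - b3; - (2^-1 * b2)];
    [:: 2 * a1; a2; - a4; - (2^-1 * b1)]] i) j.

Lemma symplE (i j : 'I_4) : sympl R i j = nth 0 (nth [::] [::
  [:: 0; 0; 0; 1]; [:: 0; 0; 1; 0]; [:: 0; -1; 0; 0]; [:: -1; 0; 0; 0]] i) j.
Proof.
rewrite /sympl !mxE.
by case: i => -[|[|[|[|i]]]] i4 //; case: j => -[|[|[|[|j]]]] j4 //; simpl; lra.
Qed.

Let big4 (F : 'I_4 -> R) : \sum_i F i = F i40 + F i41 + F i42 + F i43.
Proof.
rewrite !big_ord_recr big_ord0 /= add0r.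
by congr (F _ + F _ + F _ + F _); apply: val_inj.
Qed.

Lemma sp4E (X : 'M[R]_4) : X^T *m sympl R + sympl R *m X = 0 <-> forall i j : 'I_4,
  X i40 i * sympl R i40 j + X i41 i * sympl R i41 j + X i42 i * sympl R i42 j + X i43 i * sympl R i43 j
  + (sympl R i i40 * X i40 j + sympl R i i41 * X i41 j + sympl R i i42 * X i42 j + sympl R i i43 * X i43
    j) = 0.
Proof.
have mulE (A C : 'M[R]_4) i j : (A *m C) i j =
    A i i40 * C i40 j + A i i41 * C i41 j + A i i42 * C i42 j + A i i43 * C i43 j.
  by rewrite mxE big4.
have trE i j : X^T i j = X j i by rewrite mxE.
have E i j : (X^T *m sympl R + sympl R *m X) i j =
    X i40 i * sympl R i40 j + X i41 i * sympl R i41 j + X i42 i * sympl R i42 j + X i43 i * sympl R i43 j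
  + (sympl R i i40 * X i40 j + sympl R i i41 * X i41 j + sympl R i i42 * X i42 j + sympl R i i43 * X i43 j).
  by rewrite [LHS]mxE !mulE !trE.
split=> [X0 i j|X0]; first by rewrite -E X0 mxE.
by apply/matrixP => i j; rewrite E X0 mxE.
Qed.

Lemma sp4_spmx a1 a2 a3 a4 a5 b1 b2 b3 b4 b5 : sp4 (spmx a1 a2 a3 a4 a5 b1 b2 b3 b4 b5).
Proof.
apply/sp4E => i j; rewrite !symplE !mxE.
by case: i => -[|[|[|[|i]]]] i4 //; case: j => -[|[|[|[|j]]]] j4 //; simpl; lra.
Qed.

Lemma sp4_spmxE (X : 'M[R]_4) : sp4 X ->
  X = spmx (2^-1 * X i43 i40) (X i42 i40) (X i42 i41) (X i41 i40) (- X i41 i42)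
    (2 * X i40 i40) (2 * X i40 i41) (X i41 i41 + X i40 i40) (- 2 * X i40 i42) (- 4 * X i40 i43).
Proof.
move/sp4E => E.
have := E i40 i40; have := E i40 i41; have := E i40 i42; have := E i40 i43.
have := E i41 i40; have := E i41 i41; have := E i41 i42; have := E i41 i43.
have := E i42 i40; have := E i42 i41; have := E i42 i42; have := E i42 i43.
have := E i43 i40; have := E i43 i41; have := E i43 i42; have := E i43 i43.
rewrite !symplE; simpl => *; apply/matrixP => i j; rewrite mxE.
have iE (k : 'I_4) : [\/ k = i40, k = i41, k = i42 | k = i43].
  by case: k => -[|[|[|[|k]]]] k4 //; [constructor 1|constructor 2|constructor 3|constructor 4]; apply:
    val_inj.
by case: (iE i) => ->; case: (iE j) => ->; simpl; lra.
Qed.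

Lemma spmx_inj a1 a2 a3 a4 a5 b1 b2 b3 b4 b5 a1' a2' a3' a4' a5' b1' b2' b3' b4' b5' :
  spmx a1 a2 a3 a4 a5 b1 b2 b3 b4 b5 = spmx a1' a2' a3' a4' a5' b1' b2' b3' b4' b5' ->
  [/\ a1 = a1', a2 = a2', a3 = a3', a4 = a4' & a5 = a5'] /\
  [/\ b1 = b1', b2 = b2', b3 = b3', b4 = b4' & b5 = b5'].
Proof.
move=> /matrixP E.
have := E i43 i40; have := E i42 i40; have := E i42 i41; have := E i41 i40; have := E i41 i42.
have := E i40 i40; have := E i40 i41; have := E i41 i41; have := E i40 i42; have := E i40 i43.
by rewrite !mxE; simpl => *; split; split; lra.
Qed.

Lemma isotropy_spmx a1 a2 a3 a4 a5 b1 b2 b3 b4 b5 :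
  isotropy (spmx a1 a2 a3 a4 a5 b1 b2 b3 b4 b5) <-> [/\ a1 = 0, a2 = 0, a3 = 0, a4 = 0 & a5 = 0].
Proof.
split=> [[_ /is_trig_mxP tr]|[-> -> -> -> ->]].
  have := tr i40 i43 isT; have := tr i40 i42 isT; have := tr i40 i41 isT; have := tr i41 i42 isT.
  by rewrite !mxE; simpl => *; split; lra.
split; [exact: sp4_spmx| |by rewrite mxE /= oppr0].
apply/is_trig_mxP => i j; rewrite !mxE.
by case: i => -[|[|[|[|i]]]] i4 //; case: j => -[|[|[|[|j]]]] j4 //; simpl => // _; lra.
Qed.

End SymplecticMatrices.

(** Both kernels have dimension m - n, so one inclusion suffices. *)
Lemma kermx_eq (R : realType) m n (J A : 'M[R]_(m, n)) : row_full J -> row_full A ->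
  (forall v : 'rV_m, v *m J = 0 -> v *m A = 0) -> forall v : 'rV_m, v *m J = 0 <-> v *m A = 0.
Proof.
move=> fJ fA JA v; split=> [/JA //|/sub_kermxP vA].
have sJA : (kermx J <= kermx A)%MS by apply/rV_subP => u /sub_kermxP /JA /sub_kermxP.
have rJA : (\rank (kermx J) == \rank (kermx A))%N.
  by rewrite !mxrank_ker (eqP fJ : \rank J = n) (eqP fA : \rank A = n).
have [_ E] := mxrank_leqif_eq sJA; move: rJA; rewrite E => /andP[_ sAJ].
by apply/sub_kermxP; exact: submx_trans vA sAJ.
Qed.

Section CartanConnection.
Variables (R : realType) (P : set 'rV[R]_10) (oP : open P) (piP : 'rV[R]_10 -> 'rV[R]_5).
Variables (t1 t2 t3 t4 t5 O1 O2 O3 O4 O5 : form1 R 10).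
Variables (A1 A2 A3 A4 A5 A6 A7 A8 Z1 Z2 Z3 Z4 C1 : scal R 10).
Hypothesis st : [/\ smooth_map P t1, smooth_map P t2, smooth_map P t3, smooth_map P t4 & smooth_map P t5].
Hypothesis sO : [/\ smooth_map P O1, smooth_map P O2, smooth_map P O3, smooth_map P O4 & smooth_map P O5].
Hypothesis cP : coframe P [:: t1; t2; t3; t4; t5; O1; O2; O3; O4; O5].
Hypothesis Es : system_E_eqs P t1 t2 t3 t4 t5 O1 O2 O3 O4 O5 A1 A2 A3 A4 A5 A6 A7 A8 Z1 Z2 Z3 Z4 C1.
Hypothesis fJ : forall q, P q -> row_full ('J piP q).
Hypothesis vertical : forall q v, P q -> v *m 'J piP q = 0 ->
  [/\ ev1 (t1 q) v = 0, ev1 (t2 q) v = 0, ev1 (t3 q) v = 0, ev1 (t4 q) v = 0 & ev1 (t5 q) v = 0].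

Local Notation om := (omega_hat (Quint t1 t2 t3 t4 t5) (Quint O1 O2 O3 O4 O5)).

Lemma eval_omE q v : eval_om om q v = spmx (ev1 (t1 q) v) (ev1 (t2 q) v) (ev1 (t3 q) v) (ev1 (t4 q) v)
  (ev1 (t5 q) v) (ev1 (O1 q) v) (ev1 (O2 q) v) (ev1 (O3 q) v) (ev1 (O4 q) v) (ev1 (O5 q) v).
Proof.
apply/matrixP => i j; rewrite [LHS]mxE [RHS]mxE -[LHS]/(ev1 (om i j q) v) [om i j]mxE.
case: i => -[|[|[|[|i]]]] i4 //; case: j => -[|[|[|[|j]]]] j4 //; simpl;
  repeat first [rewrite -> ev1D | rewrite -> ev1N | rewrite -> ev1Z]; reflexivity.
Qed.

Lemma ev_curvature i j q u v : ev2 (curvature om i j q) u v = ev2 (ext_d (om i j) q) u v +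
  (ev1 (om i i40 q) u * ev1 (om i40 j q) v - ev1 (om i i40 q) v * ev1 (om i40 j q) u +
  (ev1 (om i i41 q) u * ev1 (om i41 j q) v - ev1 (om i i41 q) v * ev1 (om i41 j q) u) +
  (ev1 (om i i42 q) u * ev1 (om i42 j q) v - ev1 (om i i42 q) v * ev1 (om i42 j q) u) +
  (ev1 (om i i43 q) u * ev1 (om i43 j q) v - ev1 (om i i43 q) v * ev1 (om i43 j q) u)).
Proof.
have big4 (V : nmodType) (F : 'I_4 -> V) : \sum_l F l = F i40 + F i41 + F i42 + F i43.
  by rewrite !big_ord_recr big_ord0 /= add0r; congr (F _ + F _ + F _ + F _); apply: val_inj.
by rewrite /curvature big4 !ev2D !ev2W.
Qed.

Let omE i j : om i j = nth 0 (nth [::] [::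
    [:: 2^-1 *: O1; 2^-1 *: O2; - (2^-1 *: O4); - (4^-1 *: O5)];
    [:: t4; O3 - 2^-1 *: O1; - t5; - (2^-1 *: O4)];
    [:: t2; t3; 2^-1 *: O1 - O3; - (2^-1 *: O2)];
    [:: 2 *: t1; t2; - t4; - (2^-1 *: O1)]] i) j.
Proof. by rewrite mxE. Qed.

Let dh (o : form1 R 10) (a : R) q u v : smooth_map P o -> P q ->
  ev2 (ext_d (a *: o) q) u v = a * ev2 (ext_d o q) u v /\
  ev2 (ext_d (- (a *: o)) q) u v = - (a * ev2 (ext_d o q) u v).
Proof.
move=> so Pq; have sZ := smooth_mapZ a oP so.
by rewrite (ev2_ext_dN u v Pq sZ) (ev2_ext_dZ a u v Pq so).
Qed.
Let dD (o o' : form1 R 10) (a : R) q u v : smooth_map P o -> smooth_map P o' -> P q ->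
  ev2 (ext_d (o - a *: o') q) u v = ev2 (ext_d o q) u v - a * ev2 (ext_d o' q) u v /\
  ev2 (ext_d (a *: o' - o) q) u v = a * ev2 (ext_d o' q) u v - ev2 (ext_d o q) u v.
Proof.
move=> so so' Pq; have sZ := smooth_mapZ a oP so'.
rewrite (ev2_ext_dD u v Pq so (smooth_mapN oP sZ)) (ev2_ext_dN u v Pq sZ) (ev2_ext_dZ a u v Pq so').
by rewrite (ev2_ext_dD u v Pq sZ (smooth_mapN oP so)) (ev2_ext_dN u v Pq so) (ev2_ext_dZ a u v Pq so').
Qed.

Lemma d_om i j q u v : P q -> ev2 (ext_d (om i j) q) u v =
  let d o := ev2 (ext_d o q) u v in nth 0 (nth [::] [::
    [:: 2^-1 * d O1; 2^-1 * d O2; - (2^-1 * d O4); - (4^-1 * d O5)];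
    [:: d t4; d O3 - 2^-1 * d O1; - d t5; - (2^-1 * d O4)];
    [:: d t2; d t3; 2^-1 * d O1 - d O3; - (2^-1 * d O2)];
    [:: 2 * d t1; d t2; - d t4; - (2^-1 * d O1)]] i) j.
Proof.
have [s1 s2 s3 s4 s5] := st; have [r1 r2 r3 r4 r5] := sO; move=> Pq.
have [z1 n1] := dh 2^-1 u v r1 Pq; have [z2 n2] := dh 2^-1 u v r2 Pq; have [z4 n4] := dh 2^-1 u v r4 Pq.
have [_ n5] := dh 4^-1 u v r5 Pq; have [zt _] := dh 2 u v s1 Pq; have [m1 m2] := dD 2^-1 u v r3 r1 Pq.
have k4 := ev2_ext_dN u v Pq s4; have k5 := ev2_ext_dN u v Pq s5.
rewrite -> omE.
case: i => -[|[|[|[|i]]]] i4; [| | | |by exfalso; move: i4; rewrite !ltnS ltn0];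
  (case: j => -[|[|[|[|j]]]] j4; [| | | |by exfalso; move: j4; rewrite !ltnS ltn0]); simpl.
- exact z1.
- exact z2.
- exact n4.
- exact n5.
- reflexivity.
- exact m1.
- exact k5.
- exact n4.
- reflexivity.
- reflexivity.
- exact m2.
- exact n2.
- exact zt.
- reflexivity.
- exact k4.
- exact n1.
Qed.

Ltac rw_curv Pq := rewrite -> ev_curvature, (d_om _ _ _ _ Pq), !omE; simpl;
  repeat first [rewrite -> ev1D | rewrite -> ev1N | rewrite -> ev1Z];
  let h1 := fresh in let h2 := fresh in let h3 := fresh in let h4 := fresh in let h5 := fresh in
  let h6 := fresh in let h7 := fresh in let h8 := fresh in let h9 := fresh in let h10 := fresh in
  have [[h1 h2 h3 h4 h5] [h6 h7 h8 h9 h10]] := Es;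
  rw_d h1 Pq; rw_d h2 Pq; rw_d h3 Pq; rw_d h4 Pq; rw_d h5 Pq;
  rw_d h6 Pq; rw_d h7 Pq; rw_d h8 Pq; rw_d h9 Pq; rw_d h10 Pq; clear h1 h2 h3 h4 h5 h6 h7 h8 h9 h10; simpl.

Lemma curvature_32 q u v : P q -> ev2 (curvature om i42 i41 q) u v =
  A1 q * (ev1 (t4 q) u * ev1 (t1 q) v - ev1 (t4 q) v * ev1 (t1 q) u)
  + A2 q * (ev1 (t2 q) u * ev1 (t1 q) v - ev1 (t2 q) v * ev1 (t1 q) u).
Proof.
have [s1 s2 s3 s4 s5] := st; have [r1 r2 r3 r4 r5] := sO; move=> Pq; rw_curv Pq.
by atoms; move: (A1 q) (A2 q) => *; lra.
Qed.

Lemma curvature_23 q u v : P q -> ev2 (curvature om i41 i42 q) u v =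
  - (Z1 q * (ev1 (t2 q) u * ev1 (t3 q) v - ev1 (t2 q) v * ev1 (t3 q) u)
  + (A7 q + Z3 q) * (ev1 (t1 q) u * ev1 (t2 q) v - ev1 (t1 q) v * ev1 (t2 q) u)
  + Z4 q * (ev1 (t1 q) u * ev1 (t3 q) v - ev1 (t1 q) v * ev1 (t3 q) u)
  - A5 q * (ev1 (t1 q) u * ev1 (t4 q) v - ev1 (t1 q) v * ev1 (t4 q) u)).
Proof.
have [s1 s2 s3 s4 s5] := st; have [r1 r2 r3 r4 r5] := sO; move=> Pq; rw_curv Pq.
by atoms; move: (A7 q) (A5 q) (Z1 q) (Z3 q) (Z4 q) => *; lra.
Qed.

Lemma horizontal_curvature q i j u v : P q -> u *m 'J piP q = 0 -> ev2 (curvature om i j q) u v = 0.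
Proof.
have [s1 s2 s3 s4 s5] := st; have [r1 r2 r3 r4 r5] := sO; move=> Pq /(vertical Pq)[e1 e2 e3 e4 e5].
have iE (k : 'I_4) : [\/ k = i40, k = i41, k = i42 | k = i43].
  by case: k => -[|[|[|[|k]]]] k4 //; [constructor 1|constructor 2|constructor 3|constructor 4]; apply:
    val_inj.
case: (iE i) => ->; case: (iE j) => ->; rw_curv Pq; rewrite -> ?e1, ?e2, ?e3, ?e4, ?e5; atoms;
  move: (A1 q) (A2 q) (A3 q) (A4 q) (A5 q) (A6 q) (A7 q) (A8 q) (Z1 q) (Z2 q) (Z3 q) (Z4 q) (C1 q) => *; lra.
Qed.

Lemma coframe10_vec q (a1 a2 a3 a4 a5 b1 b2 b3 b4 b5 : R) : P q -> exists X,
  [/\ ev1 (t1 q) X = a1, ev1 (t2 q) X = a2, ev1 (t3 q) X = a3, ev1 (t4 q) X = a4 & ev1 (t5 q) X = a5] /\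
  [/\ ev1 (O1 q) X = b1, ev1 (O2 q) X = b2, ev1 (O3 q) X = b3, ev1 (O4 q) X = b4 & ev1 (O5 q) X = b5].
Proof.
move=> Pq; have [X XE] := coframe_vec (fun i => nth 0 [:: a1; a2; a3; a4; a5; b1; b2; b3; b4; b5] i) cP Pq.
exists X; split; split.
- exact: (XE (@Ordinal 10 0 isT)).
- exact: (XE (@Ordinal 10 1 isT)).
- exact: (XE (@Ordinal 10 2 isT)).
- exact: (XE (@Ordinal 10 3 isT)).
- exact: (XE (@Ordinal 10 4 isT)).
- exact: (XE (@Ordinal 10 5 isT)).
- exact: (XE (@Ordinal 10 6 isT)).
- exact: (XE (@Ordinal 10 7 isT)).
- exact: (XE (@Ordinal 10 8 isT)).
- exact: (XE (@Ordinal 10 9 isT)).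
Qed.

(** Vertical vectors annihilate the theta's by hypothesis. The converse is a dimension count: five
    independent forms against a submersion onto a 5-dimensional base. *)
Lemma verticalP q v : P q -> v *m 'J piP q = 0 <->
  [/\ ev1 (t1 q) v = 0, ev1 (t2 q) v = 0, ev1 (t3 q) v = 0, ev1 (t4 q) v = 0 & ev1 (t5 q) v = 0].
Proof.
move=> Pq; pose A : 'M[R]_(10, 5) := \matrix_(i, j) nth 0 [:: t1 q; t2 q; t3 q; t4 q; t5 q] j 0 i.
have AE (u : 'rV_10) (j : 'I_5) : (u *m A) 0 j = ev1 (nth 0 [:: t1 q; t2 q; t3 q; t4 q; t5 q] j) u.
  by rewrite mxE ev1E; apply: eq_bigr => i _; rewrite mxE mulrC.
have A0 u : u *m A = 0 <->
    [/\ ev1 (t1 q) u = 0, ev1 (t2 q) u = 0, ev1 (t3 q) u = 0, ev1 (t4 q) u = 0 & ev1 (t5 q) u = 0].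
  split=> [uA|[e1 e2 e3 e4 e5]].
    have E j : ev1 (nth 0 [:: t1 q; t2 q; t3 q; t4 q; t5 q] j) u = 0 \/ (5 <= j)%N.
      have [j5|j5] := ltnP j 5; last by right.
      by left; rewrite -(AE u (Ordinal j5)) uA mxE.
    by split; [case: (E 0%N)|case: (E 1%N)|case: (E 2)|case: (E 3)|case: (E 4)].
  apply/rowP => -[j j5]; rewrite AE [RHS]mxE; simpl.
  move: j j5 => [|[|[|[|[|j]]]]] j5; simpl; [exact e1|exact e2|exact e3|exact e4|exact e5|exfalso].
  by move: j5; rewrite !ltnS ltn0.
have fA : row_full A.
  have X (j : 'I_5) : exists X, X *m A = delta_mx 0 j :> 'rV_5.
    have [X [[x1 x2 x3 x4 x5] _]] := coframe10_vec (j == 0 :> nat)%:R (j == 1 :> nat)%:R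
      (j == 2 :> nat)%:R (j == 3 :> nat)%:R (j == 4 :> nat)%:R 0 0 0 0 0 Pq.
    exists X; apply/rowP => -[i i5]; rewrite AE [RHS]mxE -val_eqE [RHS]/= eq_sym; simpl.
    move: i i5 => [|[|[|[|[|i]]]]] i5; simpl; [exact x1|exact x2|exact x3|exact x4|exact x5|exfalso].
    by move: i5; rewrite !ltnS ltn0.
  have [X' XE] := choice X; apply/row_fullP; exists (\matrix_j X' j).
  by apply/row_matrixP => j; rewrite row_mul rowK XE row1.
rewrite -A0; apply: (kermx_eq (fJ Pq) fA) => u uJ; apply/A0; exact: vertical.
Qed.

Lemma system_E_Cartan : sp4_Cartan_connection P piP om.
Proof.
move=> q Pq; split=> [v|X sX|v|v i j vJ].
- by rewrite eval_omE; exact: sp4_spmx.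
- have XE := sp4_spmxE sX; set Y := spmx _ _ _ _ _ _ _ _ _ _ in XE.
  have [v [[x1 x2 x3 x4 x5] [y1 y2 y3 y4 y5]]] := coframe10_vec (2^-1 * X i43 i40) (X i42 i40) (X i42 i41)
    (X i41 i40) (- X i41 i42) (2 * X i40 i40) (2 * X i40 i41) (X i41 i41 + X i40 i40) (- 2 * X i40 i42)
    (- 4 * X i40 i43) Pq.
  exists v; split=> [|v']; first by rewrite eval_omE x1 x2 x3 x4 x5 y1 y2 y3 y4 y5; exact: esym XE.
  rewrite eval_omE => XE'; have /spmx_inj[[z1 z2 z3 z4 z5] [z6 z7 z8 z9 z10]] := etrans XE' XE.
  apply/eqP; rewrite -subr_eq0; apply/eqP; apply: (coframe_inj cP Pq) => -[k k10]; simpl.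
  rewrite -scaleN1r; rewrite -> ev1Dr, ev1Zr; rewrite mulN1r.
  move: k k10 => [|[|[|[|[|[|[|[|[|[|k]]]]]]]]]] k10; simpl;
    [rewrite x1 z1|rewrite x2 z2|rewrite x3 z3|rewrite x4 z4|rewrite x5 z5|
     rewrite y1 z6|rewrite y2 z7|rewrite y3 z8|rewrite y4 z9|rewrite y5 z10|by move: k10; rewrite !ltnS ltn0];
    exact: subrr.
- by rewrite eval_omE (verticalP v Pq); apply: iff_sym; exact: isotropy_spmx.
- by apply: ev1_inj => u; rewrite [RHS]ev1E big1 => [|l _]; [exact: horizontal_curvature|rewrite mxE mul0r].
Qed.

End CartanConnection.

(** * From a solution to its connection and its invariants *)

Section Solutions.
Variables (R : realType) (M : set 'rV[R]_5) (oM : open M) (B : set 'rV[R]_9) (oB : open B).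
Variables (piB : 'rV[R]_9 -> 'rV[R]_5).
Variables (w1 w2 w3 w4 w5 v1 v2 v3 v4 : form1 R 9).
Variables (I1 I2 K L T : scal R 9) (e : R).
Hypothesis sw : [/\ smooth_map B w1, smooth_map B w2, smooth_map B w3, smooth_map B w4 & smooth_map B w5].
Hypothesis str : structure_eqs B w1 w2 w3 w4 w5 v1 v2 v3 v4 I1 I2 K L T.
Hypothesis fB : fibred B M piB.
Hypothesis hor : forall b u, B b -> u *m 'J piB b = 0 ->
  [/\ ev1 (w1 b) u = 0, ev1 (w2 b) u = 0, ev1 (w3 b) u = 0, ev1 (w4 b) u = 0 & ev1 (w5 b) u = 0].
Variable inv : scal R 5.
Hypothesis I1_inv : nonvanishing_multiple B I1 (inv \o piB).
Local Notation w := (Quint (e *: w1) w2 w3 w4 w5).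

Section Solution.
Variables (P : set 'rV[R]_10) (piP : 'rV[R]_10 -> 'rV[R]_5) (s : 'rV[R]_10 -> 'rV[R]_9).
Variables (c : pcr_coeffs R 10) (O : quint (form1 R 10)) (k : E_functions R).
Hypothesis sol : E_solution M B piB w P piP s c O k.
Local Notation t := (pcr_transform c (quint_map (pullback s) w)).

Let oP : open P. Proof. by case: sol => -[]. Qed.
Let ss : smooth_map P s. Proof. by case: sol => _ []. Qed.
Let PB q : P q -> B (s q).
Proof. by move=> Pq; have [_ [_ sPB _] _ _ _] := sol; apply: sPB; exists q. Qed.

Let st : [/\ smooth_map P (q1 t), smooth_map P (q2 t), smooth_map P (q3 t), smooth_map P (q4 t) &
  smooth_map P (q5 t)].
Proof.
have [sa sb] := smooth_crho_exp sol; have [s1 s2 s3 s4 s5] := sw.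
have [_ _ [[k1 k2 _ _ [k4 k5 k6 k7 [l2 l4 l5 l6 l7]]] _ _] _ _] := sol.
have se1 : smooth_map B (e *: w1) := smooth_mapZ e oB s1.
have p1 := smooth_pullback oP ss oB PB se1; have p2 := smooth_pullback oP ss oB PB s2.
have p3 := smooth_pullback oP ss oB PB s3; have p4 := smooth_pullback oP ss oB PB s4.
have p5 := smooth_pullback oP ss oB PB s5.
have F f a := @smooth_mapF _ _ P f a oP; have D a b := @smooth_mapD _ _ P a b oP.
split.
- exact: (F _ _ k1 p1).
- exact: (D _ _ (D _ _ (F _ _ k2 p1) (F _ _ sa p2)) (F _ _ k4 p3)).
- exact: (D _ _ (D _ _ (F _ _ k5 p1) (F _ _ k6 p2)) (F _ _ k7 p3)).
- exact: (D _ _ (D _ _ (F _ _ l2 p1) (F _ _ sb p4)) (F _ _ l4 p5)).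
- exact: (D _ _ (D _ _ (F _ _ l5 p1) (F _ _ l6 p4)) (F _ _ l7 p5)).
Qed.

(** [piP] and [piB \o s] agree only on P; as P is open, their derivatives agree there too. *)
Let jacobian_piP q : P q -> 'J piP q = 'J s q *m 'J piB (s q).
Proof.
move=> Pq; have [[_ [sp _ _]] [_ _ E] _ _ _] := sol; have [spB _ _] := fB.
rewrite -(jacobian_comp oP ss oB PB spB Pq).
have sc : smooth_map P (piB \o s) by move=> j; exact: (smooth_comp oP ss oB PB (spB j)).
apply/matrixP => i j; apply: etrans (jacobianE oP sp i j Pq) _.
apply: etrans _ (esym (jacobianE oP sc i j Pq)).
have EP : {in P, (fun y => piP y 0 j) =1 (fun y => (piB \o s) y 0 j)} by move=> y Py; rewrite -(E y Py).
exact: (eq_pd i oP EP (mem_set Pq)).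
Qed.

Let vertical q v : P q -> v *m 'J piP q = 0 -> [/\ ev1 (q1 t q) v = 0, ev1 (q2 t q) v = 0, ev1 (q3 t q) v = 0,
  ev1 (q4 t q) v = 0 & ev1 (q5 t q) v = 0].
Proof.
move=> Pq; rewrite (jacobian_piP Pq) mulmxA => /(hor (PB Pq))[h1 h2 h3 h4 h5].
rewrite /pcr_transform; simpl; rewrite -> !ev1D, !ev1F, !ev1_pullback, !ev1Z.
by rewrite h1 h2 h3 h4 h5 !mulr0 !addr0.
Qed.

Lemma solution_connection :
  [/\ sp4_Cartan_connection P piP (omega_hat t O),
      basic_curvature_entries P t O k,
      vanishes P (fZ1 k) &
      nonvanishing_multiple P (fA1 k) (inv \o piP)].
Proof.
have Es : system_E P t O k by have [_ _ _ _ E] := sol.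
have [[_ [_ _ fJ]] _ [_ sO _] cP _] := sol.
have key : [/\ sp4_Cartan_connection P piP (omega_hat t O) & basic_curvature_entries P t O k].
  case: O k Es sO cP => O1 O2 O3 O4 O5 [A1 A2 A3 A4 A5 A6 A7 A8 Z1 Z2 Z3 Z4 C1] Es sO cP.
  have /system_EP Es' : system_E P (Quint (q1 t) (q2 t) (q3 t) (q4 t) (q5 t)) (Quint O1 O2 O3 O4 O5)
    (EFunctions A1 A2 A3 A4 A5 A6 A7 A8 Z1 Z2 Z3 Z4 C1) := Es.
  have sO' : [/\ smooth_map P O1, smooth_map P O2, smooth_map P O3, smooth_map P O4 & smooth_map P O5] := sO.
  split; first exact: (system_E_Cartan oP st sO' cP Es' fJ vertical).
  have c32 := curvature_32 oP st sO' Es'; have c23 := curvature_23 oP st sO' Es'.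
  split=> q; rewrite inE => Pq; apply: ev2_inj => u v.
    rewrite [LHS](c32 q u v Pq); rewrite -> ev2D, !ev2F, !ev2W; reflexivity.
  rewrite [LHS](c23 q u v Pq); rewrite -> ev2N, !ev2D, !ev2N, !ev2F, !ev2W; reflexivity.
have [K1 K2] := key; have th := theta_invariants oB sw str sol.
split; [exact: K1|exact: K2|by move=> q; rewrite inE => /th[]|].
have [lam [sl l0 lE]] := I1_inv; have [_ sb] := smooth_crho_exp sol.
pose b q := crho c q * expR (- cphi c q).
have b3 q : P q -> b q ^+ 3 != 0 by move=> /th[_ _ _ b0 _]; rewrite expf_neq0.
(* The factor comes from A1 b^3 = -I1 and I1 = lam inv, with b nowhere zero. *)
exists (fun q => - (lam (s q) * (b q * (b q * b q))^-1)); split.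
- have sls : smooth P (fun q => lam (s q)) by exact: (smooth_comp oP ss oB PB sl).
  have sbb : smooth P (fun q => b q * (b q * b q)) := smoothM oP sb (smoothM oP sb sb).
  have b0 q : P q -> b q * (b q * b q) != 0 := b3 q.
  exact: (smoothN oP (smoothM oP sls (smoothV oP b0 sbb))).
- move=> q Pq; rewrite oppr_eq0 mulf_neq0 ?invr_eq0 //; [exact: l0 (PB Pq)|exact: b3].
- move=> q; rewrite inE => Pq; have [_ _ _ b0] := th q Pq; rewrite (lE _ (mem_set (PB Pq))).
  have [_ [_ _ pE] _ _ _] := sol; have := pE q (mem_set Pq); rewrite /= => ->.
  rewrite -/(b q); have := b3 q Pq; rewrite exprS expr2.
  move: (inv (piP q)) (lam (s q)) (b q * (b q * b q)) (fA1 k q) => x l B3 a B0 E.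
  by apply: (mulIf B0); rewrite E; field.
Qed.

End Solution.

Lemma solutions_connection : gives_Cartan_connection M B piB w inv.
Proof. by move=> P piP s c O k sol; exact: (solution_connection sol). Qed.

(** A solution controls the torsion only on the image of P in B, which need not be all of B. Since P
    projects onto M, this image meets every fibre of B; one point per fibre is enough because I^3 is
    a nonvanishing multiple of a function on M. *)
Lemma question_torsion m : question M B piB w -> M m -> exists b, [/\ B b, piB b = m, K b = 0 & L b = 0].
Proof.
move=> [P [piP [s [c [ O [k sol]]]]]] Mm; have [[_ [_ PM _]] [_ sPB pE] _ _ _] := sol.
move: Mm; rewrite -PM => -[q Pq qm]; have [Kq Lq _ _ _] := theta_invariants oB sw str sol Pq.
exists (s q); split=> //; first by apply: sPB; exists q.
by rewrite -qm -(pE q (mem_set Pq)).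
Qed.

End Solutions.

(** * Adapted coframes *)

Section Flip.
Variables (R : realType) (B : set 'rV[R]_9) (oB : open B).
Variables (w1 w2 w3 w4 w5 v1 v2 v3 v4 : form1 R 9).
Variables (I1 I2 K L T : scal R 9).
Hypothesis sw : [/\ smooth_map B w1, smooth_map B w2, smooth_map B w3, smooth_map B w4 & smooth_map B w5].

Lemma flip_structure_eqs : structure_eqs B w1 w2 w3 w4 w5 v1 v2 v3 v4 I1 I2 K L T ->
  structure_eqs B (- w1) w4 w5 w2 w3 v1 (- v2) (- v4) (- v3)
    (fun x => - I2 x) (fun x => - I1 x) L K (fun x => - T x).
Proof.
have [s1 s2 s3 s4 s5] := sw; move=> [e1 e2 e3 e4 e5]; split=> x Bx u v.
- rewrite (ev2_ext_dN u v Bx s1); rewrite -> (e1 x Bx u v); simpl; rewrite -> !(ev1N w1).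
  by atoms; lra.
- rewrite -> (e4 x Bx u v); simpl; rewrite -> !(ev1N w1), !(ev1N v2), !(ev1N v4).
  by atoms; lra.
- rewrite -> (e5 x Bx u v); simpl; rewrite -> !(ev1N w1), !(ev1N v2), !(ev1N v4).
  by atoms; move: (T x) (I2 x) (L x) => *; lra.
- rewrite -> (e2 x Bx u v); simpl; rewrite -> !(ev1N w1), !(ev1N v2), !(ev1N v3).
  by atoms; lra.
- rewrite -> (e3 x Bx u v); simpl; rewrite -> !(ev1N w1), !(ev1N v2), !(ev1N v3).
  by atoms; move: (T x) (I1 x) (K x) => *; lra.
Qed.

Lemma flip_coframe : coframe B [:: w1; w2; w3; w4; w5; v1; v2; v3; v4] ->
  coframe B [:: - w1; w4; w5; w2; w3; v1; - v2; - v4; - v3].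
Proof.
move=> cB; apply: coframe_intro => // x u Bx u0.
have h1 := u0 (@Ordinal 9 0 isT); have h2 := u0 (@Ordinal 9 1 isT); have h3 := u0 (@Ordinal 9 2 isT).
have h4 := u0 (@Ordinal 9 3 isT); have h5 := u0 (@Ordinal 9 4 isT); have h6 := u0 (@Ordinal 9 5 isT).
have h7 := u0 (@Ordinal 9 6 isT); have h8 := u0 (@Ordinal 9 7 isT); have h9 := u0 (@Ordinal 9 8 isT).
have N (a : form1 R 9) : ev1 ((- a) x) u = 0 -> ev1 (a x) u = 0.
  by rewrite ev1N => /eqP; rewrite oppr_eq0 => /eqP.
apply: (coframe_inj cB Bx) => -[k k9]; simpl; clear u0.
move: k k9 => [|[|[|[|[|[|[|[|[|k]]]]]]]]] k9; simpl;
  [exact: (N _ h1)|exact h4|exact h5|exact h2|exact h3|exact h6|exact: (N _ h7)|exact: (N _ h9)|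
   exact: (N _ h8)|exfalso].
by move: k9; rewrite !ltnS ltn0.
Qed.

End Flip.

Section Adapted.
Variables (R : realType) (M : set 'rV[R]_5) (G H : scal R 5).
Hypothesis hM : para_CR M G H.

Let oM : open M. Proof. by case: hM. Qed.

Lemma smooth_Dx f : smooth M f -> smooth M (Dx H f).
Proof.
have [_ [sG sH] _ _ _] := hM => sf; rewrite /Dx.
have s1 := smooth_pd ix sf; have s2 := smooth_pd iz sf; have s3 := smooth_pd ip sf; have s4 := smooth_pd
  ir sf.
have c1 := @smooth_coord R 5 M ip; have c2 := @smooth_coord R 5 M ir.
exact: (smoothD oM (smoothD oM (smoothD oM s1 (smoothM oM c1 s2)) (smoothM oM c2 s3)) (smoothM oM sH s4)).
Qed.

Lemma smooth_para_CR_coframe : quint_all (@smooth_map R 5 5 M) (para_CR_coframe G H).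
Proof.
have [_ [sG sH] _ _ _] := hM; have d i := @smooth_dcoord R 5 M i.
have sG1 := smooth_Dx sG; have sG2 := smooth_Dx sG1.
have c1 := @smooth_coord R 5 M ip; have c2 := @smooth_coord R 5 M ir.
have A a b f g : smooth_map M a -> smooth M f -> smooth_map M b -> smooth M g ->
    smooth_map M (a - fscale f b - fscale g (dcoord iy)).
  move=> sa sf sb sg.
  exact: (smooth_mapD oM (smooth_mapD oM sa (smooth_mapN oM (smooth_mapF oM sf sb)))
   (smooth_mapN oM (smooth_mapF oM sg (d iy)))).
split; [exact: A|exact: A|exact: A|exact: d|exact: d].
Qed.

Variables (B : set 'rV[R]_9) (piB : 'rV[R]_9 -> 'rV[R]_5).
Variables (w1 w2 w3 w4 w5 v1 v2 v3 v4 : form1 R 9).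
Variables (I1 I2 I3 : scal R 9) (I31 I32 I33 I34 I35 I351 I352 I353 I354 I355 : scal R 9).
Hypothesis hB : adapted_coframe M G H B piB (Quint w1 w2 w3 w4 w5) v1 v2 v3 v4 I1 I2 I3
  (Quint I31 I32 I33 I34 I35) (Quint I351 I352 I353 I354 I355).

Let oB : open B. Proof. by case: hB. Qed.
Let fB : fibred B M piB. Proof. by case: hB. Qed.
Let MB b : B b -> M (piB b). Proof. by have [_ <- _] := fB; move=> Bb; exists b. Qed.

Lemma adapted_smooth :
  [/\ smooth_map B w1, smooth_map B w2, smooth_map B w3, smooth_map B w4 & smooth_map B w5].
Proof.
have [spB _ _] := fB; have [_ _ [c [sc _ [E1 E2 E3 E4 E5]]] _ _] := hB.
have [m1 m2 m3 m4 m5] := smooth_para_CR_coframe.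
have p1 := smooth_pullback oB spB oM MB m1; have p2 := smooth_pullback oB spB oM MB m2.
have p3 := smooth_pullback oB spB oM MB m3; have p4 := smooth_pullback oB spB oM MB m4.
have p5 := smooth_pullback oB spB oM MB m5.
have [k1 k2 kr kp [k4 k5 k6 k7 [l2 l4 l5 l6 l7]]] := sc.
have sa := smoothM oB kr (smooth_expR oB kp); have sb := smoothM oB kr (smooth_expR oB (smoothN oB kp)).
have F f a := @smooth_mapF _ _ B f a oB; have D a b := @smooth_mapD _ _ B a b oB.
have S (a b : form1 R 9) : {in B, a =1 b} -> smooth_map B b -> smooth_map B a.
  by move=> ab sb'; exact: (eq_smooth_map oB (fun x Bx => esym (ab x Bx)) sb').
split.
- exact: (S _ _ E1 (F _ _ k1 p1)).
- exact: (S _ _ E2 (D _ _ (D _ _ (F _ _ k2 p1) (F _ _ sa p2)) (F _ _ k4 p3))).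
- exact: (S _ _ E3 (D _ _ (D _ _ (F _ _ k5 p1) (F _ _ k6 p2)) (F _ _ k7 p3))).
- exact: (S _ _ E4 (D _ _ (D _ _ (F _ _ l2 p1) (F _ _ sb p4)) (F _ _ l4 p5))).
- exact: (S _ _ E5 (D _ _ (D _ _ (F _ _ l5 p1) (F _ _ l6 p4)) (F _ _ l7 p5))).
Qed.

Lemma adapted_horizontal b u : B b -> u *m 'J piB b = 0 ->
  [/\ ev1 (w1 b) u = 0, ev1 (w2 b) u = 0, ev1 (w3 b) u = 0, ev1 (w4 b) u = 0 & ev1 (w5 b) u = 0].
Proof.
move=> Bb u0; have [_ _ [c [_ _ [E1 E2 E3 E4 E5]]] _ _] := hB.
have p a : ev1 (pullback piB a b) u = 0 by rewrite ev1_pullback u0 ev1E big1 // => i _; rewrite mxE mulr0.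
split.
- apply: etrans (congr1 (fun a => ev1 a u) (E1 b (mem_set Bb))) _; simpl.
  by rewrite -> !ev1F, !p; rewrite mulr0.
- apply: etrans (congr1 (fun a => ev1 a u) (E2 b (mem_set Bb))) _; simpl.
  by rewrite -> !ev1D, !ev1F, !p; rewrite !mulr0 !addr0.
- apply: etrans (congr1 (fun a => ev1 a u) (E3 b (mem_set Bb))) _; simpl.
  by rewrite -> !ev1D, !ev1F, !p; rewrite !mulr0 !addr0.
- apply: etrans (congr1 (fun a => ev1 a u) (E4 b (mem_set Bb))) _; simpl.
  by rewrite -> !ev1D, !ev1F, !p; rewrite !mulr0 !addr0.
- apply: etrans (congr1 (fun a => ev1 a u) (E5 b (mem_set Bb))) _; simpl.
  by rewrite -> !ev1D, !ev1F, !p; rewrite !mulr0 !addr0.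
Qed.

Definition adapted_L x := - 2^-1 * I35 x.
Definition adapted_T x := 8^-1 * (2 * I34 x + I352 x).

Ltac ev_all := repeat first
  [ rewrite -> ev2D | rewrite -> ev2N | rewrite -> ev2Z | rewrite -> ev2F | rewrite -> ev2W
  | rewrite -> ev1D | rewrite -> ev1N | rewrite -> ev1Z | rewrite -> ev1F ]; simpl.

Lemma adapted_structure_eqs : structure_eqs B w1 w2 w3 w4 w5 v1 v2 v3 v4 I1 I2 I3 adapted_L adapted_T.
Proof.
have [_ _ _ _ [_ _ [[E1 E2 E3 E4 E5] _] _]] := hB; split=> x Bx u v.
- by rewrite (E1 x (mem_set Bx)); ev_all; atoms; lra.
- by rewrite (E2 x (mem_set Bx)); ev_all; atoms; lra.
- rewrite (E3 x (mem_set Bx)); ev_all; rewrite -/(adapted_T x); atoms.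
  by move: (adapted_T x) (I1 x) (I3 x) => *; lra.
- by rewrite (E4 x (mem_set Bx)); ev_all; atoms; lra.
- rewrite (E5 x (mem_set Bx)); ev_all; rewrite -/(adapted_T x) /adapted_L; atoms.
  by move: (adapted_T x) (I2 x) (I35 x) => *; lra.
Qed.

Lemma adapted_grad_I3 x : B x -> forall u, ev1 (grad I3 x) u = ev_terms1 [:: (I31, w1); (I32, w2); (I33, w3);
    (I34, w4); (I35, w5); (fun x => - 2^-1 * I3 x, v1); (I3, v2)] x u.
Proof.
have [_ _ _ _ [_ _ [_ [E _ _]] _]] := hB; move=> Bx u.
by rewrite (E x (mem_set Bx)); ev_all; atoms;
  move: (I3 x) (I31 x) (I32 x) (I33 x) (I34 x) (I35 x) => *; lra.
Qed.

Lemma adapted_grad_I35 x : B x -> forall u, ev1 (grad I35 x) u = ev_terms1 [:: (I351, w1); (I352, w2);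
    (fun x => 4 * I3 x, w3); (I354, w4); (I355, w5); (fun x => - 2^-1 * I35 x, v1);
    (fun x => -1 * I35 x, v2)] x u.
Proof.
have [_ _ _ _ [_ _ [_ [_ E E353]] _]] := hB; move=> Bx u.
rewrite (E x (mem_set Bx)); ev_all; rewrite (E353 x (mem_set Bx)); atoms.
by move: (I35 x) (I351 x) (I352 x) (I3 x) (I354 x) (I355 x) => *; lra.
Qed.

Let cB : coframe B [:: w1; w2; w3; w4; w5; v1; v2; v3; v4].
Proof. by case: hB => _ _ _ []. Qed.
Let sv : [/\ smooth_map B v1, smooth_map B v2, smooth_map B v3 & smooth_map B v4].
Proof. by case: hB => _ _ _ []. Qed.

Lemma vanishes_I33 : vanishes B I33 -> vanishes B I3.
Proof.
have [_ _ _ _ [[_ _ s3] [[s31 s32 s33 s34 s35] _] _ _]] := hB.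
exact: (I33_zero oB cB adapted_smooth sv adapted_structure_eqs s3 s31 s32 s34 s35 adapted_grad_I3
  adapted_grad_I35).
Qed.

Lemma vanishes_I355 : vanishes B I355 -> vanishes B I3.
Proof.
have [_ _ _ _ [[_ _ s3] [[s31 s32 s33 s34 s35] [s351 s352 s353 s354 s355]] _ _]] := hB.
exact: (I355_zero oB cB adapted_smooth sv adapted_structure_eqs s3 s35 s351 s352 s354 adapted_grad_I3
  adapted_grad_I35).
Qed.

(** The coframe derivatives are the coefficients of d I3 and d I35 in a coframe. If I3 = 0 the first
    five vanish, among them I35, and hence those of d I35 as well; T is a combination of one from
    each family. *)
Lemma vanishes_derivatives : vanishes B I3 ->
  [/\ vanishes B I33, vanishes B I355, vanishes B adapted_L & vanishes B adapted_T].
Proof.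
move=> I3_0.
have d3 x e : B x -> ev_terms1 [:: (I31, w1); (I32, w2); (I33, w3); (I34, w4); (I35, w5);
    (fun x => - 2^-1 * I3 x, v1); (I3, v2)] x e = 0.
  by move=> Bx; rewrite -(adapted_grad_I3 Bx) (eq_grad oB I3_0 Bx) ev1_grad_cst.
have I33_0 : vanishes B I33.
  move=> x; rewrite inE => Bx; have [e [[a1 a2 a3 a4 a5] [b1 b2 b3 b4]]] := coframe9_vec cB Bx 0 0 1 0 0
    0 0 0 0.
  have := d3 x e Bx; simpl; rewrite -> a1, a2, a3, a4, a5, b1, b2; lra.
have I34_0 : vanishes B I34.
  move=> x; rewrite inE => Bx; have [e [[a1 a2 a3 a4 a5] [b1 b2 b3 b4]]] := coframe9_vec cB Bx 0 0 0 1 0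
    0 0 0 0.
  have := d3 x e Bx; simpl; rewrite -> a1, a2, a3, a4, a5, b1, b2; lra.
have I35_0 : vanishes B I35.
  move=> x; rewrite inE => Bx; have [e [[a1 a2 a3 a4 a5] [b1 b2 b3 b4]]] := coframe9_vec cB Bx 0 0 0 0 1
    0 0 0 0.
  have := d3 x e Bx; simpl; rewrite -> a1, a2, a3, a4, a5, b1, b2; lra.
have d35 x e : B x -> ev_terms1 [:: (I351, w1); (I352, w2); (fun x => 4 * I3 x, w3); (I354, w4); (I355, w5);
    (fun x => - 2^-1 * I35 x, v1); (fun x => -1 * I35 x, v2)] x e = 0.
  by move=> Bx; rewrite -(adapted_grad_I35 Bx) (eq_grad oB I35_0 Bx) ev1_grad_cst.
split=> //.
- move=> x; rewrite inE => Bx; have [e [[a1 a2 a3 a4 a5] [b1 b2 b3 b4]]] := coframe9_vec cB Bx 0 0 0 0 1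
    0 0 0 0.
  have := d35 x e Bx; simpl; rewrite -> a1, a2, a3, a4, a5, b1, b2; lra.
- by move=> x Bx; rewrite /adapted_L I35_0 // mulr0.
- move=> x; rewrite inE => Bx; have [e [[a1 a2 a3 a4 a5] [b1 b2 b3 b4]]] := coframe9_vec cB Bx 0 1 0 0 0
    0 0 0 0.
  have := d35 x e Bx; have := I34_0 x (mem_set Bx); rewrite /adapted_T; simpl.
  rewrite -> a1, a2, a3, a4, a5, b1, b2; lra.
Qed.

Lemma GH_invariant0 b : B b -> I3 b = 0 -> GH_invariant G H (piB b) = 0.
Proof.
have [_ _ _ _ [_ _ _ [_ _ [l [_ l0 E]]]]] := hB; move=> Bb /eqP.
by rewrite (E b (mem_set Bb)) mulf_eq0 (negbTE (l0 b Bb)) => /eqP.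
Qed.

Lemma vanishes_GH : vanishes M (GH_invariant G H) <-> vanishes B I3.
Proof.
have [_ _ _ _ [_ _ _ [_ _ [l [_ _ E]]]]] := hB; have [_ BM _] := fB.
split=> [GH0 x|I30 m]; rewrite inE.
  by move=> Bx; rewrite (E x (mem_set Bx)) /= GH0 ?mulr0 ?inE //; exact: MB.
by rewrite -BM => -[b Bb <-]; exact: GH_invariant0 Bb (I30 b (mem_set Bb)).
Qed.

(** The flipped structure equations hold with -w1, whereas Q2 is posed with w1. The sign e = -1 in
    front of the first form reconciles the two. *)
Lemma flip_quintE : flip (Quint w1 w2 w3 w4 w5) = Quint ((-1) *: (- w1)) w4 w5 w2 w3.
Proof. by rewrite /flip scaleN1r opprK. Qed.

Lemma quint_scale1 : Quint w1 w2 w3 w4 w5 = Quint (1 *: w1) w2 w3 w4 w5.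
Proof. by rewrite scale1r. Qed.

Let flip_smooth :
  [/\ smooth_map B (- w1), smooth_map B w4, smooth_map B w5, smooth_map B w2 & smooth_map B w3].
Proof. by have [s1 s2 s3 s4 s5] := adapted_smooth; split; [exact: smooth_mapN|exact s4|exact s5|exact
  s2|exact s3]. Qed.

Let flip_horizontal b u : B b -> u *m 'J piB b = 0 ->
  [/\ ev1 ((- w1) b) u = 0, ev1 (w4 b) u = 0, ev1 (w5 b) u = 0, ev1 (w2 b) u = 0 & ev1 (w3 b) u = 0].
Proof. by move=> Bb /(adapted_horizontal Bb)[h1 h2 h3 h4 h5]; split=> //; rewrite ev1N h1 oppr0. Qed.

Let flip_str := flip_structure_eqs adapted_smooth adapted_structure_eqs.

Let smooth_I : smooth B I1 /\ smooth B I2.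
Proof. by have [_ _ _ _ [[]]] := hB. Qed.

Lemma connection_wunschmann : gives_Cartan_connection M B piB (Quint w1 w2 w3 w4 w5) (wunschmann H).
Proof.
have [_ _ _ _ [_ _ _ [I1_w _ _]]] := hB; rewrite quint_scale1.
exact: (solutions_connection oB adapted_smooth adapted_structure_eqs fB adapted_horizontal I1_w).
Qed.

Lemma connection_monge : gives_Cartan_connection M B piB (flip (Quint w1 w2 w3 w4 w5)) (monge G).
Proof.
have [_ _ _ _ [_ _ _ [_ [l [sl l0 lE]] _]]] := hB; rewrite flip_quintE.
apply: (solutions_connection oB flip_smooth flip_str fB flip_horizontal).
(* The flip puts -I2 in the place of I1, so the multiplier changes sign. *)
exists (fun x => - l x); split; first exact: smoothN.
  by move=> x Bx; rewrite oppr_eq0; exact: l0.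
by move=> x Bx; rewrite (lE x Bx) mulNr.
Qed.

Lemma Q1P : Q1 M B piB (Quint w1 w2 w3 w4 w5) <-> vanishes B I3.
Proof.
rewrite /Q1 quint_scale1; split=> [q|I30].
  apply/vanishes_GH => m; rewrite inE => Mm.
  have [b [Bb <- I3b _]] := question_torsion oB adapted_smooth adapted_structure_eqs q Mm.
  exact: GH_invariant0.
have [_ _ L0 T0] := vanishes_derivatives I30.
apply: (flat_question oB cB adapted_smooth sv smooth_I adapted_structure_eqs _ fB (mulr1 1)).
by split; [exact: I30|exact: L0|exact: T0].
Qed.

Lemma Q2P : Q2 M B piB (Quint w1 w2 w3 w4 w5) <-> vanishes B I3.
Proof.
rewrite /Q2 flip_quintE; split=> [q|I30].
  apply/vanishes_GH => m; rewrite inE => Mm.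
  (* After the flip I^3 takes the place of L, so the second vanishing statement is the relevant
     one. *)
  have [b [Bb <- _ I3b]] := question_torsion oB flip_smooth flip_str q Mm.
  exact: GH_invariant0.
have [_ _ L0 T0] := vanishes_derivatives I30.
have sv' : [/\ smooth_map B v1, smooth_map B (- v2), smooth_map B (- v4) & smooth_map B (- v3)].
  by have [r1 r2 r3 r4] := sv; split; [exact r1|exact: smooth_mapN|exact: smooth_mapN|exact: smooth_mapN].
have sI' : smooth B (fun x => - I2 x) /\ smooth B (fun x => - I1 x).
  by have [s1 s2] := smooth_I; split; exact: smoothN.
apply: (flat_question oB (flip_coframe cB) flip_smooth sv' sI' flip_str _ fB _); last by rewrite mulrNN mulr1.
by split; [exact: L0|exact: I30|move=> x Bx; rewrite T0 // oppr0].
Qed.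

End Adapted.

Theorem theorem5p2 (R : realType) (M : set 'rV[R]_5) (G H : 'rV[R]_5 -> R)
    (hM : para_CR M G H)
    (B : set 'rV[R]_9) (piB : 'rV[R]_9 -> 'rV[R]_5)
    (w : quint ('rV[R]_9 -> 'rV[R]_9))
    (v1 v2 v3 v4 : 'rV[R]_9 -> 'rV[R]_9)
    (I1 I2 I3 : 'rV[R]_9 -> R) (dI3 dI35 : quint ('rV[R]_9 -> R))
    (hB : adapted_coframe M G H B piB w v1 v2 v3 v4 I1 I2 I3 dI3 dI35) :
  let I3_3 := q3 dI3 in
  let I3_55 := q5 dI35 in
  [/\ (Q1 M B piB w <-> vanishes B I3_3) /\
        (vanishes B I3_3 -> gives_Cartan_connection M B piB w (wunschmann H)),
      (Q2 M B piB w <-> vanishes B I3_55) /\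
        (vanishes B I3_55 ->
           gives_Cartan_connection M B piB (flip w) (monge G)),
      (vanishes B I3_3 -> vanishes B I3) /\
        (vanishes B I3_55 -> vanishes B I3) &
      (Q1 M B piB w <-> vanishes M (GH_invariant G H)) /\
        (Q2 M B piB w <-> vanishes M (GH_invariant G H))].
Proof.
case: w dI3 dI35 hB => w1 w2 w3 w4 w5 [I31 I32 I33 I34 I35] [I351 I352 I353 I354 I355] hB /=.
have z33 := vanishes_I33 hM hB; have z355 := vanishes_I355 hM hB.
have zd := vanishes_derivatives hB; have GHE := vanishes_GH hB.
have Q1E := Q1P hM hB; have Q2E := Q2P hM hB.
split.
- split; last by move=> _; exact (connection_wunschmann hM hB).
  by rewrite Q1E; split=> [/zd[]|/z33].
- split; last by move=> _; exact (connection_monge hM hB).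
  by rewrite Q2E; split=> [/zd[]|/z355].
- by split.
- by split; [rewrite Q1E GHE|rewrite Q2E GHE].
Qed.
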